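(* Let $F:U\to\mathbb P^{r',s',t'}$ be a local orthogonal map, where $U\subset\mathbb P^{r,s}$ is a connected open set containing a null point. If $\min\{r',s'\}\le 2\min\{r,s\}-2$, then $F$ is either null or quasi-linear. If in addition $F$ maps at least one positive point to a positive point, or at least one negative point to a negative point, then $F$ is quasi-standard.
   Context: Let $r,s,t\ge 0$ be integers with $n=r+s+t>0$. $\mathbb C^{r,s,t}$ denotes $\mathbb C^n$ equipped with the (possibly degenerate, indefinite) Hermitian form $\langle z,w\rangle_{r,s,t}=\sum_{j=1}^{r}z_j\bar w_j-\sum_{j=r+1}^{r+s}z_j\bar w_j$, and $\mathbb P^{r,s,t}$ is its projectivization; $\mathbb P^{r,s}=\mathbb P^{r,s,0}$. A point $[z]$ is positive, negative or null according as $\langle z,z\rangle_{r,s,t}>0$, $<0$ or $=0$; $[z]\perp[w]$ if $\langle z,w\rangle_{r,s,t}=0$. A complex linear subspace $H$ (or $\mathbb PH$) is a null space if the form vanishes identically on $H$. A holomorphic map $F:U\to\mathbb P^{r',s',t'}$ on a connected open set $U$ containing a null point is a local orthogonal map if $F(p)\perp F(q)$ for all $p,q\in U$ with $p\perp q$. $F$ is linear if it extends to a rational map induced by a linear map of the underlying vector spaces; standard if it is induced by a linear isometry $\mathbb C^{r,s,t}\to\mathbb C^{r',s',t'}$ (a linear map $L$ with $\langle Lu,Lv\rangle_{r',s',t'}=\langle u,v\rangle_{r,s,t}$); null if $F(U)$ is contained in a null space. $F$ is quasi-standard (resp. quasi-linear) if either $F$ is standard (resp. linear), or there is a decomposition $\mathbb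 C^{r',s',t'}=A\oplus B$ into nonzero subspaces with $\langle a,b\rangle_{r',s',t'}=0$ for all $a\in A,b\in B$ such that $\pi_A\circ F$ is standard (resp. linear) and $\pi_B\circ F$ is null, where $\pi_A:\mathbb P^{r',s',t'}\dashrightarrow\mathbb PA$, $\pi_B:\mathbb P^{r',s',t'}\dashrightarrow\mathbb PB$ are induced by the linear projections, and $\mathbb PA,\mathbb PB$ carry the restricted forms. *)

(* Defs.v *)
(* C := R[i] for R : realType, i.e. the
   complex numbers, viewed as a numFieldType (so that MathComp-Analysis gives
   the vector spaces 'rV[C]_n their normed topology, and "differentiable" over
   the scalar field C means complex (holomorphic) differentiability). *)
From HB Require Import structures.
From mathcomp Require Import all_boot all_order all_algebra.
From mathcomp Require Import complex.
From mathcomp Require Import all_classical all_reals all_analysis.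
Import Order.TTheory GRing.Theory Num.Theory.
Import numFieldNormedType.Exports.
Local Open Scope ring_scope.
Local Open Scope classical_set_scope.

Definition CC (R : realType) : numFieldType := R[i].

Definition hsign (R : realType) (r s : nat) (j : nat) : CC R :=
  if (j < r)%N then 1 else if (j < r + s)%N then -1 else 0.

Definition herm (R : realType) (n r s : nat) (z w : 'rV[CC R]_n) : CC R :=
  \sum_(j < n) hsign R r s j * z 0 j * (conjc (w 0 j : R[i]) : CC R).

Definition proj_eq (R : realType) (m : nat) (u v : 'rV[CC R]_m) : Prop :=
  exists c : CC R, c != 0 /\ v = c *: u.

(* A connected open subset U of P^{n-1}, represented by its cone
   (preimage in C^n \ {0}): open, connected, nonempty, 0 \notin U,
   stable under multiplication by nonzero scalars. *)
Definition proj_domain (R : realType) (n : nat) (U : set 'rV[CC R]_n) : Prop :=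
  [/\ open U, connected U, U !=set0, ~ U 0
    & forall x c, U x -> c != 0 -> U (c *: x)].

(* F : U -> P^{m-1} represented on the cone: F x is a representative of the
   image point of [x]; it is well defined projectively and holomorphic, i.e.
   it admits local holomorphic (nowhere zero) lifts near every point. *)
Definition proj_holomorphic (R : realType) (n m : nat) (U : set 'rV[CC R]_n)
    (F : 'rV[CC R]_n -> 'rV[CC R]_m) : Prop :=
  (forall x c, U x -> c != 0 -> proj_eq R m (F x) (F (c *: x))) /\
  (forall p, U p -> exists W : set 'rV[CC R]_n, nbhs p W /\
     exists G : 'rV[CC R]_n -> 'rV[CC R]_m,
       forall x, W x -> U x ->
         [/\ differentiable G x, G x != 0 & proj_eq R m (F x) (G x)]).

Definition local_orthogonal (R : realType) (r s r' s' t' : nat)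
    (U : set 'rV[CC R]_(r + s)) (F : 'rV[CC R]_(r + s) -> 'rV[CC R]_(r' + s' + t'))
    : Prop :=
  forall p q, U p -> U q -> herm R (r + s) r s p q = 0 -> herm R (r' + s' + t') r' s' (F p) (F q) = 0.

(* The (partial) map p |-> [G p] (undefined where G p = 0) extends to the
   rational map induced by the linear map x |-> x *m M: the two are both
   defined somewhere on U and agree wherever both are defined. *)
Definition induced_by (R : realType) (n m : nat) (U : set 'rV[CC R]_n)
    (G : 'rV[CC R]_n -> 'rV[CC R]_m) (M : 'M[CC R]_(n, m)) : Prop :=
  (exists p, U p /\ G p != 0 /\ p *m M != 0) /\
  (forall p, U p -> G p != 0 -> p *m M != 0 -> proj_eq R m (G p) (p *m M)).

Definition isometry_mx (R : realType) (r s r' s' t' : nat)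
    (M : 'M[CC R]_(r + s, r' + s' + t')) : Prop :=
  forall u v, herm R (r' + s' + t') r' s' (u *m M) (v *m M) = herm R (r + s) r s u v.

Definition linear_map (R : realType) (r s r' s' t' : nat)
    (U : set 'rV[CC R]_(r + s)) (F : 'rV[CC R]_(r + s) -> 'rV[CC R]_(r' + s' + t')) :=
  exists M, induced_by R (r + s) (r' + s' + t') U F M.

Definition standard_map (R : realType) (r s r' s' t' : nat)
    (U : set 'rV[CC R]_(r + s)) (F : 'rV[CC R]_(r + s) -> 'rV[CC R]_(r' + s' + t')) :=
  exists M, isometry_mx R r s r' s' t' M /\ induced_by R (r + s) (r' + s' + t') U F M.

Definition null_space (R : realType) (m r' s' k : nat) (H : 'M[CC R]_(k, m)) : Prop :=
  forall x y : 'rV[CC R]_m, (x <= H)%MS -> (y <= H)%MS -> herm R m r' s' x y = 0.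

Definition null_map (R : realType) (n r' s' t' : nat)
    (U : set 'rV[CC R]_n) (F : 'rV[CC R]_n -> 'rV[CC R]_(r' + s' + t')) : Prop :=
  exists k (H : 'M[CC R]_(k, r' + s' + t')),
    null_space R (r' + s' + t') r' s' k H /\ forall p, U p -> (F p <= H)%MS.

Definition orth_decomp (R : realType) (r' s' t' : nat)
    (A B : 'M[CC R]_(r' + s' + t')) : Prop :=
  [/\ (A + B :=: 1%:M)%MS, (A :&: B = 0)%MS, A != 0, B != 0 &
      forall a b : 'rV[CC R]_(r' + s' + t'),
        (a <= A)%MS -> (b <= B)%MS -> herm R (r' + s' + t') r' s' a b = 0].

Definition standard_into (R : realType) (r s r' s' t' : nat)
    (U : set 'rV[CC R]_(r + s)) (A B : 'M[CC R]_(r' + s' + t'))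
    (F : 'rV[CC R]_(r + s) -> 'rV[CC R]_(r' + s' + t')) : Prop :=
  exists M : 'M[CC R]_(r + s, r' + s' + t'),
    (M <= A)%MS /\ isometry_mx R r s r' s' t' M /\
    induced_by R (r + s) (r' + s' + t') U (fun p => F p *m proj_mx A B) M.

Definition linear_into (R : realType) (r s r' s' t' : nat)
    (U : set 'rV[CC R]_(r + s)) (A B : 'M[CC R]_(r' + s' + t'))
    (F : 'rV[CC R]_(r + s) -> 'rV[CC R]_(r' + s' + t')) : Prop :=
  exists M : 'M[CC R]_(r + s, r' + s' + t'),
    (M <= A)%MS /\ induced_by R (r + s) (r' + s' + t') U (fun p => F p *m proj_mx A B) M.

Definition null_into (R : realType) (n r' s' t' : nat)
    (U : set 'rV[CC R]_n) (A B : 'M[CC R]_(r' + s' + t'))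
    (F : 'rV[CC R]_n -> 'rV[CC R]_(r' + s' + t')) : Prop :=
  exists k (H : 'M[CC R]_(k, r' + s' + t')),
    (H <= B)%MS /\ null_space R (r' + s' + t') r' s' k H /\
    forall p, U p -> (F p *m proj_mx B A <= H)%MS.

Definition quasi_standard (R : realType) (r s r' s' t' : nat)
    (U : set 'rV[CC R]_(r + s)) (F : 'rV[CC R]_(r + s) -> 'rV[CC R]_(r' + s' + t')) :=
  standard_map R r s r' s' t' U F \/
  exists A B, orth_decomp R r' s' t' A B /\ standard_into R r s r' s' t' U A B F /\
    null_into R (r + s) r' s' t' U A B F.

Definition quasi_linear (R : realType) (r s r' s' t' : nat)
    (U : set 'rV[CC R]_(r + s)) (F : 'rV[CC R]_(r + s) -> 'rV[CC R]_(r' + s' + t')) :=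
  linear_map R r s r' s' t' U F \/
  exists A B, orth_decomp R r' s' t' A B /\ linear_into R r s r' s' t' U A B F /\
    null_into R (r + s) r' s' t' U A B F.

(* Main.v *)
Require Import Defs.
From HB Require Import structures.
From mathcomp Require Import all_boot all_order all_algebra.
From mathcomp Require Import complex ring lra zify.
From mathcomp Require Import all_classical all_reals all_analysis.
Set Implicit Arguments.
Unset Strict Implicit.
Unset Printing Implicit Defensive.
Import Order.TTheory GRing.Theory Num.Theory.
Import numFieldNormedType.Exports.
Local Open Scope ring_scope.

(** Let [g] be a local holomorphic lift of the orthogonal map on a box around a null
    point, and [H z w] the target form on [g z], [g w]; it vanishes when [z] and [w]
    are orthogonal. Everything rests on the identity theorem along segments.

    If [a] points of rank at most [k = min r s] have independent images, they can be
    deformed, keeping the images independent, to points spanning a null space; their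
    images then span a null space of dimension [a], whence [a <= min r' s' <= 2k - 2].
    So for some [j < k] the largest number of independent images of points of rank at
    most [j] grows by at most one when [j] is replaced by [j + 1]. At a family [X]
    realizing it, differentiating the orthogonality relation shows that, modulo the
    span of [g X], the map [g] is a multiple of a linear map. This yields
      [H z1 y1 * H z2 y2 * <z1,y2> * <z2,y1> = H z1 y2 * H z2 y1 * <z1,y1> * <z2,y2>],
    first for [y1], [y2] orthogonal to [X] and then for all points by moving [X].
    Either [H = 0], and [g] spans a null space, or
    [H z w = ka * phi z * conj (phi w) * <z,w>] with [ka] real: then [g / phi] is the
    sum of a linear map multiplying the form by [ka] and of a map into a null space
    orthogonal to its image. The orthogonal projection onto that image splits the
    target space; both halves of the statement spread over [U] by connectedness, and a
    point whose sign is preserved forces [ka > 0]. *)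

(** * Complex derivatives and trapezoidal contour sums *)

(** The form is conjugate linear in its second argument, so null or orthogonal configurations can be
    followed only along real parameters. Identities are therefore first known on a short real
    interval and carried to the far end of a segment by a holomorphic function; where a conjugate
    occurs, it is replaced by a polynomial that agrees with it for real parameters. The bound
    [2k - 2] comes from counting by twos: one independent image at rank one and a gain of at least
    two at each of the next [k - 1] ranks would give [2k - 1] at rank [k]. A gain of at most one
    means that two points added within one extra dimension never have independent images modulo a
    maximal span; letting one of them tend to a row of [X] turns this dependence into
    proportionality to a derivative. The complex analysis uses difference quotients alone. Contour
    sums of [1/z] are only bounded below, so Cauchy's formula becomes an estimate with a lossy
    constant, which high powers of a peak function remove. The radical of the target form is cut off
    before null spaces are counted and returns in the null summand. *)

Section OneVariable.
Variable R : realType.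
Local Notation C := R[i].
Local Notation nm := (@ComplexField.Normc.normc R).
Local Notation rC := (@real_complex_def R (Phant R)).
Local Notation re := (@complex.Re R).
Local Notation im := (@complex.Im R).

Lemma nm0 : nm 0 = 0. Proof. exact: ComplexField.Normc.normc0. Qed.
Lemma nm1 : nm 1 = 1. Proof. exact: ComplexField.Normc.normc1. Qed.
Lemma nmM x y : nm (x * y) = nm x * nm y.
Proof. exact: ComplexField.Normc.normcM. Qed.
Lemma nmV x : nm x^-1 = (nm x)^-1.
Proof. exact: ComplexField.Normc.normcV. Qed.
Lemma nmN x : nm (- x) = nm x. Proof. exact: normcN. Qed.
Lemma nmD x y : nm (x + y) <= nm x + nm y. Proof. exact: le_normcD. Qed.
Lemma nmB x y : nm (x - y) <= nm x + nm y.
Proof. by rewrite -(nmN y); exact: nmD. Qed.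
Lemma nmC x y : nm (x - y) = nm (y - x).
Proof. by rewrite -nmN opprB. Qed.
Lemma nm_ge0 x : 0 <= nm x.
Proof. by case: x => a b /=; exact: sqrtr_ge0. Qed.
Lemma nm_eq0 x : (nm x == 0) = (x == 0).
Proof.
apply/eqP/eqP => [|->]; [exact: ComplexField.Normc.eq0_normc|exact: nm0].
Qed.
Lemma nm_gt0 x : (0 < nm x) = (x != 0).
Proof. by rewrite lt_def nm_ge0 andbT nm_eq0. Qed.
Lemma nm_real (x : R) : nm (rC x) = `|x|.
Proof. by rewrite /= expr0n /= addr0 sqrtr_sqr. Qed.
Lemma nmX x n : nm (x ^+ n) = nm x ^+ n.
Proof. by elim: n => [|n IH]; rewrite ?nm1 // !exprS nmM IH. Qed.
Lemma nm_norm (x : C) : `|x| = rC (nm x).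
Proof. by rewrite normc_def; case: x. Qed.
Lemma nm_nat n : nm n%:R = n%:R.
Proof. by rewrite -(rmorph_nat rC) nm_real ger0_norm. Qed.
Lemma nm_Re (x : C) : `|re x| <= nm x.
Proof.
by case: x => a b /=; rewrite -sqrtr_sqr ler_wsqrtr // lerDl sqr_ge0.
Qed.
Lemma nm_Im (x : C) : `|im x| <= nm x.
Proof.
by case: x => a b /=; rewrite -sqrtr_sqr ler_wsqrtr // lerDr sqr_ge0.
Qed.

Lemma nm_small_eq0 x : (forall e, 0 < e -> nm x <= e) -> x = 0.
Proof.
move=> H; apply/eqP; rewrite -nm_eq0 eq_le nm_ge0 andbT.
by rewrite leNgt; apply/negP => p; have := H (nm x / 2) (divr_gt0 p (ltr0Sn _ 1)); lra.
Qed.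

Definition cder (f : C -> C) (z l : C) := forall e, 0 < e ->
  exists2 d, 0 < d & forall w, nm w < d -> nm (f (z + w) - f z - l * w) <= e * nm w.
Definition cdiff f z := exists l, cder f z l.

Lemma cder_const c z : cder (fun=> c) z 0.
Proof.
move=> e e0; exists 1 => // w _.
by rewrite subrr mul0r subr0 nm0 mulr_ge0 ?nm_ge0 // ltW.
Qed.

Lemma cder_id z : cder id z 1.
Proof.
move=> e e0; exists 1 => // w _.
have -> : id (z + w) - id z - 1 * w = 0 by rewrite /=; ring.
by rewrite nm0 mulr_ge0 ?nm_ge0 // ltW.
Qed.

Lemma cder_cont f z l : cder f z l -> forall e, 0 < e ->
  exists2 d, 0 < d & forall w, nm w < d -> nm (f (z + w) - f z) <= e.
Proof.
move=> fl e e0; have [d d0 H] := fl 1 ltr01.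
have L0 : 0 < nm l + 1 by rewrite ltr_wpDl ?nm_ge0.
exists (Num.min d (e / (nm l + 1))); first by rewrite lt_min d0 divr_gt0.
move=> w; rewrite lt_min => /andP[wd we].
have -> : f (z + w) - f z = (f (z + w) - f z - l * w) + l * w by ring.
apply: (le_trans (nmD _ _)); apply: le_trans (_ : 1 * nm w + nm l * nm w <= _).
  by rewrite nmM lerD2r; exact: H.
rewrite -mulrDl addrC mulrC; move: we; rewrite ltr_pdivlMr // => /ltW.
by [].
Qed.

Lemma cder_add f g z l k : cder f z l -> cder g z k ->
  cder (fun t => f t + g t) z (l + k).
Proof.
move=> fl gk e e0; have e20 : 0 < e / 2 by rewrite divr_gt0.
have [d d0 H] := fl _ e20; have [d' d'0 H'] := gk _ e20.
exists (Num.min d d'); first by rewrite lt_min d0.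
move=> w; rewrite lt_min => /andP[wd wd'].
have -> : f (z + w) + g (z + w) - (f z + g z) - (l + k) * w =
  (f (z + w) - f z - l * w) + (g (z + w) - g z - k * w) by ring.
apply: (le_trans (nmD _ _)).
have -> : e * nm w = e / 2 * nm w + e / 2 * nm w by field.
by apply: lerD; [exact: H|exact: H'].
Qed.

Lemma cder_mul f g z l k : cder f z l -> cder g z k ->
  cder (fun t => f t * g t) z (l * g z + f z * k).
Proof.
move=> fl gk e e0.
pose K := nm (g z) + nm (f z) + nm l + 2.
have K0 : 0 < K.
  have := nm_ge0 (g z); have := nm_ge0 (f z); have := nm_ge0 l; rewrite /K; lra.
have e30 : 0 < Num.min 1 (e / 3 / K) by rewrite lt_min ltr01 !divr_gt0.
set e3 := Num.min _ _ in e30.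
have e31 : e3 * K <= e / 3.
  by rewrite -ler_pdivlMr // /e3 ge_min lexx orbT.
have e3le1 : e3 <= 1 by rewrite ge_min lexx.
have [d d0 H] := fl _ e30; have [d' d'0 H'] := gk _ e30.
have [c c0 H''] := cder_cont gk e30.
exists (Num.min d (Num.min d' c)); first by rewrite !lt_min d0 d'0.
move=> w; rewrite !lt_min => /and3P[wd wd' wc].
have -> : f (z + w) * g (z + w) - f z * g z - (l * g z + f z * k) * w =
  (f (z + w) - f z - l * w) * (g (z + w) - g z) + (f (z + w) - f z - l * w) * g z
   + l * w * (g (z + w) - g z) + f z * (g (z + w) - g z - k * w) by ring.
have A1 := H w wd; have A2 := H' w wd'; have A3 := H'' w wc.
apply: (le_trans (nmD _ _)); rewrite (nmM (f z)).
apply: (le_trans (lerD (nmD _ _) (lexx _))); rewrite (nmM (l * w)) (nmM l).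
apply: (le_trans (lerD (lerD (nmD _ _) (lexx _)) (lexx _))).
rewrite !(nmM (f (z + w) - f z - l * w)).
set u := nm (f (z + w) - f z - l * w) in A1 *.
set v := nm (g (z + w) - g z) in A3 *.
set x := nm (g (z + w) - g z - k * w) in A2 *.
have u0 : 0 <= u := nm_ge0 _. have v0 : 0 <= v := nm_ge0 _.
have x0 : 0 <= x := nm_ge0 _. have w0 := nm_ge0 w.
have gz := nm_ge0 (g z); have fz := nm_ge0 (f z); have l0 := nm_ge0 l.
have B1 : u * v <= e3 * nm w.
  apply: le_trans (ler_pM u0 v0 A1 (le_trans A3 e3le1)) _; by rewrite mulr1.
have B2 : u * nm (g z) <= e3 * nm w * nm (g z) by rewrite ler_wpM2r.
have B3 : nm l * nm w * v <= nm l * nm w * e3 by rewrite ler_wpM2l ?mulr_ge0.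
have B4 : nm (f z) * x <= nm (f z) * (e3 * nm w) by rewrite ler_wpM2l.
have B5 : e3 * K * nm w <= e / 3 * nm w by rewrite ler_wpM2r.
have B6 : e / 3 * nm w <= e * nm w by rewrite ler_wpM2r // ler_pdivrMr // ler_peMr ?ltW ?ltr1n.
apply: le_trans (lerD (lerD (lerD B1 B2) B3) B4) _.
apply: (le_trans _ (le_trans B5 B6)).
have -> : e3 * K * nm w = e3 * nm w + e3 * nm w * nm (g z) + nm l * nm w * e3 +
  nm (f z) * (e3 * nm w) + e3 * nm w by rewrite /K; ring.
by rewrite lerDl mulr_ge0 // ltW.
Qed.

Lemma cder_inv f z l : f z != 0 -> cder f z l -> cder (fun t => (f t)^-1) z (- l / (f z) ^+ 2).
Proof.
move=> fz0 fl e e0; have fzp : 0 < nm (f z) by rewrite nm_gt0.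
set a := nm (f z) in fzp.
pose K := 2 * (a + nm l + 1) / a ^+ 3.
have K0 : 0 < K.
  rewrite /K divr_gt0 ?exprn_gt0 // mulr_gt0 //; have := nm_ge0 l; lra.
have e10 : 0 < Num.min 1 (Num.min (e / K) (a / 2)) by rewrite !lt_min ltr01 (divr_gt0 e0 K0) (divr_gt0 fzp).
set e1 := Num.min _ _ in e10.
have e1K : e1 * K <= e by rewrite -ler_pdivlMr // /e1 !ge_min lexx orbT.
have e1a : e1 <= a / 2 by rewrite /e1 !ge_min lexx !orbT.
have [d d0 H] := fl _ e10; have [c c0 H'] := cder_cont fl e10.
exists (Num.min d c); first by rewrite lt_min d0.
move=> w; rewrite lt_min => /andP[wd wc].
have A1 := H w wd; have A2 := H' w wc.
have fw : a / 2 <= nm (f (z + w)).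
  have : a <= nm (f (z + w)) + nm (f (z + w) - f z).
    by rewrite /a -[X in nm X <= _](subKr (f (z + w))); exact: nmB.
  lra.
have fw0 : f (z + w) != 0 by rewrite -nm_gt0 (lt_le_trans _ fw) // divr_gt0.
have -> : (f (z + w))^-1 - (f z)^-1 - - l / f z ^+ 2 * w =
  (- (f z * (f (z + w) - f z - l * w)) + l * w * (f (z + w) - f z)) / (f z ^+ 2 * f (z + w)).
  by field; rewrite fz0 fw0.
rewrite nmM nmV nmM nmX -/a ler_pdivrMr ?mulr_gt0 ?exprn_gt0 ?nm_gt0 //.
apply: (le_trans (nmD _ _)); rewrite nmN !nmM -/a.
set u := nm (f (z + w) - f z - l * w) in A1 *.
set v := nm (f (z + w) - f z) in A2 *.
have w0 := nm_ge0 w; have l0 := nm_ge0 l.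
have B1 : a * u <= a * (e1 * nm w) by rewrite ler_wpM2l // ltW.
have B2 : nm l * nm w * v <= nm l * nm w * e1 by rewrite ler_wpM2l // mulr_ge0.
apply: (le_trans (lerD B1 B2)).
have B3 : e1 * K * nm w * (a ^+ 2 * (a / 2)) <= e * nm w * (a ^+ 2 * nm (f (z + w))).
  have a2 : 0 <= a ^+ 2 by rewrite exprn_ge0 // ltW.
  have a20 : 0 <= a / 2 by rewrite divr_ge0 // ltW.
  apply: ler_pM.
  - by apply: mulr_ge0 => //; apply: mulr_ge0; exact: ltW.
  - by rewrite mulr_ge0.
  - by rewrite ler_wpM2r.
  - by rewrite ler_wpM2l.
apply: le_trans _ B3.
have -> : e1 * K * nm w * (a ^+ 2 * (a / 2)) = e1 * nm w * (a + nm l + 1).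
  by rewrite /K; field; rewrite gt_eqF.
have w1 : 0 <= e1 * nm w by apply: mulr_ge0 => //; exact: ltW.
have : 0 <= e1 * nm w * 1 by rewrite mulr1.
by lra.
Qed.

Lemma cder_ext f g z l : f =1 g -> cder f z l -> cder g z l.
Proof. by move=> fg fl e /fl[d d0 H]; exists d => // w /H; rewrite !fg. Qed.

Lemma cder_near f g z l r : 0 < r -> (forall w, nm w < r -> f (z + w) = g (z + w)) ->
  cder f z l -> cder g z l.
Proof.
move=> r0 fg fl e /fl[d d0 H]; exists (Num.min d r); first by rewrite lt_min d0.
move=> w; rewrite lt_min => /andP[wd wr]; rewrite -fg // -[in g z](addr0 z) -fg ?addr0 ?nm0 //.
exact: H.
Qed.

Lemma cder_affine f a b t l : cder f (a + t * b) l -> cder (fun s => f (a + s * b)) t (l * b).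
Proof.
move=> fl e e0.
have B0 : 0 < nm b + 1 by rewrite ltr_wpDl ?nm_ge0.
have [d d0 H] := fl (e / (nm b + 1)) (divr_gt0 e0 B0).
exists (d / (nm b + 1)); first by rewrite divr_gt0.
move=> w; rewrite ltr_pdivlMr // => wd.
have wb : nm (w * b) <= nm w * (nm b + 1) by rewrite nmM ler_wpM2l ?nm_ge0 // lerDl.
have := H (w * b) (le_lt_trans wb wd).
have -> : a + t * b + w * b = a + (t + w) * b by ring.
have -> : l * b * w = l * (w * b) by ring.
move/le_trans; apply.
apply: (le_trans (ler_wpM2l _ wb)); first by apply: divr_ge0; exact: ltW.
rewrite le_eqVlt; apply/orP; left; apply/eqP; field; by rewrite gt_eqF.
Qed.

Lemma cdiff_const c z : cdiff (fun=> c) z.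
Proof. by exists 0; exact: cder_const. Qed.
Lemma cdiff_id z : cdiff id z.
Proof. by exists 1; exact: cder_id. Qed.
Lemma cdiff_add f g z : cdiff f z -> cdiff g z -> cdiff (fun t => f t + g t) z.
Proof. by move=> [l fl] [k gk]; exists (l + k); exact: cder_add. Qed.
Lemma cdiff_mul f g z : cdiff f z -> cdiff g z -> cdiff (fun t => f t * g t) z.
Proof. by move=> [l fl] [k gk]; exists (l * g z + f z * k); exact: cder_mul. Qed.
Lemma cdiff_opp f z : cdiff f z -> cdiff (fun t => - f t) z.
Proof.
move=> fl; have [l H] := cdiff_mul (cdiff_const (-1) z) fl.
by exists l; apply: cder_ext H => t; rewrite mulN1r.
Qed.
Lemma cdiff_sub f g z : cdiff f z -> cdiff g z -> cdiff (fun t => f t - g t) z.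
Proof. by move=> fl gk; apply: cdiff_add => //; exact: cdiff_opp. Qed.
Lemma cdiff_inv f z : f z != 0 -> cdiff f z -> cdiff (fun t => (f t)^-1) z.
Proof. by move=> f0 [l fl]; exists (- l / (f z) ^+ 2); exact: cder_inv f0 fl. Qed.
Lemma cdiff_ext f g z : f =1 g -> cdiff f z -> cdiff g z.
Proof. by move=> fg [l fl]; exists l; exact: cder_ext fl. Qed.
Lemma cdiff_exp f z n : cdiff f z -> cdiff (fun t => f t ^+ n) z.
Proof.
move=> fl; elim: n => [|n IH]; first exact: cdiff_const.
by apply: cdiff_ext (cdiff_mul fl IH) => t; rewrite exprS.
Qed.
Lemma cdiff_sum (I : Type) (r : seq I) (P : pred I) (F : I -> C -> C) z :
  (forall i, cdiff (F i) z) -> cdiff (fun t => \sum_(i <- r | P i) F i t) z.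
Proof.
move=> H; elim: r => [|i r IH].
  by apply: cdiff_ext (cdiff_const 0 z) => t; rewrite big_nil.
case Pi : (P i).
  by apply: cdiff_ext (cdiff_add (H i) IH) => t; rewrite big_cons Pi.
by apply: cdiff_ext IH => t; rewrite big_cons Pi.
Qed.
Lemma cdiff_prod (I : Type) (r : seq I) (P : pred I) (F : I -> C -> C) z :
  (forall i, cdiff (F i) z) -> cdiff (fun t => \prod_(i <- r | P i) F i t) z.
Proof.
move=> H; elim: r => [|i r IH].
  by apply: cdiff_ext (cdiff_const 1 z) => t; rewrite big_nil.
case Pi : (P i).
  by apply: cdiff_ext (cdiff_mul (H i) IH) => t; rewrite big_cons Pi.
by apply: cdiff_ext IH => t; rewrite big_cons Pi.
Qed.
Lemma cdiff_affine f a b t : cdiff f (a + t * b) -> cdiff (fun s => f (a + s * b)) t.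
Proof. by move=> [l fl]; exists (l * b); exact: cder_affine fl. Qed.
Lemma cdiff_cont f z : cdiff f z -> forall e, 0 < e ->
  exists2 d, 0 < d & forall w, nm w < d -> nm (f (z + w) - f z) <= e.
Proof. by move=> [l fl]; exact: cder_cont fl. Qed.

(** Cousin's argument: if [P] failed on the unit square, quartering would give nested dyadic squares
    on which it fails, shrinking to a point whose local hypothesis they contradict. [P m x y] is
    read as a property of the square of side [2^-m] with lower left corner [(x, y)]. *)
Lemma dyadic_cousin (P : nat -> R -> R -> Prop) :
  (forall m x y, let h := 2^-1 ^+ m.+1 in P m.+1 x y -> P m.+1 (x + h) y ->
     P m.+1 x (y + h) -> P m.+1 (x + h) (y + h) -> P m x y) ->
  (forall x y, 0 <= x <= 1 -> 0 <= y <= 1 -> exists m0, forall m u v,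
     (m0 <= m)%N -> 0 <= u -> u + 2^-1 ^+ m <= 1 -> 0 <= v -> v + 2^-1 ^+ m <= 1 ->
     u <= x <= u + 2^-1 ^+ m -> v <= y <= v + 2^-1 ^+ m -> P m u v) ->
  P 0%N 0 0.
Proof.
move=> sub loc; apply: contrapT => nP.
have step m (z : R * R) : exists z' : R * R, ~ P m z.1 z.2 ->
  [/\ ~ P m.+1 z'.1 z'.2, z.1 <= z'.1 <= z.1 + 2^-1 ^+ m.+1 &
      z.2 <= z'.2 <= z.2 + 2^-1 ^+ m.+1].
  have h0 : 0 <= (2^-1 : R) ^+ m.+1 by rewrite exprn_ge0 ?invr_ge0.
  set h := 2^-1 ^+ m.+1 in h0 *.
  case: (pselect (P m z.1 z.2)) => Pz; first by exists z.
  case: (pselect (P m.+1 z.1 z.2)) => P1; last first.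
    by exists z => _; split => //; rewrite lexx lerDl.
  case: (pselect (P m.+1 (z.1 + h) z.2)) => P2; last first.
    by exists (z.1 + h, z.2) => _ /=; split; rewrite ?lexx ?lerDl ?h0.
  case: (pselect (P m.+1 z.1 (z.2 + h))) => P3; last first.
    by exists (z.1, z.2 + h) => _ /=; split; rewrite ?lexx ?lerDl ?h0.
  case: (pselect (P m.+1 (z.1 + h) (z.2 + h))) => P4; last first.
    by exists (z.1 + h, z.2 + h) => _ /=; split; rewrite ?lexx ?lerDl ?h0.
  by case: Pz; exact: sub P1 P2 P3 P4.
have [nx Hnx] := choice (fun p : nat * (R * R) => step p.1 p.2).
pose z := fix z n := if n is n'.+1 then nx (n', z n') else (0 : R, 0 : R).
have nPz n : ~ P n (z n).1 (z n).2.
  by elim: n => // n IH; have [] := Hnx (n, z n) IH.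
have zx n : (z n).1 <= (z n.+1).1 <= (z n).1 + 2^-1 ^+ n.+1.
  by have [] := Hnx (n, z n) (nPz n).
have zy n : (z n).2 <= (z n.+1).2 <= (z n).2 + 2^-1 ^+ n.+1.
  by have [] := Hnx (n, z n) (nPz n).
have lim (u : nat -> R) : u 0%N = 0 ->
    (forall n, u n <= u n.+1 <= u n + 2^-1 ^+ n.+1) ->
    exists2 x, 0 <= x <= 1 & forall n, [/\ 0 <= u n, u n + 2^-1 ^+ n <= 1 &
      u n <= x <= u n + 2^-1 ^+ n].
  move=> u0 us.
  have mono n k : u n <= u (n + k)%N.
    elim: k => [|k IH]; first by rewrite addn0.
    by rewrite addnS; apply: (le_trans IH); have /andP[] := us (n + k)%N.
  have anti n k : u (n + k)%N + 2^-1 ^+ (n + k) <= u n + 2^-1 ^+ n.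
    elim: k => [|k IH]; first by rewrite addn0.
    apply: le_trans IH; rewrite addnS; have /andP[_] := us (n + k)%N.
    by rewrite exprS; lra.
  have bnd n p : u p <= u n + 2^-1 ^+ n.
    have p0 k : 0 <= (2^-1 : R) ^+ k by rewrite exprn_ge0 ?invr_ge0.
    case: (leqP n p) => [/subnKC <-|/ltnW/subnKC <-].
      by apply: le_trans (anti n (p - n)%N); rewrite lerDl.
    by apply: le_trans (mono p (n - p)%N) _; rewrite lerDl.
  have ub n : ubound (range u) (u n + 2^-1 ^+ n) by move=> _ [p _ <-]; exact: bnd.
  have hs : has_sup (range u).
    by split; [exists (u 0%N), 0%N|exists (u 0%N + 2^-1 ^+ 0); exact: ub].
  have up n : u n <= sup (range u) by apply: ub_le_sup; [case: hs|exists n].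
  have lo n : sup (range u) <= u n + 2^-1 ^+ n by apply: ge_sup; [case: hs|exact: ub].
  exists (sup (range u)) => [|n]; last first.
    rewrite up lo; split => //; first by rewrite -u0; have := mono 0%N n; rewrite add0n.
    by have := anti 0%N n; rewrite add0n u0 expr0 add0r.
  by have := up 0%N; have := lo 0%N; rewrite u0 add0r expr0 => -> ->.
have [x x01 Hx] := lim (fun n => (z n).1) erefl zx.
have [y y01 Hy] := lim (fun n => (z n).2) erefl zy.
have [m0 H] := loc x y x01 y01.
have [x1 x2 x3] := Hx m0; have [y1 y2 y3] := Hy m0.
exact: nPz (H m0 _ _ (leqnn _) x1 x2 y1 y2 x3 y3).
Qed.

(* The trapezoidal rule on [2 ^ n] equal pieces is exact on affine functions, which
   replaces the contour integral in Goursat's argument. *)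
Fixpoint trap (f : C -> C) n (a b : C) : C :=
  if n is n'.+1 then trap f n' a ((a + b) / 2) + trap f n' ((a + b) / 2) b
  else (f a + f b) / 2 * (b - a).

Definition ctour f n a W V := trap f n a (a + W) + trap f n (a + W) (a + W + V)
  + trap f n (a + W + V) (a + V) + trap f n (a + V) a.

Lemma trap_rev f n a b : trap f n b a = - trap f n a b.
Proof.
elim: n a b => [|n IH] a b /=; first by field.
by rewrite [b + a]addrC !(IH _ ((a + b) / 2)) !(IH ((a + b) / 2)); ring.
Qed.

Lemma trap_lin f g h c n a b : (forall z, h z = f z + c * g z) ->
  trap h n a b = trap f n a b + c * trap g n a b.
Proof.
move=> H; elim: n a b => [|n IH] a b /=; first by rewrite !H; field.
by rewrite !IH; ring.
Qed.

Lemma trap_affine c l n a b :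
  trap (fun z => c + l * z) n a b = (c * b + l * b ^+ 2 / 2) - (c * a + l * a ^+ 2 / 2).
Proof. by elim: n a b => [|n IH] a b /=; [field|rewrite !IH; ring]. Qed.

Definition onseg (a b z : C) := exists2 s : R, 0 <= s <= 1 & z = a + rC s * (b - a).

Lemma half_realC : (2^-1 : C) = rC 2^-1.
Proof. by rewrite fmorphV rmorph_nat. Qed.

Lemma onseg_l a b : onseg a b a.
Proof. by exists 0; rewrite ?lexx ?ler01 // rmorph0 mul0r addr0. Qed.
Lemma onseg_r a b : onseg a b b.
Proof. by exists 1; rewrite ?lexx ?ler01 // rmorph1 mul1r addrC subrK. Qed.
Lemma onseg_half1 a b z : onseg a ((a + b) / 2) z -> onseg a b z.
Proof.
move=> [s s01 ->]; exists (s / 2); first by move: s01; lra.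
by rewrite rmorphM /= -half_realC; field.
Qed.
Lemma onseg_half2 a b z : onseg ((a + b) / 2) b z -> onseg a b z.
Proof.
move=> [s s01 ->]; exists ((1 + s) / 2); first by move: s01; lra.
by rewrite rmorphM rmorphD /= -half_realC; field.
Qed.

Lemma trap_ext f g n a b : (forall z, onseg a b z -> f z = g z) -> trap f n a b = trap g n a b.
Proof.
elim: n a b => [|n IH] a b H /=.
  by rewrite !H //; [exact: onseg_r|exact: onseg_l].
by rewrite !IH // => z zs; apply: H; [exact: onseg_half2|exact: onseg_half1].
Qed.

Lemma nm_half x : nm (x / 2) = nm x / 2.
Proof. by rewrite nmM nmV nm_nat. Qed.

Lemma trap_bound f n a b B : (forall z, onseg a b z -> nm (f z) <= B) ->
  nm (trap f n a b) <= B * nm (b - a).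
Proof.
elim: n a b => [|n IH] a b H /=.
  rewrite nmM nm_half ler_wpM2r ?nm_ge0 //.
  have := nmD (f a) (f b); have := H _ (onseg_l a b); have := H _ (onseg_r a b); lra.
have I1 := IH _ _ (fun z zs => H z (onseg_half1 zs)).
have I2 := IH _ _ (fun z zs => H z (onseg_half2 zs)).
apply: (le_trans (nmD _ _)).
move: I1 I2; have -> : (a + b) / 2 - a = (b - a) / 2 by field.
have -> : b - (a + b) / 2 = (b - a) / 2 by field.
by rewrite nm_half; lra.
Qed.

(** Inner edges are traversed in both directions and cancel by [trap_rev]; an outer edge at depth
    [n.+1] is exactly its two halves at depth [n]. Subdivision thus needs no limit. *)
Lemma ctour_split f n a W V : ctour f n.+1 a W V =
  ctour f n a (W / 2) (V / 2) + ctour f n (a + W / 2) (W / 2) (V / 2) +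
  ctour f n (a + V / 2) (W / 2) (V / 2) + ctour f n (a + W / 2 + V / 2) (W / 2) (V / 2).
Proof.
rewrite /ctour /=.
have e1 : (a + (a + W)) / 2 = a + W / 2 by field.
have e2 : (a + W + (a + W + V)) / 2 = a + W + V / 2 by field.
have e3 : (a + W + V + (a + V)) / 2 = a + W / 2 + V by field.
have e4 : (a + V + a) / 2 = a + V / 2 by field.
have f1 : a + W / 2 + W / 2 = a + W by field.
have f2 : a + W / 2 + W / 2 + V / 2 = a + W + V / 2 by field.
have f3 : a + V / 2 + V / 2 = a + V by field.
have f4 : a + V / 2 + W / 2 + V / 2 = a + W / 2 + V by field.
have f5 : a + V / 2 + W / 2 = a + W / 2 + V / 2 by field.
have f6 : a + W / 2 + V / 2 + W / 2 = a + W + V / 2 by field.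
have f7 : a + W / 2 + V / 2 + W / 2 + V / 2 = a + W + V by field.
have f8 : a + W / 2 + V / 2 + V / 2 = a + W / 2 + V by field.
have g1 : a + W + V / 2 + V / 2 = a + W + V by field.
rewrite e1 e2 e3 e4 !f5 !f1 !f6 !g1 !f8 !f3.
rewrite (trap_rev f n (a + W / 2) (a + W / 2 + V / 2)).
rewrite (trap_rev f n (a + W / 2 + V / 2) (a + W + V / 2)).
rewrite (trap_rev f n (a + W / 2 + V / 2) (a + W / 2 + V)).
rewrite (trap_rev f n (a + V / 2) (a + W / 2 + V / 2)).
ring.
Qed.

End OneVariable.

(** * Goursat's theorem *)

Section Goursat.
Variable R : realType.
Local Notation C := R[i].
Local Notation nm := (@ComplexField.Normc.normc R).
Local Notation rC := (@real_complex_def R (Phant R)).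
Local Notation re := (@complex.Re R).
Local Notation im := (@complex.Im R).

Lemma half_pow_small (S d : R) : 0 <= S -> 0 < d ->
  exists m0, forall m, (m0 <= m)%N -> S * 2^-1 ^+ m < d.
Proof.
move=> S0 d0; exists (Num.bound (S / d)) => m mb.
have Sd : S / d < 2 ^+ m.
  apply: lt_le_trans (archi_boundP _) _; first by rewrite divr_ge0 // ltW.
  apply: (@le_trans _ _ m%:R); first by rewrite ler_nat.
  by rewrite -natrX ler_nat ltnW // ltn_expl.
rewrite exprVn ltr_pdivrMr ?exprn_gt0 // mulrC.
by rewrite -ltr_pdivrMr.
Qed.

(** A gauge for the exceptional point of [goursat]: it is monotone, and across [0] its increments
    are at least the square root of the length, so a product of two such increments dominates the
    side of a square. *)
Definition ssqrt (u : R) := if 0 <= u then Num.sqrt u else - Num.sqrt (- u).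

Lemma ssqrt_mono u v : u <= v -> ssqrt u <= ssqrt v.
Proof.
move=> uv; rewrite /ssqrt; case: (leP 0 u) => u0.
  by rewrite (le_trans u0 uv); exact: ler_wsqrtr.
case: (leP 0 v) => v0; last by rewrite lerN2; apply: ler_wsqrtr; rewrite lerN2.
by apply: (@le_trans _ _ 0); rewrite ?oppr_le0 ?sqrtr_ge0.
Qed.

Lemma ssqrt_gap u v : u <= 0 -> 0 <= v -> Num.sqrt (v - u) <= ssqrt v - ssqrt u.
Proof.
move=> u0 v0; rewrite {1}/ssqrt v0.
have -> : - ssqrt u = Num.sqrt (- u).
  rewrite /ssqrt; case: leP => u1; last by rewrite opprK.
  have -> : u = 0 by apply/le_anti; rewrite u0 u1.
  by rewrite oppr0 sqrtr0 oppr0.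
have nu0 : 0 <= - u by rewrite oppr_ge0.
rewrite -(@ler_pXn2r _ 2) ?nnegrE ?addr_ge0 ?sqrtr_ge0 //.
rewrite sqrrD !sqr_sqrtr // ?addr_ge0 //.
have : 0 <= Num.sqrt v * Num.sqrt (- u) by rewrite mulr_ge0 ?sqrtr_ge0.
rewrite -mulr_natl; lra.
Qed.

Lemma trap_bound_dir f n a d B : (forall s : R, 0 <= s <= 1 -> nm (f (a + rC s * d)) <= B) ->
  nm (trap f n a (a + d)) <= B * nm d.
Proof.
move=> H; have ad : a + d - a = d by rewrite addrAC subrr add0r.
rewrite -[X in B * nm X]ad; apply: trap_bound => _ [s s01 ->].
by rewrite ad; exact: H.
Qed.

(** The contour sum of an affine function is zero, so only the remainder counts, over a perimeter of
    [2 * (nm W + nm V)]. *)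
Lemma ctour_affine_approx g al be B n c W V :
  (forall s t : R, 0 <= s <= 1 -> 0 <= t <= 1 ->
     nm (g (c + rC s * W + rC t * V) - (al + be * (c + rC s * W + rC t * V))) <= B) ->
  nm (ctour g n c W V) <= 2 * B * (nm W + nm V).
Proof.
move=> H; pose r z := g z - (al + be * z).
have E a b : trap g n a b = trap r n a b + 1 * trap (fun z => al + be * z) n a b.
  by apply: trap_lin => z; rewrite /r mul1r subrK.
have -> : ctour g n c W V = ctour r n c W V.
  by rewrite /ctour !E !trap_affine; field.
have b01 : 0 <= (0 : R) <= 1 by rewrite lexx ler01.
have b11 : 0 <= (1 : R) <= 1 by rewrite lexx ler01.
have nb (s : R) : 0 <= s <= 1 -> 0 <= 1 - s <= 1 by lra.
have h1 : nm (trap r n c (c + W)) <= B * nm W.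
  apply: trap_bound_dir => s s01.
  by have := H s 0 s01 b01; rewrite /r !rmorph0 !mul0r !addr0.
have h2 : nm (trap r n (c + W) (c + W + V)) <= B * nm V.
  apply: trap_bound_dir => s s01.
  by have := H 1 s b11 s01; rewrite /r !rmorph1 !mul1r.
have h3 : nm (trap r n (c + W + V) (c + V)) <= B * nm W.
  have -> : c + V = c + W + V + - W by ring.
  rewrite -(nmN W); apply: trap_bound_dir => s s01.
  have := H (1 - s) 1 (nb _ s01) b11; rewrite /r !rmorphB !rmorph1 !mul1r.
  by have -> : c + W + V + rC s * - W = c + (1 - rC s) * W + V by ring.
have h4 : nm (trap r n (c + V) c) <= B * nm V.
  have {2}-> : c = c + V + - V by ring.
  rewrite -(nmN V); apply: trap_bound_dir => s s01.
  have := H 0 (1 - s) b01 (nb _ s01); rewrite /r !rmorphB !rmorph1 !rmorph0 !mul0r !addr0.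
  by have -> : c + V + rC s * - V = c + (1 - rC s) * V by ring.
rewrite /ctour; apply: (le_trans (nmD _ _)).
apply: (le_trans (lerD (nmD _ _) (lexx _))).
apply: (le_trans (lerD (lerD (nmD _ _) (lexx _)) (lexx _))).
lra.
Qed.

Lemma half_exp m : (2^-1 ^+ m.+1 : R) = 2^-1 ^+ m / 2.
Proof. by rewrite exprS mulrC. Qed.

(** Goursat's bisection, with errors measured by an additive set function [mu] instead of area
    alone. At a point of differentiability the error is of the order of the area; at the one point
    where only continuity is known it is of the order of the side, which area could not absorb. *)
Lemma goursat g (a W V : C) (p q : R) :
  (forall x y : R, 0 <= x <= 1 -> 0 <= y <= 1 ->
     let z := a + rC x * W + rC y * V in
     cdiff g z \/ [/\ x = p, y = q & forall e, 0 < e ->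
       exists2 d, 0 < d & forall w, nm w < d -> nm (g (z + w) - g z) <= e]) ->
  forall e, 0 < e -> exists n0, forall n, (n0 <= n)%N -> nm (ctour g n a W V) <= e.
Proof.
move=> Hg e e0.
(* An additive mass that gives at least [h] to every square of side [h] containing [(p, q)]. *)
pose nu m x y := (ssqrt (x + 2^-1 ^+ m - p) - ssqrt (x - p)) *
                 (ssqrt (y + 2^-1 ^+ m - q) - ssqrt (y - q)).
pose mu m x y := (2^-1 ^+ m) ^+ 2 + nu m x y.
have h0 m : 0 <= (2^-1 : R) ^+ m by rewrite exprn_ge0 ?invr_ge0.
have nu0 m x y : 0 <= nu m x y.
  by rewrite /nu mulr_ge0 // subr_ge0 ssqrt_mono // lerD2r lerDl.
pose e1 := e / mu 0%N 0 0.
have mu0 : 0 < mu 0%N 0 0.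
  by rewrite /mu expr0 expr1n ltr_wpDr.
have e10 : 0 < e1 by rewrite divr_gt0.
pose hW m : C := rC (2^-1 ^+ m) * W; pose hV m : C := rC (2^-1 ^+ m) * V.
(* The bound is required only from some depth on, since each quartering consumes one level of the
   trapezoidal rule. *)
pose P m x y := exists n0, forall n, (n0 <= n)%N ->
  nm (ctour g n (a + rC x * W + rC y * V) (hW m) (hV m)) <= e1 * mu m x y.
suff : P 0%N 0 0.
  move=> [n0 H]; exists n0 => n /H.
  by rewrite /hW /hV expr0 !rmorph1 !rmorph0 !mul0r !addr0 !mul1r /e1 divfK // gt_eqF.
apply: dyadic_cousin => [m x y h [n1 H1] [n2 H2] [n3 H3] [n4 H4]|x y x01 y01].
  exists (n1 + n2 + n3 + n4).+1 => -[//|n] nn; rewrite ctour_split.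
  have hWS : hW m / 2 = hW m.+1.
    by rewrite /hW half_exp rmorphM /= -half_realC; field.
  have hVS : hV m / 2 = hV m.+1.
    by rewrite /hV half_exp rmorphM /= -half_realC; field.
  rewrite hWS hVS.
  have p1 : a + rC x * W + rC y * V + hW m.+1 = a + rC (x + h) * W + rC y * V.
    by rewrite rmorphD /= /hW /h; ring.
  have p2 : a + rC x * W + rC y * V + hV m.+1 = a + rC x * W + rC (y + h) * V.
    by rewrite rmorphD /= /hV /h; ring.
  have p3 : a + rC (x + h) * W + rC y * V + hV m.+1 = a + rC (x + h) * W + rC (y + h) * V.
    by rewrite (rmorphD _ y) /= /hV /h; ring.
  rewrite p1 p2 p3.
  have {}H1 := H1 n ltac:(lia); have {}H2 := H2 n ltac:(lia).
  have {}H3 := H3 n ltac:(lia); have {}H4 := H4 n ltac:(lia).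
  apply: (le_trans (nmD _ _)).
  apply: (le_trans (lerD (nmD _ _) (lexx _))).
  apply: (le_trans (lerD (lerD (nmD _ _) (lexx _)) (lexx _))).
  apply: (le_trans (lerD (lerD (lerD H1 H2) H3) H4)).
  rewrite -!mulrDr; apply: ler_wpM2l; first exact: ltW.
  rewrite le_eqVlt; apply/orP; left; apply/eqP.
  have hh : h = 2^-1 ^+ m / 2 by exact: half_exp.
  have xx : x + h + h = x + 2^-1 ^+ m by rewrite hh; field.
  have yy : y + h + h = y + 2^-1 ^+ m by rewrite hh; field.
  by rewrite /mu /nu -!/h xx yy hh; field.
pose S := nm W + nm V.
have S0 : 0 <= S by rewrite addr_ge0 ?nm_ge0.
have shW : forall k, nm (hW k) + nm (hV k) = S * 2^-1 ^+ k.
  by move=> k; rewrite /hW /hV !nmM !nm_real !ger0_norm // /S; ring.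
have near_m m u v s t : u <= x <= u + 2^-1 ^+ m -> v <= y <= v + 2^-1 ^+ m ->
    0 <= s <= 1 -> 0 <= t <= 1 ->
    nm (a + rC u * W + rC v * V + rC s * hW m + rC t * hV m
      - (a + rC x * W + rC y * V)) <= S * 2^-1 ^+ m.
  move=> ux vy s01 t01.
  have -> : a + rC u * W + rC v * V + rC s * hW m + rC t * hV m - (a + rC x * W + rC y * V)
     = rC (u - x + s * 2^-1 ^+ m) * W + rC (v - y + t * 2^-1 ^+ m) * V.
    by rewrite !rmorphD !rmorphM !rmorphN /= /hW /hV; ring.
  apply: (le_trans (nmD _ _)); rewrite !nmM !nm_real /S mulrDl.
  have b (r z k : R) : 0 <= r <= 1 -> z <= k <= z + 2^-1 ^+ m -> `|z - k + r * 2^-1 ^+ m| <= 2^-1 ^+ m.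
    move=> r01 zk.
    have : 0 <= r * 2^-1 ^+ m <= 1 * 2^-1 ^+ m.
      by rewrite mulr_ge0 //= ?ler_wpM2r //; case/andP: r01.
    by rewrite ler_norml; lra.
  by rewrite lerD // mulrC ler_wpM2l ?nm_ge0 // b.
case: (Hg x y x01 y01) => [[l Hl]|[xp yq Hc]].
  (* On a square of side [h] the remainder is this factor times [S h], and half the perimeter is
     [S h], so the contour sum is at most [2 S ^ 2 h ^ 2] times the factor; the [1] keeps the
     denominator positive. *)
  have e20 : 0 < e1 / (2 * S ^+ 2 + 1).
    by rewrite divr_gt0 // ltr_wpDl // mulr_ge0 // exprn_ge0.
  have [d d0 Hd] := Hl _ e20; have [m0 Hm] := half_pow_small S0 d0.
  exists m0 => m u v m0m _ _ _ _ ux vy; exists 0%N => n _.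
  set z := a + rC x * W + rC y * V in Hd.
  pose B := e1 / (2 * S ^+ 2 + 1) * (S * 2^-1 ^+ m).
  have := @ctour_affine_approx g (g z - l * z) l B n (a + rC u * W + rC v * V) (hW m) (hV m).
  move=> H; apply: le_trans (H _) _ => [s t s01 t01|].
    pose z' := a + rC u * W + rC v * V + rC s * hW m + rC t * hV m.
  have nr : nm (z' - z) <= S * 2^-1 ^+ m by exact: near_m.
  rewrite -/z'.
    have zz : z' = z + (z' - z) by rewrite addrC subrK.
    have := Hd (z' - z) (le_lt_trans nr (Hm _ m0m)).
    rewrite -zz; have -> : g z' - (g z - l * z + l * z') = g z' - g z - l * (z' - z) by ring.
    by move/le_trans; apply; rewrite /B ler_wpM2l // ltW.
  rewrite shW; apply: (@le_trans _ _ (e1 * (2^-1 ^+ m) ^+ 2)); last first.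
    by rewrite ler_wpM2l ?(ltW e10) // /mu lerDl.
  have -> : 2 * B * (S * 2^-1 ^+ m) =
    e1 * (2^-1 ^+ m) ^+ 2 * (2 * S ^+ 2 / (2 * S ^+ 2 + 1)).
    rewrite /B; field; rewrite gt_eqF // ltr_wpDl // mulr_ge0 // exprn_ge0 //.
  have S2 : 0 <= 2 * S ^+ 2 by rewrite mulr_ge0 // exprn_ge0.
  apply: ler_piMr; first by rewrite mulr_ge0 ?(ltW e10) ?exprn_ge0.
  by rewrite ler_pdivrMr ?mul1r ?lerDl // ltr_wpDl.
(* At the exceptional point [g] is approximated by a constant; the resulting bound, linear in the
   side, is paid for by [nu]. *)
have e20 : 0 < e1 / (2 * S + 1) by rewrite divr_gt0 // ltr_wpDl // mulr_ge0.
have [d d0 Hd] := Hc _ e20; have [m0 Hm] := half_pow_small S0 d0.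
exists m0 => m u v m0m _ _ _ _ ux vy; exists 0%N => n _.
set z := a + rC x * W + rC y * V in Hd.
pose B := e1 / (2 * S + 1).
have := @ctour_affine_approx g (g z) 0 B n (a + rC u * W + rC v * V) (hW m) (hV m).
move=> H; apply: le_trans (H _) _ => [s t s01 t01|].
  pose z' := a + rC u * W + rC v * V + rC s * hW m + rC t * hV m.
  have nr : nm (z' - z) <= S * 2^-1 ^+ m by exact: near_m.
  rewrite -/z'.
  have zz : z' = z + (z' - z) by rewrite addrC subrK.
  have := Hd (z' - z) (le_lt_trans nr (Hm _ m0m)).
  by rewrite -zz mul0r addr0.
rewrite shW; apply: (@le_trans _ _ (e1 * 2^-1 ^+ m)); last first.
  rewrite ler_wpM2l ?(ltW e10) // /mu.
  apply: (@le_trans _ _ (nu m u v)); last by rewrite lerDr exprn_ge0.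
  have k (r z0 : R) : z0 <= r <= z0 + 2^-1 ^+ m ->
      Num.sqrt (2^-1 ^+ m) <= ssqrt (z0 + 2^-1 ^+ m - r) - ssqrt (z0 - r).
    move=> zr; have := @ssqrt_gap (z0 - r) (z0 + 2^-1 ^+ m - r).
    have -> : (z0 + 2^-1 ^+ m - r) - (z0 - r) = 2^-1 ^+ m by ring.
    by apply; lra.
  rewrite -[X in X <= _](@sqr_sqrtr _ (2^-1 ^+ m)) // expr2.
  by rewrite /nu -xp -yq; apply: ler_pM; rewrite ?sqrtr_ge0 // k.
have -> : 2 * B * (S * 2^-1 ^+ m) = e1 * 2^-1 ^+ m * (2 * S / (2 * S + 1)).
  by rewrite /B; field; rewrite gt_eqF // ltr_wpDl // mulr_ge0.
have S2 : 0 <= 2 * S by rewrite mulr_ge0.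
apply: ler_piMr; first by rewrite mulr_ge0 ?(ltW e10).
by rewrite ler_pdivrMr ?mul1r ?lerDl // ltr_wpDl.
Qed.

(** The imaginary part of [conjc a * b], twice the signed area of the triangle [0, a, b]. *)
Definition cross (a b : C) : R := re a * im b - im a * re b.

Lemma im_div (a b : C) : a != 0 -> im (b / a) = cross a b / nm a ^+ 2.
Proof.
case: a b => [x y] [u v] a0.
have n2 : nm (x +i* y)%C ^+ 2 = x ^+ 2 + y ^+ 2.
  by rewrite /= sqr_sqrtr // addr_ge0 // sqr_ge0.
have : nm (x +i* y)%C ^+ 2 != 0 by rewrite expf_neq0 // nm_eq0.
rewrite n2 /cross /= => n0; field; exact: n0.
Qed.

(** One trapezoid contributes [cross a b] times the mean of [1 / nm a ^ 2] and [1 / nm b ^ 2] to the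
    imaginary part, and halving the segment halves [cross]. This lower bound for contour sums of
    [1/z] stands in for the value [2 pi i]. *)
Lemma im_trap_inv n (a b : C) (D : R) : 0 <= cross a b ->
  (forall z, onseg a b z -> 0 < nm z <= D) ->
  cross a b / D ^+ 2 <= im (trap (fun z => z^-1) n a b).
Proof.
elim: n a b => [|n IH] a b cr H /=.
  have /andP[a0 aD] := H _ (onseg_l a b); have /andP[b0 bD] := H _ (onseg_r a b).
  have an : a != 0 by rewrite -nm_gt0. have bn : b != 0 by rewrite -nm_gt0.
  have -> : (a^-1 + b^-1) / 2 * (b - a) = b / a / 2 - a / b / 2 by field; rewrite an bn.
  have D0 : 0 < D := lt_le_trans a0 aD.
  have imh z : im (z / 2) = im z / 2.
    by rewrite half_realC; case: z => u v; rewrite /real_complex_def /=; ring.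
  have imB (z z' : C) : im (z - z') = im z - im z' by case: z z' => [? ?] [? ?].
  rewrite imB !imh !im_div //.
  have -> : cross b a = - cross a b by rewrite /cross; ring.
  have k c : 0 < c -> c <= D -> cross a b / D ^+ 2 <= cross a b / c ^+ 2.
    move=> c0 cD; rewrite ler_wpM2l // lef_pV2 ?posrE ?exprn_gt0 //.
    by rewrite ler_pXn2r // nnegrE ltW.
  have := k _ a0 aD; have := k _ b0 bD; rewrite mulNr; lra.
have cm : cross a ((a + b) / 2) = cross a b / 2.
  by rewrite half_realC /cross /real_complex_def; case: a b {H cr} => [? ?] [? ?] /=; field.
have cm' : cross ((a + b) / 2) b = cross a b / 2.
  by rewrite half_realC /cross /real_complex_def; case: a b {H cr cm} => [? ?] [? ?] /=; field.
have imD (z z' : C) : im (z + z') = im z + im z' by case: z z' => [? ?] [? ?].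
have c2 : 0 <= cross a b / 2 by rewrite divr_ge0.
have I1 := IH a ((a + b) / 2); rewrite cm in I1.
have I2 := IH ((a + b) / 2) b; rewrite cm' in I2.
have {}I1 := I1 c2 (fun z zs => H z (onseg_half1 zs)).
have {}I2 := I2 c2 (fun z zs => H z (onseg_half2 zs)).
rewrite imD; move: I1 I2; have -> : cross a b / 2 / D ^+ 2 = cross a b / D ^+ 2 / 2 by ring.
lra.
Qed.

End Goursat.

(** * The identity theorem on a segment *)

Section Identity.
Variable R : realType.
Local Notation C := R[i].
Local Notation nm := (@ComplexField.Normc.normc R).
Local Notation rC := (@real_complex_def R (Phant R)).
Local Notation re := (@complex.Re R).
Local Notation im := (@complex.Im R).
Local Notation cpx := (@complex.Complex R).

Lemma cpxD (x y x' y' : R) : cpx x y + cpx x' y' = cpx (x + x') (y + y').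
Proof. by []. Qed.
Lemma cpxB (x y x' y' : R) : cpx x y - cpx x' y' = cpx (x - x') (y - y').
Proof. by []. Qed.
Lemma rCM (s x y : R) : rC s * cpx x y = cpx (s * x) (s * y).
Proof. by rewrite /real_complex_def; congr (cpx _ _); rewrite mul0r ?subr0 ?addr0. Qed.
Lemma nm_cpx (x y : R) : nm (cpx x y) <= `|x| + `|y|.
Proof.
have -> : cpx x y = cpx x 0 + cpx 0 y by rewrite cpxD addr0 add0r.
apply: (le_trans (nmD _ _)); rewrite /= !expr0n /= addr0 add0r.
by rewrite !sqrtr_sqr.
Qed.

(** Continuity bounds [f] near each point, and a maximum joins the bounds of the four quarters. *)
Lemma bounded_rect (f : C -> C) (a W V : C) :
  (forall x y : R, 0 <= x <= 1 -> 0 <= y <= 1 -> cdiff f (a + rC x * W + rC y * V)) ->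
  exists B, forall x y : R, 0 <= x <= 1 -> 0 <= y <= 1 ->
    nm (f (a + rC x * W + rC y * V)) <= B.
Proof.
move=> Hf.
pose P m (u v : R) := exists B, forall x y : R, u <= x <= u + 2^-1 ^+ m ->
  v <= y <= v + 2^-1 ^+ m -> nm (f (a + rC x * W + rC y * V)) <= B.
suff [B HB] : P 0%N 0 0.
  by exists B => x y x01 y01; apply: HB; rewrite expr0 add0r.
apply: dyadic_cousin => [m u v h [B1 H1] [B2 H2] [B3 H3] [B4 H4]|x y x01 y01].
  exists (Num.max (Num.max B1 B2) (Num.max B3 B4)) => x y.
  have hh : 2^-1 ^+ m = h + h by rewrite /h half_exp; field.
  rewrite hh !le_max => ux vy; have hd : 2^-1 ^+ m.+1 = h by [].
  rewrite hd in H1 H2 H3 H4; clearbody h.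
  case: (leP x (u + h)) => xu; case: (leP y (v + h)) => yv.
  - by rewrite H1 //; lra.
  - by rewrite H3 ?orbT //; lra.
  - by rewrite H2 ?orbT //; lra.
  - by rewrite H4 ?orbT //; lra.
have [d d0 Hd] := cdiff_cont (Hf x y x01 y01) ltr01.
pose S := nm W + nm V.
have S0 : 0 <= S by rewrite addr_ge0 ?nm_ge0.
have [m0 Hm] := half_pow_small S0 d0.
exists m0 => m u v m0m _ _ _ _ ux vy.
exists (nm (f (a + rC x * W + rC y * V)) + 1) => x' y' ux' vy'.
have E : a + rC x' * W + rC y' * V = a + rC x * W + rC y * V + (rC (x' - x) * W + rC (y' - y) * V).
  by rewrite !rmorphB /=; ring.
have lt : nm (rC (x' - x) * W + rC (y' - y) * V) < d.
  apply: le_lt_trans (Hm m m0m); apply: (le_trans (nmD _ _)).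
  rewrite !nmM !nm_real /S mulrDl.
  rewrite lerD // mulrC ler_wpM2l ?nm_ge0 //; rewrite ler_norml; lra.
have := Hd _ lt; rewrite -E.
have := nmD (f (a + rC x' * W + rC y' * V) - f (a + rC x * W + rC y * V)) (f (a + rC x * W + rC y * V)).
rewrite subrK; lra.
Qed.

Lemma seg_cpx (x y x' y' : R) z : onseg (cpx x y) (cpx x' y') z ->
  exists2 s, 0 <= s <= 1 & z = cpx (x + s * (x' - x)) (y + s * (y' - y)).
Proof. by move=> [s s01 ->]; exists s; rewrite // cpxB rCM cpxD. Qed.

Lemma nm_re (x y : R) : `|x| <= nm (cpx x y). Proof. exact: (nm_Re (cpx x y)). Qed.
Lemma nm_im (x y : R) : `|y| <= nm (cpx x y). Proof. exact: (nm_Im (cpx x y)). Qed.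

(* A maximum principle up to a multiplicative constant; the constant disappears below
   once it is applied to functions with a high-order peak. *)
Lemma max_rect (f : C -> C) (rho t M : R) : 0 < rho -> 0 < t <= 1 ->
  (forall x y, - rho <= x <= rho -> - (t * rho) <= y <= rho -> cdiff f (cpx x y)) ->
  (forall x y, - rho <= x <= rho -> - (t * rho) <= y <= rho ->
     [\/ x = rho, x = - rho, y = rho | y = - (t * rho)] -> nm (f (cpx x y)) <= M) ->
  nm (f 0) <= 8 / t * M.
Proof.
move=> r0 t01 Hf HM; have t0 : 0 < t by case/andP: t01.
have tr0 : 0 < t * rho by rewrite mulr_gt0.
have trr : t * rho <= rho by rewrite -[X in _ <= X]mul1r ler_pM2r //; case/andP: t01.
have M0 : 0 <= M.
  by apply: le_trans (nm_ge0 _) (HM rho rho _ _ _); [lra|lra|apply: Or41].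
pose a := cpx (- rho) (- (t * rho)); pose W := cpx (2 * rho) 0; pose V := cpx 0 (rho + t * rho).
have z0E : (0 : C) = cpx 0 0 by [].
have ptE x y : a + rC x * W + rC y * V =
    cpx (- rho + x * (2 * rho)) (- (t * rho) + y * (rho + t * rho)).
  by rewrite /a /W /V !rCM !cpxD !mulr0 !addr0.
have ptin x y : 0 <= x <= 1 -> 0 <= y <= 1 ->
    - rho <= - rho + x * (2 * rho) <= rho /\
    - (t * rho) <= - (t * rho) + y * (rho + t * rho) <= rho.
  move=> x01 y01; have p : 0 <= x * (2 * rho) <= 1 * (2 * rho).
    by rewrite mulr_ge0 ?ler_wpM2r //; lra.
  have q : 0 <= y * (rho + t * rho) <= 1 * (rho + t * rho).
    by rewrite mulr_ge0 ?ler_wpM2r //; lra.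
  by split; lra.
have Hf0 : cdiff f 0 by rewrite z0E; apply: Hf; lra.
have [l Hl] := Hf0.
(* The difference quotient, extended by the derivative: continuous at [0] and differentiable at the
   other points, which is exactly what [goursat] accepts. *)
pose g z := if z == 0 then l else (f z - f 0) / z.
have gd z : z != 0 -> cdiff f z -> cdiff g z.
  move=> z0 fz.
  have [k Hk] := cdiff_mul (cdiff_sub fz (cdiff_const (f 0) z)) (cdiff_inv z0 (cdiff_id z)).
  exists k; apply: (@cder_near R _ g z k (nm z)) Hk; first by rewrite nm_gt0.
  move=> w wz; rewrite /g; case: eqP => // /eqP zw; exfalso; move: wz.
  by move: zw; rewrite addrC addr_eq0 => /eqP ->; rewrite nmN ltxx.
have gc e : 0 < e -> exists2 d, 0 < d & forall w, nm w < d -> nm (g (0 + w) - g 0) <= e.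
  move=> e0; have [d d0 Hd] := Hl e e0; exists d => // w /Hd; rewrite add0r /g eqxx.
  case: eqP => [->|/eqP w0]; first by move=> _; rewrite subrr nm0 ltW.
  have -> : (f w - f 0) / w - l = (f w - f 0 - l * w) / w by field.
  by rewrite nmM nmV ler_pdivrMr // nm_gt0.
(* [1/2] and [t / (1 + t)] are the coordinates of the origin in the rectangle. *)
have G := @goursat R g a W V 2^-1 (t / (1 + t)).
have {}G e : 0 < e -> exists n0, forall n, (n0 <= n)%N -> nm (ctour g n a W V) <= e.
  apply: G => x y x01 y01 z; rewrite /z ptE.
  have [xin yin] := ptin x y x01 y01.
  case: (eqVneq (cpx (- rho + x * (2 * rho)) (- (t * rho) + y * (rho + t * rho))) 0) => [E|nz]; last first.
    by left; apply: gd => //; exact: Hf.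
  right; rewrite E; split; last exact: gc.
    move/(congr1 re): E => /= E; have n : rho != 0 by rewrite gt_eqF.
    apply: (mulIf n); lra.
  move/(congr1 im): E => /= E; have n : rho != 0 by rewrite gt_eqF.
  have t1 : 1 + t != 0 by rewrite gt_eqF //; lra.
  apply: (mulIf n); apply: (mulIf t1).
  have -> : t / (1 + t) * rho * (1 + t) = t * rho by field.
  lra.
pose A := a; pose B := cpx rho (- (t * rho)); pose D := cpx rho rho; pose F := cpx (- rho) rho.
have aW : a + W = B by rewrite /a /W /B cpxD; congr cpx; ring.
have aWV : a + W + V = D by rewrite aW /B /V /D cpxD; congr cpx; ring.
have aV : a + V = F by rewrite /a /V /F cpxD; congr cpx; ring.
pose bd z := exists x y, [/\ z = cpx x y, - rho <= x <= rho, - (t * rho) <= y <= rho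
   & [\/ x = rho, x = - rho, y = rho | y = - (t * rho)]].
have bdAB z : onseg A B z -> bd z.
  move=> /seg_cpx[s s01 ->].
  have p : 0 <= s * (2 * rho) <= 1 * (2 * rho) by rewrite mulr_ge0 ?ler_wpM2r //; lra.
  eexists _, _; split; first reflexivity.
  - by lra.
  - by lra.
  - by apply: Or44; ring.
have bdBD z : onseg B D z -> bd z.
  move=> /seg_cpx[s s01 ->].
  have p : 0 <= s * (rho + t * rho) <= 1 * (rho + t * rho) by rewrite mulr_ge0 ?ler_wpM2r //; lra.
  eexists _, _; split; first reflexivity.
  - by lra.
  - by lra.
  - by apply: Or41; ring.
have bdDF z : onseg D F z -> bd z.
  move=> /seg_cpx[s s01 ->].
  have p : 0 <= s * (2 * rho) <= 1 * (2 * rho) by rewrite mulr_ge0 ?ler_wpM2r //; lra.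
  eexists _, _; split; first reflexivity.
  - by lra.
  - by lra.
  - by apply: Or43; ring.
have bdFA z : onseg F A z -> bd z.
  move=> /seg_cpx[s s01 ->].
  have p : 0 <= s * (rho + t * rho) <= 1 * (rho + t * rho) by rewrite mulr_ge0 ?ler_wpM2r //; lra.
  eexists _, _; split; first reflexivity.
  - by lra.
  - by lra.
  - by apply: Or42; ring.
have bdn z : bd z -> t * rho <= nm z <= 2 * rho.
  move=> [x [y [-> xin yin b]]]; apply/andP; split.
    case: b => E; rewrite E.
    - by apply: le_trans (nm_re _ _); rewrite ger0_norm; lra.
    - by apply: le_trans (nm_re _ _); rewrite normrN ger0_norm; lra.
    - by apply: le_trans (nm_im _ _); rewrite ger0_norm; lra.
    - by apply: le_trans (nm_im _ _); rewrite normrN ger0_norm; lra.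
  apply: (le_trans (nm_cpx _ _)).
  have : `|x| <= rho by rewrite ler_norml.
  have : `|y| <= rho by rewrite ler_norml; lra.
  lra.
have bdz z : bd z -> z != 0.
  by move=> /bdn /andP[b _]; rewrite -nm_gt0; apply: lt_le_trans b.
pose k z := f z / z.
have kE n u v : (forall z, onseg u v z -> bd z) ->
    trap k n u v = trap g n u v + f 0 * trap (fun z => z^-1) n u v.
  move=> H; rewrite -(@trap_lin R g (fun z => z^-1) (fun z => g z + f 0 * z^-1)) //.
  by apply: trap_ext => z /H /bdz z0; rewrite /k /g (negPf z0); field.
have kb n u v : (forall z, onseg u v z -> bd z) ->
    nm (trap k n u v) <= M / (t * rho) * nm (v - u).
  move=> H; apply: trap_bound => z /H bz; rewrite /k nmM nmV.
  have /andP[b _] := bdn _ bz.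
  have fM : nm (f z) <= M.
    by have [x [y [-> xin yin E]]] := bz; exact: HM.
  apply: ler_pM; rewrite ?nm_ge0 ?invr_ge0 ?nm_ge0 //.
  by rewrite lef_pV2 ?posrE // (lt_le_trans tr0 b).
have ib n u v : (forall z, onseg u v z -> bd z) -> 0 <= cross u v ->
    cross u v / (2 * rho) ^+ 2 <= im (trap (fun z => z^-1) n u v).
  move=> H cr; apply: im_trap_inv => // z /H /bdn /andP[b1 b2].
  by rewrite b2 (lt_le_trans tr0 b1).
have cE n : ctour k n a W V = ctour g n a W V + f 0 * ctour (fun z => z^-1) n a W V.
  by rewrite /ctour aWV aW aV !kE //; ring.
have c1 : cross A B = 2 * t * rho ^+ 2 by rewrite /cross /A /B /a /=; ring.
have c2 : cross B D = (1 + t) * rho ^+ 2 by rewrite /cross /B /D /=; ring.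
have c3 : cross D F = 2 * rho ^+ 2 by rewrite /cross /D /F /=; ring.
have c4 : cross F A = (1 + t) * rho ^+ 2 by rewrite /cross /F /A /a /=; ring.
have r2 : 0 < rho ^+ 2 by rewrite exprn_gt0.
(* The four sides contribute at least [t/2], [(1 + t)/4], [1/2] and [(1 + t)/4], together
   [1 + t]. *)
have cI n : 1 <= nm (ctour (fun z => z^-1) n a W V).
  apply: le_trans (nm_Im _); apply: le_trans (ler_norm _).
  have imD (z z' : C) : im (z + z') = im z + im z' by case: z z' => [? ?] [? ?].
  rewrite /ctour aWV aW aV !imD.
  have i1 := ib n A B bdAB; have i2 := ib n B D bdBD; have i3 := ib n D F bdDF; have i4 := ib n F A bdFA.
  rewrite c1 in i1; rewrite c2 in i2; rewrite c3 in i3; rewrite c4 in i4.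
  have {}i1 := i1 ltac:(rewrite !mulr_ge0 ?ltW //).
  have {}i2 := i2 ltac:(apply: mulr_ge0; lra).
  have {}i3 := i3 ltac:(apply: mulr_ge0; lra).
  have {}i4 := i4 ltac:(apply: mulr_ge0; lra).
  have ee s : s * rho ^+ 2 / (2 * rho) ^+ 2 = s / 4 by field; rewrite gt_eqF.
  move: i1 i2 i3 i4; rewrite !ee -/A; lra.
(* Four sides of length at most [2 rho], on which [f z / z] is at most [M / (t rho)]. *)
have cK n : nm (ctour k n a W V) <= 8 / t * M.
  have n1 : nm (B - A) <= 2 * rho.
    rewrite cpxB; apply: (le_trans (nm_cpx _ _)).
    by rewrite subrr normr0 addr0 ger0_norm; lra.
  have n2 : nm (D - B) <= 2 * rho.
    rewrite cpxB; apply: (le_trans (nm_cpx _ _)).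
    by rewrite subrr normr0 add0r ger0_norm; lra.
  have n3 : nm (F - D) <= 2 * rho.
    rewrite nmC cpxB; apply: (le_trans (nm_cpx _ _)).
    by rewrite subrr normr0 addr0 ger0_norm; lra.
  have n4 : nm (A - F) <= 2 * rho.
    rewrite nmC cpxB; apply: (le_trans (nm_cpx _ _)).
    by rewrite subrr normr0 add0r ger0_norm; lra.
  have s0 : 0 <= M / (t * rho) by rewrite divr_ge0 // ltW.
  have kb' u v : (forall z, onseg u v z -> bd z) -> nm (v - u) <= 2 * rho ->
      nm (trap k n u v) <= 2 / t * M.
    move=> H1 H2; apply: (le_trans (kb n _ _ H1)); apply: (le_trans (ler_wpM2l s0 H2)).
    by rewrite le_eqVlt; apply/orP; left; apply/eqP; field; rewrite !gt_eqF.
  rewrite /ctour aWV aW aV; apply: (le_trans (nmD _ _)).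
  apply: (le_trans (lerD (nmD _ _) (lexx _))).
  apply: (le_trans (lerD (lerD (nmD _ _) (lexx _)) (lexx _))).
  have := kb' _ _ bdAB n1; have := kb' _ _ bdBD n2; have := kb' _ _ bdDF n3; have := kb' _ _ bdFA n4.
  have -> : 8 / t * M = 4 * (2 / t * M) by ring.
  lra.
rewrite leNgt; apply/negP => lt.
have e0 : 0 < (nm (f 0) - 8 / t * M) / 2 by lra.
have [n0 Hn] := G _ e0; have {}Hn := Hn n0 (leqnn _).
have fE : f 0 * ctour (fun z => z^-1) n0 a W V = ctour k n0 a W V - ctour g n0 a W V.
  by rewrite cE; ring.
have : nm (f 0) * 1 <= nm (f 0) * nm (ctour (fun z => z^-1) n0 a W V).
  by rewrite ler_wpM2l ?nm_ge0.
rewrite -nmM fE; have := nmB (ctour k n0 a W V) (ctour g n0 a W V); have := cK n0; lra.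
Qed.

Lemma geom_le0 (x K th : R) : 0 <= th < 1 -> (forall n, x <= K * th ^+ n) -> x <= 0.
Proof.
move=> th01 H; rewrite leNgt; apply/negP => x0.
have d0 : 0 < 1 - th by lra.
have bern n : (1 + n%:R * (1 - th)) * th ^+ n <= 1.
  elim: n => [|n IH]; first by rewrite mul0r addr0 mul1r expr0.
  apply: le_trans IH; rewrite exprS mulrA ler_wpM2r ?exprn_ge0 //; first by lra.
  have n0 : 0 <= n%:R * (1 - th) * (1 - th) by rewrite !mulr_ge0 // ltW.
  rewrite -natr1; nra.
have K0 : 0 < K by have := H 0%N; rewrite expr0 mulr1; lra.
have nb := archi_boundP (ltW (divr_gt0 (divr_gt0 K0 x0) d0)).
set n := Num.bound _ in nb.
have := H n; have := bern n.
have : K / x < n%:R * (1 - th) by rewrite -ltr_pdivrMr.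
rewrite ltr_pdivrMr // => h1 h2 h3.
have t0 : 0 < th ^+ n.
  rewrite lt_def exprn_ge0 ?andbT; last by lra.
  apply/eqP => E; move: h3; rewrite E mulr0; lra.
nra.
Qed.

(** [max_rect] is applied on a rectangle whose lower side lies on the real axis, where [f] vanishes,
    to [f] times the [n]-th power of a peak function. That function is [1] at the point and at most
    [25/28] on the other sides, so the lossy constant is beaten as [n] grows. *)
Lemma zero_half (f : C -> C) : (forall z, nm z < 1 -> cdiff f z) ->
  (forall x, `|x| < 1 -> f (rC x) = 0) ->
  forall x y, 0 < y -> `|x| < 1/8 -> y < 1/8 -> f (cpx x y) = 0.
Proof.
move=> Hf Hz x y y0 x8 y8.
move: x8; rewrite ltr_norml => x8.
have in1 u v : - (1/2) <= u <= 1/2 -> - (2 * y * (1/2)) <= v <= 1/2 -> nm (cpx x y + cpx u v) < 1.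
  move=> hu hv; rewrite cpxD /= -(@ltr_pXn2r _ 2) ?nnegrE ?sqrtr_ge0 // sqr_sqrtr; last first.
    by rewrite addr_ge0 ?sqr_ge0.
  have a1 : (x + u) ^+ 2 <= (5/8) ^+ 2.
    have : 0 <= (5/8 - (x + u)) * (5/8 + (x + u)) by apply: mulr_ge0; lra.
    rewrite !expr2; lra.
  have a2 : (y + v) ^+ 2 <= (5/8) ^+ 2.
    have : 0 <= (5/8 - (y + v)) * (5/8 + (y + v)) by apply: mulr_ge0; lra.
    rewrite !expr2; lra.
  rewrite expr1n; lra.
have [B HB] : exists B, forall u v, - (1/2) <= u <= 1/2 -> - (2 * y * (1/2)) <= v <= 1/2 ->
    nm (f (cpx x y + cpx u v)) <= B.
  have := @bounded_rect f (cpx x y + cpx (- (1/2)) (- y)) (cpx 1 0) (cpx 0 (1/2 + y)).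
  case=> [s t s01 t01|B HB].
    rewrite !rCM -!addrA !cpxD; apply: Hf; rewrite -cpxD; apply: in1.
      by lra.
    have p : 0 <= t * (1/2 + y) <= 1 * (1/2 + y) by rewrite mulr_ge0 ?ler_wpM2r //; lra.
    by lra.
  exists B => u v hu hv.
  have h0 : 0 < 1/2 + y by lra.
  have := HB (u + 1/2) ((v + y) / (1/2 + y)).
  rewrite !rCM !mulr0 -!addrA !cpxD mulr1 divfK ?gt_eqF //.
  have -> : - (1 / 2) + (u + 1 / 2 + 0) = u by ring.
  have -> : - y + (0 + (v + y)) = v by ring.
  apply; first by lra.
  by rewrite divr_ge0 ?ler_pdivrMr //; lra.
apply: nm_small_eq0 => e e0; apply: le_trans (ltW e0).
have q0 : cpx 0 (y + 1/2) != 0 by apply/eqP => /(congr1 im) /=; lra.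
apply: (@geom_le0 _ (8 / (2 * y) * B) (25/28)) => [|n]; first by lra.
(* The pole lies at distance [1/2] below the real axis. On the other three sides the numerator is at
   most [5/8] and the denominator at least [7/10], whence [25/28]. *)
pose h z := f (cpx x y + z) * (cpx 0 (y + 1/2) * (z + cpx 0 (y + 1/2))^-1) ^+ n.
have h0E : h 0 = f (cpx x y) by rewrite /h addr0 add0r divff // expr1n mulr1.
rewrite -h0E -[X in _ <= X]mulrA; apply: (@max_rect h (1/2) (2 * y) (B * (25/28) ^+ n)).
- by lra.
- by lra.
- move=> u v hu hv; apply: cdiff_mul.
    have := @cdiff_affine R f (cpx x y) 1 (cpx u v).
    rewrite mulr1 => /(_ (Hf _ (in1 _ _ hu hv))).
    by apply: cdiff_ext => z; rewrite mulr1.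
  apply: cdiff_exp; apply: cdiff_mul; first exact: cdiff_const.
  apply: cdiff_inv; last by apply: cdiff_add; [exact: cdiff_id|exact: cdiff_const].
  by rewrite cpxD; apply/eqP => /(congr1 im) /=; lra.
- move=> u v hu hv bnd.
  have q : 0 <= (y + v) * (y + v + 1) by apply: mulr_ge0; lra.
  have low : v = - (2 * y * (1/2)) \/ 7/10 <= nm (cpx u v + cpx 0 (y + 1/2)).
    case: bnd => E; [right|right|right|by left]; rewrite cpxD.
    + rewrite /= -(@ler_pXn2r _ 2) ?nnegrE ?sqrtr_ge0 // ?sqr_sqrtr; last by rewrite addr_ge0 ?sqr_ge0.
      by rewrite E addr0 !expr2; lra.
    + rewrite /= -(@ler_pXn2r _ 2) ?nnegrE ?sqrtr_ge0 // ?sqr_sqrtr; last by rewrite addr_ge0 ?sqr_ge0.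
      by rewrite E addr0 !expr2; lra.
    + apply: le_trans (nm_im _ _); rewrite ger0_norm; lra.
  case: low => [E|low].
    have -> : h (cpx u v) = 0.
      rewrite /h cpxD E; have -> : y + - (2 * y * (1/2)) = 0 by field.
      have -> : cpx (x + u) 0 = rC (x + u) by [].
      by rewrite Hz ?mul0r // ltr_norml; lra.
    rewrite nm0; apply: mulr_ge0; first exact: le_trans (nm_ge0 _) (HB _ _ hu hv).
    by apply: exprn_ge0; lra.
  rewrite /h nmM nmX nmM nmV; apply: ler_pM.
  - exact: nm_ge0.
  - by rewrite exprn_ge0 // mulr_ge0 ?invr_ge0 ?nm_ge0.
  - exact: HB.
  have l0 : 0 < nm (cpx u v + cpx 0 (y + 1/2)) by lra.
  apply: lerXn2r; rewrite ?nnegrE; [by rewrite mulr_ge0 ?invr_ge0 ?nm_ge0|lra|].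
  rewrite ler_pdivrMr //; apply: (le_trans (nm_cpx _ _)).
  rewrite normr0 add0r ger0_norm; lra.
Qed.

Lemma zero_near_real (f : C -> C) : (forall z, nm z < 1 -> cdiff f z) ->
  (forall x, `|x| < 1 -> f (rC x) = 0) -> forall z, nm z < 1/8 -> f z = 0.
Proof.
move=> Hf Hz [x y] z8.
have x8 := le_lt_trans (nm_re x y) z8; have y8 := le_lt_trans (nm_im x y) z8.
case: (ltrgtP y 0) => y0; last first.
- by rewrite y0; apply: Hz; lra.
- by apply: zero_half => //; move: y8; rewrite gtr0_norm.
have := @zero_half (fun z => f (0 + z * -1)).
have -> : f (cpx x y) = (fun z => f (0 + z * -1)) (cpx (- x) (- y)).
  by rewrite add0r mulrN1; congr f; apply/eqP; rewrite eq_complex /= !opprK !eqxx.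
apply.
- by move=> z z1; apply: cdiff_affine; rewrite add0r mulrN1; apply: Hf; rewrite nmN.
- by move=> u u1; rewrite add0r mulrN1 -rmorphN; apply: Hz; rewrite normrN.
- by lra.
- by rewrite normrN.
- by move: y8; rewrite ltr0_norm.
Qed.

(** The peak argument around [a], with base [a / (a + z)]: its pole falls on the centre of the disc
    where [f] is already zero, so the product stays differentiable. On the square of half side
    [rho / 3] the ratio is at most [(1/8) / (1/3 - 1/8) = 3/5]. *)
Lemma zero_spread (f : C -> C) (rho r0 : R) : 0 < rho -> 0 < r0 ->
  (forall z, nm z < rho -> cdiff f z) -> (forall z, nm z < r0 -> f z = 0) ->
  forall a, nm a < rho / 8 -> f a = 0.
Proof.
move=> rho0 r00 Hf Hz a a8.
case: (eqVneq a 0) => [->|a0]; first by apply: Hz; rewrite nm0.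
have inr u v : - (rho/3) <= u <= rho/3 -> - (1 * (rho/3)) <= v <= rho/3 -> nm (a + cpx u v) < rho.
  move=> hu hv; apply: (le_lt_trans (nmD _ _)).
  have := nm_cpx u v.
  have : `|u| <= rho/3 by rewrite ler_norml.
  have : `|v| <= rho/3 by rewrite ler_norml; lra.
  lra.
have [B HB] : exists B, forall u v, - (rho/3) <= u <= rho/3 -> - (1 * (rho/3)) <= v <= rho/3 ->
    nm (f (a + cpx u v)) <= B.
  have := @bounded_rect f (a + cpx (- (rho/3)) (- (rho/3))) (cpx (2 * rho/3) 0) (cpx 0 (2 * rho/3)).
  case=> [s t s01 t01|B HB].
    rewrite !rCM -!addrA !cpxD; apply: Hf; apply: inr.
      have p : 0 <= s * (2 * rho/3) <= 1 * (2 * rho/3) by rewrite mulr_ge0 ?ler_wpM2r //; lra.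
      by lra.
    have p : 0 <= t * (2 * rho/3) <= 1 * (2 * rho/3) by rewrite mulr_ge0 ?ler_wpM2r //; lra.
    by lra.
  exists B => u v hu hv.
  have h0 : 0 < 2 * rho/3 by lra.
  have := HB ((u + rho/3) / (2 * rho/3)) ((v + rho/3) / (2 * rho/3)).
  rewrite !rCM !mulr0 -!addrA !cpxD !divfK ?gt_eqF //.
  have -> : - (rho / 3) + (u + rho / 3 + 0) = u by ring.
  have -> : - (rho / 3) + (0 + (v + rho / 3)) = v by ring.
  by apply; rewrite divr_ge0 ?ler_pdivrMr //; lra.
apply: nm_small_eq0 => e e0; apply: le_trans (ltW e0).
apply: (@geom_le0 _ (8 / 1 * B) (3/5)) => [|n]; first by lra.
pose h z := f (a + z) * (a * (a + z)^-1) ^+ n.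
have h0E : h 0 = f a by rewrite /h addr0 divff // expr1n mulr1.
have fd z : nm (a + z) < rho -> cdiff (fun z => f (a + z)) z.
  move=> az; have := @cdiff_affine R f a 1 z; rewrite mulr1 => /(_ (Hf _ az)).
  by apply: cdiff_ext => w; rewrite mulr1.
rewrite -h0E -[X in _ <= X]mulrA; apply: (@max_rect h (rho/3) 1 (B * (3/5) ^+ n)).
- by lra.
- by lra.
- move=> u v hu hv; set z := cpx u v; have az := inr u v hu hv; rewrite -/z in az.
  case: (eqVneq (a + z) 0) => [E|nz].
    exists 0; apply: (@cder_near R (fun=> 0) h z 0 r0) => //; last exact: cder_const.
    by move=> w wr; rewrite /h addrA E add0r Hz // mul0r.
  apply: cdiff_mul; first exact: fd.
  apply: cdiff_exp; apply: cdiff_mul; first exact: cdiff_const.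
  by apply: cdiff_inv => //; apply: cdiff_add; [exact: cdiff_const|exact: cdiff_id].
- move=> u v hu hv bnd.
  have low : rho/3 <= nm (cpx u v).
    case: bnd => ->.
    + by apply: le_trans (nm_re _ _); rewrite ger0_norm; lra.
    + by apply: le_trans (nm_re _ _); rewrite normrN ger0_norm; lra.
    + by apply: le_trans (nm_im _ _); rewrite ger0_norm; lra.
    + by apply: le_trans (nm_im _ _); rewrite mul1r normrN ger0_norm; lra.
  have low2 : rho/3 - rho/8 < nm (a + cpx u v).
    have := nmB (a + cpx u v) a; rewrite [a + _ - _]addrAC subrr add0r; lra.
  rewrite /h nmM nmX nmM nmV; apply: ler_pM.
  - exact: nm_ge0.
  - by rewrite exprn_ge0 // mulr_ge0 ?invr_ge0 ?nm_ge0.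
  - exact: HB.
  apply: lerXn2r; rewrite ?nnegrE; [by rewrite mulr_ge0 ?invr_ge0 ?nm_ge0|lra|].
  by rewrite ler_pdivrMr; lra.
Qed.

(** A chain of discs of radius [rho / 16] with centres less than [rho / 16] apart: each lies in the
    disc of radius [rho / 8] about the previous centre that [zero_spread] clears. *)
Lemma zero_walk (f : C -> C) (rho t0 r0 : R) : 0 < rho -> 0 < r0 -> 0 <= t0 <= 1 ->
  (forall t w, 0 <= t <= 1 -> nm w < rho -> cdiff f (rC t + w)) ->
  (forall w, nm w < r0 -> f (rC t0 + w) = 0) -> f 1 = 0.
Proof.
move=> rho0 r00 t01 Hf Hz.
have fd t z : 0 <= t <= 1 -> nm z < rho -> cdiff (fun z => f (rC t + z)) z.
  move=> tt az; have := @cdiff_affine R f (rC t) 1 z; rewrite mulr1 => /(_ (Hf _ _ tt az)).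
  by apply: cdiff_ext => w; rewrite mulr1.
have step t t' : 0 <= t <= 1 -> 0 <= t' <= 1 -> `|t' - t| < rho / 16 ->
    (exists2 r, 0 < r & forall w, nm w < r -> f (rC t + w) = 0) ->
    exists2 r, 0 < r & forall w, nm w < r -> f (rC t' + w) = 0.
  move=> tt tt' d [r r1 Hr]; exists (rho / 16); first by lra.
  move=> w wr; have := @zero_spread (fun z => f (rC t + z)) rho r rho0 r1 (fun z => @fd t z tt) Hr (rC (t' - t) + w).
  have -> : rC t + (rC (t' - t) + w) = rC t' + w by rewrite rmorphB /=; ring.
  by apply; apply: (le_lt_trans (nmD _ _)); rewrite nm_real; lra.
have [N HN] := half_pow_small ler01 (divr_gt0 rho0 (ltr0Sn _ 15)).
have {}HN := HN N (leqnn _); rewrite mul1r in HN.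
have kk k : (k <= 2 ^ N)%N -> exists2 r, 0 < r & forall w, nm w < r ->
    f (rC (t0 + k%:R * 2^-1 ^+ N * (1 - t0)) + w) = 0.
  elim: k => [_|k IH kN].
    by exists r0 => //; rewrite !mul0r addr0.
  have h0 : 0 < (2^-1 : R) ^+ N by rewrite exprn_gt0 ?invr_gt0.
  have bk j : (j <= 2 ^ N)%N -> 0 <= t0 + j%:R * 2^-1 ^+ N * (1 - t0) <= 1.
    move=> jN; have : 0 <= j%:R * (2^-1 : R) ^+ N <= 1.
      rewrite mulr_ge0 ?(ltW h0) //= exprVn ler_pdivrMr ?exprn_gt0 // mul1r.
      by rewrite -natrX ler_nat.
    by nra.
  apply: step (IH (ltnW kN)); [exact: bk (ltnW kN)|exact: bk|].
  rewrite -natr1.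
  have -> : t0 + (k%:R + 1) * 2^-1 ^+ N * (1 - t0) - (t0 + k%:R * 2^-1 ^+ N * (1 - t0)) =
    2^-1 ^+ N * (1 - t0) by ring.
  rewrite ger0_norm; first by nra.
  by rewrite mulr_ge0 ?(ltW h0) //; lra.
have [r r1 Hr] := kk (2 ^ N)%N (leqnn _).
have := Hr 0; rewrite nm0 addr0 natrX exprVn mulfV ?expf_neq0 ?pnatr_eq0 // mul1r addrC subrK rmorph1.
by apply.
Qed.

(** The form in which continuation is used throughout: zeros on a real interval at one end of
    [[0, 1]] reach the other end. [zero_near_real] is applied on a disc about [c = min 1 t1 / 2] of
    radius at most [c], whose real diameter lies in the interval. *)
Lemma identity01 (f : C -> C) (rho t1 : R) : 0 < rho -> 0 < t1 ->
  (forall t w, 0 <= t <= 1 -> nm w < rho -> cdiff f (rC t + w)) ->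
  (forall t, 0 < t < t1 -> f (rC t) = 0) -> f 1 = 0.
Proof.
move=> rho0 t10 Hf Hz.
pose c := Num.min 1 t1 / 2; pose r := Num.min rho c.
have mm : 0 < Num.min 1 t1 by rewrite lt_min ltr01.
have m1 : Num.min 1 t1 <= 1 by rewrite ge_min lexx.
have m2 : Num.min 1 t1 <= t1 by rewrite ge_min lexx orbT.
have c0 : 0 < c by rewrite divr_gt0.
have r0 : 0 < r by rewrite lt_min rho0.
have rrho : r <= rho by rewrite ge_min lexx.
have rc : r <= c by rewrite ge_min lexx orbT.
have ct : c + c = Num.min 1 t1 by rewrite /c; field.
have rn : rC r != 0 by rewrite -nm_gt0 nm_real gtr0_norm.
apply: (@zero_walk f rho c (r / 8)) => //.
- by rewrite divr_gt0.
- by lra.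
move=> w wr; have := @zero_near_real (fun z => f (rC c + z * rC r)) _ _ (w / rC r).
rewrite divfK //; apply.
- move=> z z1; apply: cdiff_affine; apply: Hf; first by lra.
  rewrite nmM nm_real gtr0_norm //; apply: lt_le_trans rrho.
  by rewrite -[X in _ < X]mul1r ltr_pM2r.
- move=> x x1; rewrite -rmorphM -rmorphD; apply: Hz.
  have : `|x * r| < r by rewrite normrM (gtr0_norm r0) -[X in _ < X]mul1r ltr_pM2r.
  by rewrite ltr_norml; lra.
- by rewrite nmM nmV nm_real gtr0_norm // ltr_pdivrMr //; move: wr; lra.
Qed.

End Identity.

(** * Holomorphic maps of several variables *)

Section SeveralVariables.
Variable R : realType.
Local Notation C := R[i].
Local Notation nm := (@ComplexField.Normc.normc R).
Local Notation rC := (@real_complex_def R (Phant R)).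

Lemma fin_pos (I : finType) (F : I -> R) : (forall i, 0 < F i) ->
  exists2 e, 0 < e & forall i, e <= F i.
Proof.
move=> H; suff [e e0 He] : exists2 e, 0 < e & forall i, i \in enum I -> e <= F i.
  by exists e => // i; apply: He; rewrite mem_enum.
elim: (enum I) => [|i s [e e0 He]]; first by exists 1.
exists (Num.min (F i) e); first by rewrite lt_min H.
move=> j; rewrite inE ge_min => /orP[/eqP ->|/He ->]; first by rewrite lexx.
by rewrite orbT.
Qed.

Lemma fin_near (I : finType) (P : I -> C -> Prop) :
  (forall i, exists2 d, 0 < d & forall w, nm w < d -> P i w) ->
  exists2 d, 0 < d & forall i w, nm w < d -> P i w.
Proof.
move=> H; have [d Hd] := choice (fun i => (fun h => let: ex_intro2 x y z := h in
  ex_intro (fun x => 0 < x /\ forall w, nm w < x -> P i w) x (conj y z)) (H i)).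
have [e e0 He] := fin_pos (fun i => proj1 (Hd i)).
by exists e => // i w we; apply: (proj2 (Hd i)); apply: lt_le_trans (He i).
Qed.

Lemma fin_lt_bound (I : finType) (F : I -> R) (rho : R) : 0 < rho ->
  (forall i, F i < rho) -> exists2 q, q < rho & forall i, F i <= q.
Proof.
move=> r0 H; have H' i : 0 < rho - F i by rewrite subr_gt0.
have [e e0 He] := fin_pos H'.
by exists (rho - e) => [|i]; [lra|have := He i; lra].
Qed.

Definition mcdiff a b (F : C -> 'M[C]_(a, b)) t := forall i j, cdiff (fun s => F s i j) t.

Lemma mcdiff_const a b (A : 'M[C]_(a, b)) t : mcdiff (fun=> A) t.
Proof. by move=> i j; exact: cdiff_const. Qed.
Lemma mcdiff_add a b (F G : C -> 'M[C]_(a, b)) t : mcdiff F t -> mcdiff G t ->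
  mcdiff (fun s => F s + G s) t.
Proof.
by move=> hF hG i j; apply: cdiff_ext (cdiff_add (hF i j) (hG i j)) => s; rewrite mxE.
Qed.
Lemma mcdiff_scale a b (f : C -> C) (F : C -> 'M[C]_(a, b)) t : cdiff f t -> mcdiff F t ->
  mcdiff (fun s => f s *: F s) t.
Proof.
by move=> hf hF i j; apply: cdiff_ext (cdiff_mul hf (hF i j)) => s; rewrite mxE.
Qed.
Lemma mcdiff_sub a b (F G : C -> 'M[C]_(a, b)) t : mcdiff F t -> mcdiff G t ->
  mcdiff (fun s => F s - G s) t.
Proof.
by move=> hF hG i j; apply: cdiff_ext (cdiff_sub (hF i j) (hG i j)) => s; rewrite !mxE.
Qed.
Lemma mcdiff_mul a b c (F : C -> 'M[C]_(a, b)) (G : C -> 'M[C]_(b, c)) t :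
  mcdiff F t -> mcdiff G t -> mcdiff (fun s => F s *m G s) t.
Proof.
move=> hF hG i j; apply: (@cdiff_ext _ (fun s => \sum_k F s i k * G s k j)).
  by move=> s; rewrite mxE.
by apply: cdiff_sum => k; exact: cdiff_mul.
Qed.
Lemma mcdiff_affine a b (A B : 'M[C]_(a, b)) t : mcdiff (fun s => A + s *: B) t.
Proof.
apply: mcdiff_add; first exact: mcdiff_const.
by apply: mcdiff_scale; [exact: cdiff_id|exact: mcdiff_const].
Qed.
Lemma cdiff_det a (F : C -> 'M[C]_a) t : mcdiff F t -> cdiff (fun s => \det (F s)) t.
Proof.
move=> hF; apply: cdiff_sum => s; apply: cdiff_mul; first exact: cdiff_const.
by apply: cdiff_prod => i; exact: hF.
Qed.
Lemma mcdiff_adj a (F : C -> 'M[C]_a) t : mcdiff F t -> mcdiff (fun s => \adj (F s)) t.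
Proof.
move=> hF i j.
apply: (@cdiff_ext _ (fun s => (-1) ^+ (j + i) * \det (row' j (col' i (F s))))).
  by move=> s; rewrite mxE.
apply: cdiff_mul; first exact: cdiff_const.
apply: cdiff_det => k l; apply: cdiff_ext (hF (lift j k) (lift i l)) => s.
by rewrite !mxE.
Qed.

Variable n : nat.
Variable p0 : 'rV[C]_n.
Variable rho : R.

Definition inbox (p : 'rV[C]_n) (q : R) a (X : 'M[C]_(a, n)) :=
  forall i j, nm (X i j - p 0 j) < q.
Local Notation inO := (inbox p0 rho).

Lemma inO_row a (X : 'M[C]_(a, n)) i : inO X -> inO (row i X).
Proof. by move=> H k j; rewrite mxE; exact: H. Qed.

Lemma inO_rows a (X : 'M[C]_(a, n)) : (forall i, inO (row i X)) -> inO X.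
Proof. by move=> H i j; have := H i 0 j; rewrite mxE. Qed.

Lemma inO_col a b (X : 'M[C]_(a, n)) (Y : 'M[C]_(b, n)) : inO X -> inO Y -> inO (col_mx X Y).
Proof. by move=> hX hY i j; rewrite mxE; case: splitP. Qed.

Lemma inO_near a (X : 'M[C]_(a, n)) : inO X ->
  exists2 e, 0 < e & forall E : 'M[C]_(a, n), (forall i j, nm (E i j) < e) -> inO (X + E).
Proof.
move=> H; case: (ltP 0 rho) => r0; last first.
  exists 1 => // E _ i j; exfalso; have := H i j; rewrite ltNge; apply/negP.
  by rewrite negbK (le_trans r0) // nm_ge0.
have [q q0 Hq] := @fin_lt_bound ('I_a * 'I_n)%type (fun k => nm (X k.1 k.2 - p0 0 k.2)) rho r0
  (fun k => H k.1 k.2).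
exists (rho - q); first by lra.
move=> E HE i j; rewrite mxE addrAC; apply: (le_lt_trans (nmD _ _)).
have := Hq (i, j) => /=; have := HE i j; lra.
Qed.

Lemma mcdiff_cont a b (F : C -> 'M[C]_(a, b)) t e : mcdiff F t -> 0 < e ->
  exists2 d, 0 < d & forall w, nm w < d -> forall i j, nm (F (t + w) i j - F t i j) < e.
Proof.
move=> hF e0; have e20 : 0 < e / 2 by rewrite divr_gt0.
have [d d0 Hd] := fin_near (fun k : 'I_a * 'I_b => cdiff_cont (hF k.1 k.2) e20).
exists d => // w wd i j; apply: le_lt_trans (Hd (i, j) w wd) _; lra.
Qed.

Lemma inO_cont a (F : C -> 'M[C]_(a, n)) t : mcdiff F t -> inO (F t) ->
  exists2 e, 0 < e & forall w, nm w < e -> inO (F (t + w)).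
Proof.
move=> hF /inO_near [e e0 He]; have [d d0 Hd] := mcdiff_cont hF e0.
exists d => // w wd; have -> : F (t + w) = F t + (F (t + w) - F t) by rewrite [RHS]addrC subrK.
by apply: He => i j; rewrite !mxE; exact: Hd.
Qed.

(** The box is convex, and finitely many strict inequalities leave a margin for a complex
    neighbourhood of the segment. *)
Lemma inO_line a (A B : 'M[C]_(a, n)) : inO A -> inO (A + B) ->
  exists2 e, 0 < e & forall t w, 0 <= t <= 1 -> nm w < e -> inO (A + (rC t + w) *: B).
Proof.
move=> HA HB; case: (ltP 0 rho) => r0; last first.
  exists 1 => // t w _ _ i j; exfalso; have := HA i j; rewrite ltNge; apply/negP.
  by rewrite negbK (le_trans r0) // nm_ge0.
have [q q0 Hq] := @fin_lt_bound ('I_a * 'I_n)%type (fun k => nm (A k.1 k.2 - p0 0 k.2)) rho r0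
  (fun k => HA k.1 k.2).
have [p pp Hp] := @fin_lt_bound ('I_a * 'I_n)%type (fun k => nm ((A + B) k.1 k.2 - p0 0 k.2)) rho r0
  (fun k => HB k.1 k.2).
pose b k := nm (B k.1 k.2) + 1.
have bpos (k : 'I_a * 'I_n) : 0 < (b k)^-1 by rewrite invr_gt0 /b ltr_wpDl ?nm_ge0.
have [c c0 Hc] := fin_pos bpos.
pose m := Num.max q p; have qm : q <= m by rewrite le_max lexx.
have pm : p <= m by rewrite le_max lexx orbT.
have mr : m < rho by rewrite gt_max q0.
exists ((rho - m) * c); first by rewrite mulr_gt0 // subr_gt0.
move=> t w t01 wd i j.
have -> : (A + (rC t + w) *: B) i j - p0 0 j =
   rC (1 - t) * (A i j - p0 0 j) + rC t * ((A + B) i j - p0 0 j) + w * B i j.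
  by rewrite !mxE rmorphB rmorph1 /=; ring.
have h1 : nm (rC (1 - t) * (A i j - p0 0 j)) <= (1 - t) * m.
  rewrite nmM nm_real ger0_norm; last by lra.
  by rewrite ler_wpM2l ?(le_trans (Hq (i, j))) //; lra.
have h2 : nm (rC t * ((A + B) i j - p0 0 j)) <= t * m.
  rewrite nmM nm_real ger0_norm; last by lra.
  by rewrite ler_wpM2l ?(le_trans (Hp (i, j))) //; lra.
have h3 : nm (w * B i j) < rho - m.
  rewrite nmM; have k0 := bpos (i, j); rewrite invr_gt0 in k0.
  have : nm w * b (i, j) < rho - m.
    rewrite -ltr_pdivlMr //; apply: lt_le_trans wd _.
    by rewrite ler_wpM2l ?subr_ge0 ?(ltW mr) // Hc.
  apply: le_lt_trans; rewrite ler_wpM2l ?nm_ge0 // /b /=; lra.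
apply: (le_lt_trans (nmD _ _)); apply: (le_lt_trans (lerD (nmD _ _) (lexx _))); lra.
Qed.

(** [q] is any bound for the entries of [h], so the supremum norm need not be formed. *)
Definition hder m (g : 'rV[C]_n -> 'rV[C]_m) x (L : 'M[C]_(n, m)) := forall e, 0 < e ->
  exists2 d, 0 < d & forall (h : 'rV[C]_n) q, q < d -> (forall i, nm (h 0 i) <= q) ->
    forall j, nm ((g (x + h) - g x - h *m L) 0 j) <= e * q.
Definition hdiff m (g : 'rV[C]_n -> 'rV[C]_m) x := exists L, hder g x L.

Lemma hder_line m (g : 'rV[C]_n -> 'rV[C]_m) L (a b : 'rV[C]_n) t j : hder g (a + t *: b) L ->
  cder (fun s => g (a + s *: b) 0 j) t ((b *m L) 0 j).
Proof.
move=> gL e e0; pose K := \sum_i nm (b 0 i) + 1.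
have K0 : 0 < K by rewrite ltr_wpDl // sumr_ge0 // => i _; exact: nm_ge0.
have bK i : nm (b 0 i) <= K.
  rewrite /K (bigD1 i) //= -addrA lerDl addr_ge0 // sumr_ge0 // => k _; exact: nm_ge0.
have [d d0 Hd] := gL (e / K) (divr_gt0 e0 K0).
exists (d / K); first by rewrite divr_gt0.
move=> w; rewrite ltr_pdivlMr // => wd.
have Hb i : nm ((w *: b) 0 i) <= nm w * K by rewrite mxE nmM ler_wpM2l ?nm_ge0.
have := Hd (w *: b) (nm w * K) wd Hb j.
have -> : a + t *: b + w *: b = a + (t + w) *: b by rewrite scalerDl addrA.
rewrite !mxE.
have -> : e / K * (nm w * K) = e * nm w by field; rewrite gt_eqF.
have -> : \sum_k (w *: b) 0 k * L k j = (\sum_k b 0 k * L k j) * w => //.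
by rewrite mulr_suml; apply: eq_bigr => k _; rewrite mxE; ring.
Qed.

Section Lift.
Variable m : nat.
Variable g : 'rV[C]_n -> 'rV[C]_m.
Hypothesis gd : forall x, inO x -> hdiff g x.

Definition gm a (X : 'M[C]_(a, n)) : 'M[C]_(a, m) := \matrix_i g (row i X).

Lemma row_gm a (X : 'M[C]_(a, n)) i : row i (gm X) = g (row i X).
Proof. by rewrite rowK. Qed.

Lemma gm_row (x : 'rV[C]_n) : gm x = g x.
Proof.
have -> : gm x = row 0 (gm x) by apply/rowP => j; rewrite [in RHS]mxE.
by rewrite row_gm; congr g; apply/rowP => j; rewrite mxE.
Qed.

Lemma gm_col a b (X : 'M[C]_(a, n)) (Y : 'M[C]_(b, n)) : gm (col_mx X Y) = col_mx (gm X) (gm Y).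
Proof.
apply/row_matrixP => i; rewrite row_gm; case: (splitP i) => k ik.
  have -> : i = lshift b k by apply: val_inj.
  by rewrite !rowKu row_gm.
have -> : i = rshift a k by apply: val_inj.
by rewrite !rowKd row_gm.
Qed.

Lemma mcdiff_gm a (A B : 'M[C]_(a, n)) t : inO (A + t *: B) ->
  mcdiff (fun s => gm (A + s *: B)) t.
Proof.
move=> H i j.
have rE s : row i (A + s *: B) = row i A + s *: row i B by rewrite linearD linearZ.
have [L HL] := gd (inO_row i H); rewrite rE in HL.
exists ((row i B *m L) 0 j); apply: cder_ext (hder_line j HL) => s.
by rewrite -rE mxE.
Qed.

Lemma cdiff_gm_det a (A B : 'M[C]_(a, n)) P t : inO (A + t *: B) ->
  cdiff (fun s => \det (gm (A + s *: B) *m P)) t.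
Proof.
move=> H; apply: cdiff_det; apply: mcdiff_mul; [exact: mcdiff_gm|exact: mcdiff_const].
Qed.

(** [phi] will be a determinant or a linear functional of the images; the zeros are again given on a
    real interval only. *)
Lemma gm_identity a (A B : 'M[C]_(a, n)) (phi : 'M[C]_(a, m) -> C) t1 :
  (forall F t, mcdiff F t -> cdiff (fun s => phi (F s)) t) ->
  inO A -> inO (A + B) -> 0 < t1 ->
  (forall t, 0 < t < t1 -> phi (gm (A + rC t *: B)) = 0) -> phi (gm (A + B)) = 0.
Proof.
move=> hphi HA HB t10 Hz; have [e e0 He] := inO_line HA HB.
have := @identity01 R (fun s => phi (gm (A + s *: B))) e t1 e0 t10.
rewrite scale1r; apply=> [t w t01 we|//].
by apply: hphi; apply: mcdiff_gm; exact: He.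
Qed.

(** Freeness becomes the nonvanishing of one determinant with a fixed [P], which is an open and
    holomorphic condition on the family. *)
Lemma row_free_det a (G : 'M[C]_(a, m)) : row_free G <-> exists P, \det (G *m P) != 0.
Proof.
split=> [/row_freeP[P GP]|[P GP]]; first by exists P; rewrite GP det1 oner_eq0.
have : G *m P \in unitmx by rewrite unitmxE unitfE.
rewrite -row_free_unit /row_free => /eqP E; rewrite eqn_leq rank_leq_row /=.
by rewrite -[X in (X <= _)%N]E mxrankM_maxl.
Qed.

End Lift.

End SeveralVariables.

(** * Hermitian forms and null spaces *)

Section Hermitian.
Variable R : realType.
Local Notation C := R[i].
Local Notation nm := (@ComplexField.Normc.normc R).
Local Notation rC := (@real_complex_def R (Phant R)).

Lemma conjM (x y : C) : conjc (x * y) = conjc x * conjc y. Proof. exact: rmorphM. Qed.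
Lemma conjB (x y : C) : conjc (x - y) = conjc x - conjc y. Proof. exact: rmorphB. Qed.
Lemma conj_half : conjc (2^-1 : C) = 2^-1.
Proof. by rewrite conjc_inv conjc_nat. Qed.

Definition ct a b (A : 'M[C]_(a, b)) : 'M[C]_(b, a) := (map_mx conjc A)^T.

Lemma ctE a b (A : 'M[C]_(a, b)) i j : ct A i j = conjc (A j i).
Proof. by rewrite !mxE. Qed.
Lemma ctM a b c (A : 'M[C]_(a, b)) (B : 'M[C]_(b, c)) : ct (A *m B) = ct B *m ct A.
Proof. by rewrite /ct map_mxM trmx_mul. Qed.
Lemma ctK a b (A : 'M[C]_(a, b)) : ct (ct A) = A.
Proof. by apply/matrixP => i j; rewrite !mxE conjcK. Qed.
Lemma ctD a b (A B : 'M[C]_(a, b)) : ct (A + B) = ct A + ct B.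
Proof. by rewrite /ct map_mxD linearD. Qed.
Lemma ctB a b (A B : 'M[C]_(a, b)) : ct (A - B) = ct A - ct B.
Proof. by rewrite /ct map_mxB linearB. Qed.
Lemma ctZ a b c (A : 'M[C]_(a, b)) : ct (c *: A) = conjc c *: ct A.
Proof. by rewrite /ct map_mxZ linearZ. Qed.
Lemma ct1 a : ct (1%:M : 'M[C]_a) = 1%:M.
Proof. by rewrite /ct map_mx1 trmx1. Qed.
Lemma ct0 a b : ct (0 : 'M[C]_(a, b)) = 0.
Proof. by rewrite /ct map_mx0 trmx0. Qed.
Lemma ct_inj a b : injective (@ct a b).
Proof. by move=> A B E; rewrite -(ctK A) E ctK. Qed.

Lemma row_transport d (c c0 : 'rV[C]_d) : c != 0 -> c0 != 0 ->
  exists2 g, g \in unitmx & c *m g = c0.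
Proof.
have e1 (c1 : 'rV[C]_d) : c1 != 0 -> exists2 g, g \in unitmx & exists2 x, x != 0 & c1 = x *: pid_mx 1 *m g.
  move=> c10; exists (row_ebase c1); first exact: row_ebase_unit.
  have rk : \rank c1 = 1%N by rewrite rank_rV c10.
  exists (col_ebase c1 0 0); last first.
    by rewrite -{1}[c1]mulmx_ebase rk [col_ebase c1]mx11_scalar mul_scalar_mx !mxE.
  have := col_ebase_unit c1; rewrite unitmxE unitfE [col_ebase c1]mx11_scalar det_scalar1 mxE.
  by rewrite eqxx mulr1n.
move=> /e1[g gu [x x0 ->]] /e1[g' gu' [x' x'0 ->]].
exists (invmx g *m ((x' / x) *: g')).
  by rewrite unitmx_mul unitmx_inv gu unitmxZ ?gu' // unitfE mulf_neq0 // invr_eq0.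
rewrite mulmxA mulmxK // -!scalemxAl -scalemxAr scalerA mulrC divfK //.
Qed.

Section Form.
Variables (n : nat) (J : 'M[C]_n).
Hypothesis ctJ : ct J = J.
Hypothesis JJ : J *m J = 1%:M.

Definition hf a b (X : 'M[C]_(a, n)) (Y : 'M[C]_(b, n)) : 'M[C]_(a, b) := X *m J *m ct Y.

Lemma ct_hf a b (X : 'M[C]_(a, n)) (Y : 'M[C]_(b, n)) : ct (hf X Y) = hf Y X.
Proof. by rewrite /hf !ctM ctK ctJ mulmxA. Qed.
Lemma hfDl a b (X X' : 'M[C]_(a, n)) (Y : 'M[C]_(b, n)) : hf (X + X') Y = hf X Y + hf X' Y.
Proof. by rewrite /hf !mulmxDl. Qed.
Lemma hfDr a b (X : 'M[C]_(a, n)) (Y Y' : 'M[C]_(b, n)) : hf X (Y + Y') = hf X Y + hf X Y'.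
Proof. by rewrite /hf ctD mulmxDr. Qed.
Lemma hfBl a b (X X' : 'M[C]_(a, n)) (Y : 'M[C]_(b, n)) : hf (X - X') Y = hf X Y - hf X' Y.
Proof. by rewrite /hf !mulmxBl. Qed.
Lemma hfBr a b (X : 'M[C]_(a, n)) (Y Y' : 'M[C]_(b, n)) : hf X (Y - Y') = hf X Y - hf X Y'.
Proof. by rewrite /hf ctB mulmxBr. Qed.
Lemma hfMl a b c (A : 'M[C]_(c, a)) (X : 'M[C]_(a, n)) (Y : 'M[C]_(b, n)) :
  hf (A *m X) Y = A *m hf X Y.
Proof. by rewrite /hf !mulmxA. Qed.
Lemma hfMr a b c (A : 'M[C]_(c, b)) (X : 'M[C]_(a, n)) (Y : 'M[C]_(b, n)) :
  hf X (A *m Y) = hf X Y *m ct A.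
Proof. by rewrite /hf ctM !mulmxA. Qed.
Lemma hfZl a b c (X : 'M[C]_(a, n)) (Y : 'M[C]_(b, n)) : hf (c *: X) Y = c *: hf X Y.
Proof. by rewrite /hf -!scalemxAl. Qed.
Lemma hfZr a b c (X : 'M[C]_(a, n)) (Y : 'M[C]_(b, n)) : hf X (c *: Y) = conjc c *: hf X Y.
Proof. by rewrite /hf ctZ -scalemxAr. Qed.
Lemma hf0l a b (Y : 'M[C]_(b, n)) : hf (0 : 'M[C]_(a, n)) Y = 0.
Proof. by rewrite /hf !mul0mx. Qed.
Lemma hf0r a b (X : 'M[C]_(a, n)) : hf X (0 : 'M[C]_(b, n)) = 0.
Proof. by rewrite /hf ct0 mulmx0. Qed.
Lemma hfE a b (X : 'M[C]_(a, n)) (Y : 'M[C]_(b, n)) i j :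
  hf X Y i j = hf (row i X) (row j Y) 0 0.
Proof.
rewrite !mxE; apply: eq_bigr => l _; rewrite !mxE; congr (_ * _).
by apply: eq_bigr => q _; rewrite !mxE.
Qed.

Lemma unitJ : J \in unitmx.
Proof. by have [] := mulmx1_unit JJ. Qed.

(** A right inverse of [B *m J] gives a dual family; subtracting half its Gram matrix times [B]
    makes it null and, [B] being null, does not disturb the pairing. *)
Lemma dual_frame d (B : 'M[C]_(d, n)) : row_free B -> hf B B = 0 ->
  exists2 Q, hf B Q = 1%:M & hf Q Q = 0.
Proof.
move=> Bf BB; have : row_free (B *m J) by rewrite /row_free mxrankMfree ?row_free_unit ?unitJ.
move=> /row_freeP[P BP]; pose Q0 := ct P.
have BQ : hf B Q0 = 1%:M by rewrite /hf /Q0 ctK.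
have QB : hf Q0 B = 1%:M by rewrite -ct_hf BQ ct1.
pose S := hf Q0 Q0; have cS : ct S = S by rewrite ct_hf.
exists (Q0 - 2^-1 *: (S *m B)).
  by rewrite hfBr hfZr hfMr BB mul0mx scaler0 subr0.
rewrite hfBl !hfBr !hfZl !hfZr !hfMl !hfMr BB BQ QB mul0mx mulmx0 !scaler0 subr0.
rewrite mulmx1 mul1mx cS conj_half -/S -addrA -opprD -scalerDl.
have -> : 2^-1 + 2^-1 = 1 :> C by field.
by rewrite scale1r subrr.
Qed.

End Form.
End Hermitian.

(** * Moving independent images onto a null space *)

Section NullPoints.
Variable R : realType.
Local Notation C := R[i].
Local Notation nm := (@ComplexField.Normc.normc R).
Local Notation rC := (@real_complex_def R (Phant R)).
Variables (n m : nat) (J : 'M[C]_n).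
Hypothesis ctJ : ct J = J.
Hypothesis JJ : J *m J = 1%:M.
Variables (p0 : 'rV[C]_n) (rho : R).
Hypothesis rho0 : 0 < rho.
Local Notation inO := (inbox p0 rho).
Variable g : 'rV[C]_n -> 'rV[C]_m.
Hypothesis gd : forall x, inO x -> hdiff g x.
Hypothesis O0 : ~ inO (0 : 'rV[C]_n).
Variable k : nat.
Hypothesis frames : forall d, (0 < d <= k)%N ->
  exists B : 'M[C]_(d, n), [/\ row_free B, hf J B B = 0 & (p0 <= B)%MS].

Lemma half_shift a b (W T : 'M[C]_(a, b)) (s : C) :
  W - 2^-1 *: T + s *: (2^-1 *: T) = W + ((s - 1) / 2) *: T.
Proof. by apply/matrixP => i j; rewrite !mxE; field. Qed.

Lemma small_real (P : C -> Prop) : (exists2 e, 0 < e & forall w, nm w < e -> P w) ->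
  exists2 e, 0 < e & forall t : R, 0 < t < e -> P (rC t).
Proof.
move=> [e e0 He]; exists e => // t /andP[t0 te]; apply: He.
by rewrite nm_real gtr0_norm.
Qed.

(** The shift multiplies the Gram matrix of [X] by [1 + c + conjc c]; the condition says that [c]
    has real part [-1/2]. *)
Lemma null_shift d (X Q : 'M[C]_(d, n)) tau (c : C) : hf J Q Q = 0 ->
  tau *m hf J Q X = hf J X X -> 1 + (c + conjc c) = 0 ->
  hf J (X + c *: (tau *m Q)) (X + c *: (tau *m Q)) = 0.
Proof.
move=> QQ tX cc.
have Xt : hf J X Q *m ct tau = hf J X X.
  by rewrite -(ct_hf ctJ Q X) -ctM tX ct_hf.
rewrite hfDl !hfDr !hfZl !hfZr !hfMl !hfMr QQ mul0mx mulmx0 !scaler0 addr0 tX Xt.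
by rewrite -{1}[hf J X X]scale1r -!scalerDl -addrA [conjc c + c]addrC cc scale0r.
Qed.

(* For [s] in [iR] the matrix [X + ((s - 1) / 2) tau Q] spans a null space, and [s = 1] gives [X]. *)
Lemma null_slice a d (X Q : 'M[C]_(d, n)) tau (A : 'M[C]_(a, d)) (P : 'M[C]_(m, a)) :
  hf J Q Q = 0 -> tau *m hf J Q X = hf J X X ->
  inO (A *m X) -> inO (A *m X - A *m (2^-1 *: (tau *m Q))) ->
  (forall Y : 'M[C]_(a, n), (\rank Y <= d)%N -> inO Y -> hf J Y Y = 0 ->
     \det (gm g Y *m P) = 0) ->
  \det (gm g (A *m X) *m P) = 0.
Proof.
move=> QQ tX AX; set K := A *m (2^-1 *: _) => G1 nullz.
set G := A *m X - K in G1.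
have hG : inO (G + K) by rewrite subrK.
have [e4 e40 He4] := inO_line G1 hG.
pose f s := \det (gm g (G + s *: K) *m P).
have fd s : inO (G + s *: K) -> cdiff f s.
  by move=> Hs; exact: (cdiff_gm_det gd P Hs).
have ie0 : nm (Complex 0 e4) = e4.
  by rewrite /= expr0n /= add0r sqrtr_sqr gtr0_norm.
have fz (x : R) : `|x| < 1 -> f (0 + rC x * Complex 0 e4) = 0.
  move=> x1; set s := _ + _.
  have sE : s = Complex 0 (x * e4).
    by rewrite /s add0r /real_complex_def; congr Complex; rewrite ?mul0r ?mulr0 ?subr0 ?addr0.
  have sn : nm s < e4.
    by rewrite /s add0r nmM nm_real ie0 -[X in _ < X]mul1r ltr_pM2r.
  (* For imaginary [s] the real part of [(s - 1) / 2] is [-1/2], as [null_shift] requires. *)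
  pose c := (s - 1) / 2.
  have cE : 1 + (c + conjc c) = 0.
    have -> : conjc c = (conjc s - 1) / 2.
      by rewrite /c conjM conjB conjc1 conj_half.
    have -> : conjc s = - s by rewrite sE; apply/eqP; rewrite eq_complex /= oppr0 !eqxx.
    by rewrite /c; field.
  have ZE : G + s *: K = A *m (X + c *: (tau *m Q)).
    by rewrite /G /K mulmxDr -!scalemxAr half_shift.
  apply: nullz.
  - by rewrite ZE; apply: leq_trans (mxrankM_maxl _ _) _; exact: rank_leq_col.
  - by have := He4 0 s; rewrite rmorph0 add0r; apply; rewrite ?lexx ?ler01.
  - by rewrite ZE hfMl hfMr null_shift // mul0mx mulmx0.
have f0 z : nm z < 1 / 8 -> f (0 + z * Complex 0 e4) = 0.
  move: z; apply: (@zero_near_real R (fun z => f (0 + z * Complex 0 e4))) => // z z1.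
  apply: cdiff_affine; apply: fd; have := He4 0 (z * Complex 0 e4).
  rewrite rmorph0; apply; rewrite ?lexx ?ler01 // nmM ie0.
  by rewrite -[X in _ < X]mul1r ltr_pM2r.
have ie : Complex 0 e4 != 0 :> C by rewrite -nm_gt0 ie0.
have -> : A *m X = G + 1 *: K by rewrite scale1r subrK.
apply: (@zero_walk R f e4 0 (e4 / 8)) => //.
- by rewrite divr_gt0.
- by rewrite lexx ler01.
- by move=> t1 w t01 we; apply: fd; exact: He4.
- move=> w we; have := f0 (w / Complex 0 e4); rewrite divfK // rmorph0; apply.
  by rewrite nmM nmV ie0 ltr_pdivrMr //; lra.
Qed.

(** Otherwise a determinant that is nonzero at [Y] vanishes on all null families of no larger rank,
    and the identity theorem carries this back to [Y]: from null families to spans close to a null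
    frame ([null_slice]), then along the segment from [B] to [X], then from the contracted family to
    the full one. *)
Lemma null_rows a (Y : 'M[C]_(a.+1, n)) : (\rank Y <= k)%N -> inO Y -> row_free (gm g Y) ->
  exists Y' : 'M[C]_(a.+1, n),
    [/\ (\rank Y' <= \rank Y)%N, inO Y', hf J Y' Y' = 0 & row_free (gm g Y')].
Proof.
move=> rk HY Yf; apply: contrapT => nY.
have nullz (Y' : 'M[C]_(a.+1, n)) P : (\rank Y' <= \rank Y)%N -> inO Y' -> hf J Y' Y' = 0 ->
    \det (gm g Y' *m P) = 0.
  move=> h1 h2 h3; apply/eqP; apply: contra_notT nY => h4; exists Y'; split => //.
  by apply/row_free_det; exists P.
have [P HP] := proj1 (row_free_det _) Yf.
have dd (F : C -> 'M[C]_(a.+1, m)) t : mcdiff F t -> cdiff (fun s => \det (F s *m P)) t.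
  by move=> HF; apply: cdiff_det; apply: mcdiff_mul => //; exact: mcdiff_const.
set d := \rank Y in rk nullz.
pose X : 'M[C]_(d, n) := row_base Y; pose A0 : 'M[C]_(a.+1, d) := Y *m pinvmx X.
have YE : Y = A0 *m X by rewrite mulmxKpV // eq_row_base.
pose c : 'rV[C]_d := row 0 A0.
have y1E : row 0 Y = c *m X by rewrite {1}YE row_mul.
have c0 : c != 0.
  apply/eqP => E; apply: O0; have := inO_row 0 HY.
  by rewrite y1E E mul0mx.
have d0 : (0 < d)%N.
  rewrite lt0n; apply/eqP => E; move: c0; apply/negP; rewrite negbK; apply/eqP/rowP => j.
  by exfalso; case: j => j jd; rewrite E in jd.
have [B0 [B0f B00 pB]] := frames (introT andP (conj d0 rk)).
have p00 : p0 != 0.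
  by apply/eqP => E; apply: O0 => i j; rewrite E !mxE subrr nm0.
have c'0 : p0 *m pinvmx B0 != 0.
  by apply: contra_neq p00 => E; rewrite -(mulmxKpV pB) E mul0mx.
have [h hu ch] := row_transport c0 c'0.
pose B := h *m B0.
have cB : c *m B = p0 by rewrite /B mulmxA ch mulmxKpV.
have BB : hf J B B = 0 by rewrite /B hfMl hfMr B00 mul0mx mulmx0.
have Bf : row_free B by rewrite /row_free /B mxrankMfree // mxrank_unit.
have [Q BQ QQ] := dual_frame ctJ JJ Bf BB.
(* With all rows equal to [c], [A1 *m X] repeats the first point and [A1 *m B] repeats [p0], so
   coefficients near [A1] keep both families in the box. *)
pose A1 : 'M[C]_(a.+1, d) := \matrix_(i, j) c 0 j.
have A1M b (Z : 'M[C]_(d, b)) i : row i (A1 *m Z) = c *m Z.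
  by rewrite row_mul; congr (_ *m _); apply/rowP => j; rewrite !mxE.
pose A t := A1 + t *: (A0 - A1).
have A1X : inO (A1 *m X) by apply: inO_rows => i; rewrite A1M -y1E; exact: inO_row.
have A1B : inO (A1 *m B).
  by apply: inO_rows => i; rewrite A1M cB => j l; rewrite ord1 subrr nm0.
have AE t Z : A t *m Z = A1 *m Z + t *: ((A0 - A1) *m Z).
  by rewrite /A mulmxDl -scalemxAl.
(* contract the points towards the first one *)
have [t [AtX AtB dt]] : exists t, [/\ inO (A t *m X), inO (A t *m B) &
    \det (gm g (A t *m X) *m P) != 0].
  have hX : inO (A1 *m X + (A0 - A1) *m X) by rewrite -mulmxDl [A1 + _]addrC subrK -YE.
  have h1 : exists2 e, 0 < e & forall t : R, 0 < t < e -> inO (A (rC t) *m B).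
    apply: (@small_real (fun t => inO (A t *m B))); have A1B' : inO (A1 *m B + 0 *: ((A0 - A1) *m B)) by rewrite scale0r addr0.
    have [e e0 He] := inO_cont (mcdiff_affine (A1 *m B) ((A0 - A1) *m B) 0) A1B'.
    exists e; first by [].
    by move=> w we; rewrite AE; have := He w we; rewrite add0r.
  have [e e0 He] := h1.
  apply: contrapT => nt; move/eqP: HP; apply.
  have := @gm_identity _ _ _ _ _ _ gd _ _ _ (fun M => \det (M *m P)) (Num.min e 1) dd A1X hX.
  rewrite -mulmxDl [A1 + _]addrC subrK -YE; apply; first by rewrite lt_min e0 ltr01.
  move=> t; rewrite lt_min => /and3P[t0 te t1]; apply/eqP; apply: contra_notT nt => dn0.
  have [e' e'0 He'] := inO_line A1X hX.
  exists (rC t); rewrite AE; split => //; last by apply: He; rewrite t0.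
  by have := He' t 0; rewrite addr0; apply; rewrite ?nm0 // ltW //= ltW.
set At := A t in AtX AtB dt.
(* deform the span to a null space *)
pose X_ u := B + u *: (X - B).
have AX_ u : At *m X_ u = At *m B + u *: (At *m X - At *m B).
  by rewrite /X_ mulmxDr -scalemxAr mulmxBr.
have hX : inO (At *m B + (At *m X - At *m B)) by rewrite [_ + (_ - _)]addrC subrK.
have [e1 e10 He1] := inO_line AtB hX.
move/eqP: dt; apply.
pose D := X - B.
(* [N] and [M] are polynomials in [u] that agree, for real [u], with the form of [Q] against [X_ u]
   and of [X_ u] against itself. [T u] is then the [tau] of [null_slice]; inverting [N u] by
   Cramer's rule makes it differentiable at [0]. *)
pose N u : 'M[C]_d := 1%:M + u *: ct (hf J D Q).
pose M u : 'M[C]_d := u *: (hf J D B + hf J B D) + (u * u) *: hf J D D.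
pose T u := M u *m ((\det (N u))^-1 *: \adj (N u)).
have ME (u : R) : M (rC u) = hf J (X_ (rC u)) (X_ (rC u)).
  rewrite /X_ -/D hfDl !hfDr BB !hfZl !hfZr conjc_real add0r /M scalerDr scalerA.
  by rewrite [RHS]addrA [_ *: hf J B D + _]addrC.
have NE (u : R) : N (rC u) = ct (hf J (X_ (rC u)) Q).
  by rewrite /X_ -/D hfDl hfZl BQ ctD ctZ ct1 conjc_real.
have N0 : N 0 = 1%:M by rewrite /N scale0r addr0.
have Nc : mcdiff N 0 by exact: mcdiff_affine.
have dN0 : \det (N 0) != 0 by rewrite N0 det1 oner_eq0.
have Tc : mcdiff T 0.
  apply: mcdiff_mul.
    apply: mcdiff_add; apply: mcdiff_scale; try exact: mcdiff_const; try exact: cdiff_id.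
    by apply: cdiff_mul; exact: cdiff_id.
  apply: mcdiff_scale; last exact: mcdiff_adj.
  by apply: cdiff_inv => //; exact: cdiff_det.
(* The family that [null_slice] needs in the box; at [u = 0] it is [At *m B], hence it stays there
   for small [u]. *)
pose G u := At *m X_ u - At *m (2^-1 *: (T u *m Q)).
have Gc : mcdiff G 0.
  have h1 := mcdiff_mul (mcdiff_const At 0) (mcdiff_affine B (X - B) 0).
  have h2 := mcdiff_scale (cdiff_const 2^-1 0) (mcdiff_mul Tc (mcdiff_const Q 0)).
  exact: (mcdiff_sub h1 (mcdiff_mul (mcdiff_const At 0) h2)).
have G0 : inO (G 0).
  rewrite /G /X_ /T /M scale0r addr0 mulr0 !scale0r addr0 !mul0mx scaler0 mulmx0 subr0.
  exact: AtB.
have [e2 e20 He2] := small_real (inO_cont Gc G0).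
have [e3 e30 He3] : exists2 e, 0 < e & forall u : R, 0 < u < e -> \det (N (rC u)) != 0.
  apply: (@small_real (fun u => \det (N u) != 0)); have [dd3 d30 Hd3] := cdiff_cont (cdiff_det Nc) (divr_gt0 ltr01 (ltr0Sn R 1)).
  exists dd3 => // w wd; have := Hd3 w wd; rewrite add0r N0 det1 -nm_gt0.
  move=> H; rewrite lt_def nm_ge0 andbT; apply/eqP => /eqP; rewrite nm_eq0 => /eqP E.
  by move: H; rewrite E sub0r nmN nm1; lra.
have := @gm_identity _ _ _ _ _ _ gd _ _ _ (fun M => \det (M *m P)) (Num.min 1 (Num.min e2 e3)) dd AtB hX.
rewrite [At *m B + (_ - _)]addrC subrK; apply; first by rewrite !lt_min ltr01 e20.
move=> u; rewrite !lt_min => /and4P[u0 u1 ue2 ue3].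
rewrite -AX_; set Xu := X_ (rC u).
have {}He2 := He2 u (introT andP (conj u0 ue2)); rewrite add0r in He2.
have {}He3 := He3 u (introT andP (conj u0 ue3)).
pose tau := T (rC u).
have tauE : tau *m N (rC u) = M (rC u).
  by rewrite /tau /T -mulmxA -scalemxAl mul_adj_mx scale_scalar_mx mulVf // mulmx1.
have AXu : inO (At *m Xu).
  rewrite AX_; have := He1 u 0; rewrite addr0; apply; rewrite ?nm0 //.
  by rewrite ltW //= ltW.
apply: (null_slice (Q := Q) (tau := tau)) => //.
have -> : hf J Q Xu = N (rC u) by rewrite NE ct_hf.
by rewrite tauE ME.
by move=> Y0; exact: nullz.
Qed.

End NullPoints.

(** * Derivatives along segments *)

Section Derivatives.
Variable R : realType.
Local Notation C := R[i].
Local Notation nm := (@ComplexField.Normc.normc R).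
Local Notation rC := (@real_complex_def R (Phant R)).

Lemma cder_zero_real (f : C -> C) z l t1 : cder f z l -> 0 < t1 ->
  (forall t : R, 0 < t < t1 -> f (z + rC t) = f z) -> l = 0.
Proof.
move=> fl t10 Hz; apply: nm_small_eq0 => e e0; have [d d0 Hd] := fl e e0.
pose t := Num.min t1 d / 2.
have m0 : 0 < Num.min t1 d by rewrite lt_min t10.
have t0 : 0 < t by rewrite divr_gt0.
have tm : t < Num.min t1 d by rewrite /t ltr_pdivrMr // ltr_pMr // ltr1n.
move: (tm); rewrite lt_min => /andP[tt td].
have nt : nm (rC t) = t by rewrite nm_real gtr0_norm.
have := Hd (rC t); rewrite nt Hz ?t0 // subrr sub0r nmN nmM nt => /(_ td).
by rewrite ler_pM2r.
Qed.

Lemma cder_unique (f : C -> C) z l l' : cder f z l -> cder f z l' -> l = l'.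
Proof.
move=> fl fl'; apply/eqP; rewrite -subr_eq0; apply/eqP.
have nl := cder_mul (cder_const (-1) z) fl'.
apply: (@cder_zero_real (fun t => f t + (-1) * f t) z _ 1) => //.
  by have := cder_add fl nl; rewrite mul0r add0r mulN1r.
by move=> t _; rewrite !mulN1r !subrr.
Qed.

Lemma cder_eq_real (f f' : C -> C) l l' t1 : cder f 0 l -> cder f' 0 l' -> 0 < t1 ->
  f 0 = f' 0 -> (forall t : R, 0 < t < t1 -> f (rC t) = f' (rC t)) -> l = l'.
Proof.
move=> fl fl' t10 E0 E; apply/eqP; rewrite -subr_eq0; apply/eqP.
have nl := cder_mul (cder_const (-1) 0) fl'.
apply: (@cder_zero_real (fun t => f t + (-1) * f' t) 0 _ t1) => //.
  by have := cder_add fl nl; rewrite mul0r add0r mulN1r.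
by move=> t t01; rewrite add0r !mulN1r E // E0 !subrr.
Qed.

Lemma cder_scale (f : C -> C) z l k : cder f z l -> cder (fun t => k * f t) z (k * l).
Proof. by move=> fl; have := cder_mul (cder_const k z) fl; rewrite mul0r add0r. Qed.

Lemma cder_cont0 (f : C -> C) l e : cder f 0 l -> 0 < e ->
  exists2 d, 0 < d & forall t : R, 0 < t < d -> nm (f (rC t) - f 0) <= e.
Proof.
move=> fl e0; have [d d0 Hd] := cder_cont fl e0; exists d => // t /andP[t0 td].
by have := Hd (rC t); rewrite add0r nm_real gtr0_norm //; exact.
Qed.

Lemma mcdiff_cont_real a b (F : C -> 'M[C]_(a, b)) e : mcdiff F 0 -> 0 < e ->
  exists2 d, 0 < d & forall t : R, 0 < t < d -> forall i j, nm ((F (rC t) - F 0) i j) < e.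
Proof.
move=> hF e0; have [d d0 Hd] := mcdiff_cont hF e0; exists d => // t /andP[t0 td] i j.
by have := Hd (rC t); rewrite nm_real gtr0_norm // add0r !mxE => /(_ td i j).
Qed.

Lemma cder_sum (I : Type) (r : seq I) (F : I -> C -> C) (l : I -> C) z :
  (forall i, cder (F i) z (l i)) -> cder (fun t => \sum_(i <- r) F i t) z (\sum_(i <- r) l i).
Proof.
move=> H; elim: r => [|i r IH].
  by rewrite big_nil; apply: cder_ext (cder_const 0 z) => t; rewrite big_nil.
by rewrite big_cons; apply: cder_ext (cder_add (H i) IH) => t; rewrite big_cons.
Qed.

(** A mean value inequality by bisection: increments bounded by [e] times the length add up over the
    two halves. [P m u v] speaks of the interval from [u] to [u + 2^-m]. *)
Lemma cder0_const (f : C -> C) : (forall t : R, 0 <= t <= 1 -> cder f (rC t) 0) -> f 1 = f 0.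
Proof.
move=> H; apply/eqP; rewrite -subr_eq0; apply/eqP; apply: nm_small_eq0 => e e0.
pose P m (u v : R) := nm (f (rC (u + 2^-1 ^+ m)) - f (rC u)) <= e * 2^-1 ^+ m.
suff : P 0%N 0 0 by rewrite /P expr0 add0r mulr1 rmorph0 rmorph1.
apply: (@dyadic_cousin R P) => [m u v h P1 P2 _ _|x y x01 _].
  move: P1 P2; rewrite /P -/h => P1 P2.
  have hh : 2^-1 ^+ m = h + h by rewrite /h half_exp; field.
  rewrite hh addrA.
  have := nmD (f (rC (u + h + h)) - f (rC (u + h))) (f (rC (u + h)) - f (rC u)).
  by rewrite addrA subrK; lra.
have [d d0 Hd] := H x x01 e e0; have [m0 Hm] := half_pow_small ler01 d0.
exists m0 => m u v m0m _ _ _ _ /andP[ux xu] _.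
have {}Hm := Hm m m0m; rewrite mul1r in Hm.
set h := 2^-1 ^+ m in xu Hm *.
have K t : `|t - x| < d -> nm (f (rC t) - f (rC x)) <= e * `|t - x|.
  move=> tx; have := Hd (rC (t - x)); rewrite nm_real => /(_ tx).
  by rewrite mul0r subr0 -rmorphD /= [x + _]addrC subrK.
have K1 := K (u + h); have K2 := K u.
rewrite ger0_norm in K1; last by lra.
rewrite ler0_norm in K2; last by lra.
have {}K1 := K1 ltac:(lra); have {}K2 := K2 ltac:(lra).
rewrite /P -/h.
have := nmB (f (rC (u + h)) - f (rC x)) (f (rC u) - f (rC x)).
by rewrite opprB addrA subrK; lra.
Qed.

Definition mder a b (F : C -> 'M[C]_(a, b)) t (D : 'M[C]_(a, b)) :=
  forall i j, cder (fun s => F s i j) t (D i j).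

Lemma mder_ex a b (F : C -> 'M[C]_(a, b)) t : mcdiff F t -> exists D, mder F t D.
Proof.
move=> H; have [D HD] := choice (fun ij : 'I_a * 'I_b => H ij.1 ij.2).
by exists (\matrix_(i, j) D (i, j)) => i j; rewrite mxE; exact: (HD (i, j)).
Qed.

Lemma mder_mul a b c (F : C -> 'M[C]_(a, b)) (G : C -> 'M[C]_(b, c)) t D E :
  mder F t D -> mder G t E -> mder (fun s => F s *m G s) t (D *m G t + F t *m E).
Proof.
move=> hF hG i j; rewrite !mxE -big_split.
apply: (@cder_ext _ (fun s => \sum_k F s i k * G s k j)).
  by move=> s; rewrite mxE.
by apply: cder_sum => k; exact: cder_mul.
Qed.

Lemma mder_const a b (A : 'M[C]_(a, b)) t : mder (fun=> A) t 0.
Proof. by move=> i j; rewrite mxE; exact: cder_const. Qed.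

Lemma mder_unique a b (F : C -> 'M[C]_(a, b)) t D E : mder F t D -> mder F t E -> D = E.
Proof. by move=> hD hE; apply/matrixP => i j; exact: cder_unique (hD i j) (hE i j). Qed.

(* [c] stays orthogonal to the row space of [F] because that space is stationary to first order. *)
Lemma stationary_rows a b (F : C -> 'M[C]_(a, b)) (P : 'M[C]_(b, a)) (c : 'cV[C]_b) :
  (forall t : R, 0 <= t <= 1 -> exists D, [/\ mder F (rC t) D, (D <= F (rC t))%MS &
     \det (F (rC t) *m P) != 0]) ->
  F 0 *m c = 0 -> F 1 *m c = 0.
Proof.
move=> H F0c.
(* By Cramer's rule [E t *m rho t = F t *m c]. When this is differentiated with [F' = K F], the
   terms containing [K] cancel and leave [E] times the derivative of [rho] equal to zero; so [rho]
   is constant. *)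
pose E t := F t *m P; pose rho t := ((\det (E t))^-1 *: \adj (E t)) *m (F t *m c).
have rhoE t : \det (E t) != 0 -> E t *m rho t = F t *m c.
  by move=> d0; rewrite /rho mulmxA -scalemxAr mul_mx_adj scale_scalar_mx mulVf // mul1mx.
have rho0 : rho 0 = 0 by rewrite /rho F0c mulmx0.
have d01 (t : R) : 0 <= t <= 1 -> mder rho (rC t) 0.
  move=> t01; have [F' [Fd /submxP[K KE] dE]] := H t t01.
  have Fm : mcdiff F (rC t) by move=> i j; exists (F' i j); exact: Fd.
  have Em : mcdiff E (rC t) by apply: mcdiff_mul => //; exact: mcdiff_const.
  have rm : mcdiff rho (rC t).
    apply: mcdiff_mul; last by apply: mcdiff_mul => //; exact: mcdiff_const.
    apply: mcdiff_scale; last exact: mcdiff_adj.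
    by apply: cdiff_inv => //; exact: cdiff_det.
  have [D HD] := mder_ex rm.
  have Ed := mder_mul Fd (mder_const P (rC t)); rewrite mulmx0 addr0 in Ed.
  have Fcd := mder_mul Fd (mder_const c (rC t)); rewrite mulmx0 addr0 in Fcd.
  have [r r0 Hr] : exists2 r, 0 < r & forall w, nm w < r -> \det (E (rC t + w)) != 0.
    have nd : 0 < nm (\det (E (rC t))) / 2 by rewrite divr_gt0 // nm_gt0.
    have [r r0 Hr] := cdiff_cont (cdiff_det Em) nd.
    exists r; first by [].
    move=> w wr; apply/eqP => Ew; have := Hr w wr; rewrite Ew sub0r nmN; lra.
  have Prd := mder_mul Ed HD.
  have Prd' : mder (fun s => F s *m c) (rC t) (F' *m P *m rho (rC t) + F (rC t) *m P *m D).
    move=> i j; apply: (@cder_near R (fun s => (F s *m P *m rho s) i j) _ _ _ r r0 _ (Prd i j)).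
    by move=> w wr; exact: (congr1 (fun M : 'M[C]_(a, 1) => M i j) (rhoE _ (Hr w wr))).
  have := mder_unique Prd' Fcd.
  rewrite KE -!mulmxA !(mulmxA (F (rC t))) -/(E (rC t)) rhoE // => /eqP.
  rewrite -[X in _ == X]addr0 (inj_eq (addrI _)) => /eqP ED.
  have D0 : D = 0.
    have := congr1 (fun M => \adj (E (rC t)) *m M) ED.
    rewrite /= mulmxA mul_adj_mx mulmx0 mul_scalar_mx => /eqP.
    by rewrite scaler_eq0 (negPf dE) => /eqP.
  by rewrite -D0.
have r1 : rho 1 = 0.
  apply/matrixP => i j; rewrite [RHS]mxE.
  have -> : (0 : C) = rho 0 i j by rewrite rho0 mxE.
  apply: (@cder0_const (fun s => rho s i j)) => t t01.
  by have := d01 t t01 i j; rewrite mxE.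
have h1 : 0 <= (1 : R) <= 1 by rewrite ler01 lexx.
have [_ [_ _]] := H 1 h1; rewrite rmorph1 => /rhoE <-.
by rewrite r1 mulmx0.
Qed.

Lemma hder_line_mul n m (g : 'rV[C]_n -> 'rV[C]_m) L (a b : 'rV[C]_n) t (c : 'cV[C]_m) :
  hder g (a + t *: b) L -> cder (fun s => (g (a + s *: b) *m c) 0 0) t ((b *m L *m c) 0 0).
Proof.
move=> gL; apply: (@cder_ext _ (fun s => \sum_k g (a + s *: b) 0 k * c k 0)).
  by move=> s; rewrite mxE.
rewrite mxE; apply: cder_sum => k.
have := cder_mul (hder_line k gL) (cder_const (c k 0) t).
by rewrite mulr0 addr0.
Qed.

End Derivatives.

Section LinearAlgebra.
Variable F : fieldType.

Lemma row_free_dcol a b m (A : 'M[F]_(a, m)) (B : 'M[F]_(b, m)) :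
  row_free (col_mx A B) -> row_free B.
Proof.
move=> AB; rewrite -kermx_eq0; apply/rowV0P => x /sub_kermxP xB.
have : row_mx 0 x *m col_mx A B = 0 *m col_mx A B by rewrite mul_row_col mul0mx xB addr0 mul0mx.
by move=> /(row_free_inj AB) /eqP; rewrite row_mx_eq0 => /andP[_ /eqP].
Qed.

(** Modulo the rows of [A] the two vectors are dependent, and [c1], [c2] are functionals on that
    quotient. *)
Lemma quotient_line a m (A : 'M[F]_(a, m)) (u v : 'rV[F]_m) (c1 c2 : 'cV[F]_m) :
  row_free A -> ~~ row_free (col_mx A (col_mx u v)) -> A *m c1 = 0 -> A *m c2 = 0 ->
  (u *m c1) 0 0 * (v *m c2) 0 0 = (u *m c2) 0 0 * (v *m c1) 0 0.
Proof.
move=> Af; rewrite -kermx_eq0 => /rowV0Pn[x /sub_kermxP].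
rewrite -[x]hsubmxK mul_row_col; set al := lsubmx x; set y := rsubmx x.
rewrite -[y]hsubmxK mul_row_col; set be := lsubmx y; set ga := rsubmx y.
rewrite [be]mx11_scalar [ga]mx11_scalar !mul_scalar_mx => E x0 h1 h2.
have k (c : 'cV[F]_m) : A *m c = 0 -> be 0 0 * (u *m c) 0 0 + ga 0 0 * (v *m c) 0 0 = 0.
  move=> Ac; have := congr1 (fun M => (M *m c) 0 0) E.
  by rewrite !mulmxDl -!scalemxAl -mulmxA Ac mulmx0 add0r mul0mx !mxE.
have K1 := k _ h1; have K2 := k _ h2.
case: (eqVneq (be 0 0) 0) => b0; last first.
  apply: (mulfI b0); have -> : be 0 0 * ((u *m c1) 0 0 * (v *m c2) 0 0) =
    (be 0 0 * (u *m c1) 0 0) * (v *m c2) 0 0 by ring.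
  have -> : be 0 0 * ((u *m c2) 0 0 * (v *m c1) 0 0) =
    (be 0 0 * (u *m c2) 0 0) * (v *m c1) 0 0 by ring.
  have -> : be 0 0 * (u *m c1) 0 0 = - (ga 0 0 * (v *m c1) 0 0) by apply/eqP; rewrite -addr_eq0 K1.
  have -> : be 0 0 * (u *m c2) 0 0 = - (ga 0 0 * (v *m c2) 0 0) by apply/eqP; rewrite -addr_eq0 K2.
  by ring.
case: (eqVneq (ga 0 0) 0) => g0; last first.
  move: K1 K2; rewrite b0 !mul0r !add0r => /eqP; rewrite mulf_eq0 (negPf g0) => /eqP ->.
  by move=> /eqP; rewrite mulf_eq0 (negPf g0) => /eqP ->; rewrite !mulr0.
exfalso; move/eqP: x0; apply.
move: E; rewrite b0 g0 !scale0r !addr0 => alA.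
have al0 : al = 0 by apply: (row_free_inj Af); rewrite alA mul0mx.
by rewrite al0 !raddf0 !row_mx0.
Qed.

Lemma functional_multiple n (u w : 'cV[F]_n) :
  (forall x : 'rV[F]_n, x *m u = 0 -> x *m w = 0) -> exists c, w = c *: u.
Proof.
move=> H; case: (eqVneq u 0) => [u0|/matrix0Pn[i [j ui]]].
  exists 0; rewrite scale0r; apply/row_matrixP => i; rewrite row0 rowE.
  by apply: H; rewrite u0 mulmx0.
rewrite ord1 in ui; exists (w i 0 / u i 0); apply/matrixP => l q; rewrite ord1 !mxE.
have := H (delta_mx 0 l - (u l 0 / u i 0) *: delta_mx 0 i).
rewrite !mulmxBl -!scalemxAl -!rowE => K.
have /K/matrixP/(_ 0 0) : row l u - (u l 0 / u i 0) *: row i u = 0.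
  by apply/matrixP => p p'; rewrite !ord1 !mxE divfK // subrr.
rewrite !mxE => /eqP; rewrite subr_eq0 => /eqP ->.
by rewrite mulrAC [RHS]mulrAC [w i 0 * _]mulrC.
Qed.

End LinearAlgebra.

(** * The cross-ratio identity *)

Section Balance.
Variables (F : fieldType) (a1 a2 a3 a4 b1 b2 b3 b4 : F).

Lemma balance_neq0 k k' : k != 0 -> a2 * (k * b1) = a1 * (k' * b2) ->
  a4 * (k * b3) = a3 * (k' * b4) -> a1 * a4 * (b2 * b3) = a2 * a3 * (b1 * b4).
Proof.
move=> k0 E1 E2; apply: (mulfI k0).
transitivity (a1 * b2 * (a4 * (k * b3))); first by ring.
transitivity (a2 * (k * b1) * (a3 * b4)); last by ring.
by rewrite E1 E2; ring.
Qed.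

Lemma balance_eq0 : a1 = 0 -> a3 = 0 -> a1 * a4 * (b2 * b3) = a2 * a3 * (b1 * b4).
Proof. by move=> -> ->; rewrite mulr0 !mul0r. Qed.

Lemma balance_zero : a1 = 0 -> a2 = 0 -> a1 * a4 * (b2 * b3) = a2 * a3 * (b1 * b4).
Proof. by move=> -> ->; rewrite !mul0r. Qed.

End Balance.

(** * Linearity modulo the images of a maximal family *)

Section OrthogonalMaps.
Variable R : realType.
Local Notation C := R[i].
Local Notation nm := (@ComplexField.Normc.normc R).
Local Notation rC := (@real_complex_def R (Phant R)).
Variables (n m : nat) (J : 'M[C]_n) (J' : 'M[C]_m).
Hypothesis ctJ : ct J = J.
Hypothesis JJ : J *m J = 1%:M.
Hypothesis ctJ' : ct J' = J'.
Variables (p0 : 'rV[C]_n) (rho : R).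
Local Notation inO := (inbox p0 rho).
Variable g : 'rV[C]_n -> 'rV[C]_m.
Hypothesis gd : forall x, inO x -> hdiff g x.
Hypothesis O0 : ~ inO (0 : 'rV[C]_n).
Hypothesis orth : forall x y, inO x -> inO y -> hf J x y = 0 -> hf J' (g x) (g y) = 0.

Local Notation H x y := (hf J' (g x) (g y) 0 0).
Local Notation q x y := (hf J x y 0 0).
Local Notation gm := (gm g).

(** Equality of the cross ratios of [H] and of the source form at four points, cleared of
    denominators so that it makes sense where values vanish. *)
Definition star_eq z1 z2 y1 y2 :=
  H z1 y1 * H z2 y2 * (q z1 y2 * q z2 y1) = H z1 y2 * H z2 y1 * (q z1 y1 * q z2 y2).

Lemma orth_rows a (X : 'M[C]_(a, n)) y : inO X -> inO y -> hf J X y = 0 ->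
  gm X *m (J' *m ct (g y)) = 0.
Proof.
move=> HX Hy Xy; apply/row_matrixP => i; rewrite row_mul row_gm row0 mulmxA.
apply: orth => //; first exact: inO_row.
by rewrite /hf -!row_mul -[X *m J *m _]/(hf J X y) Xy row0.
Qed.

Lemma small_curve a (F : C -> 'M[C]_(a, n)) : mcdiff F 0 -> inO (F 0) ->
  exists2 t1 : R, 0 < t1 & forall t, 0 < t < t1 -> inO (F (rC t)).
Proof.
move=> hF /inO_near[e e0 He]; have [d d0 Hd] := mcdiff_cont_real hF e0.
exists d; first by [].
move=> t t01; have -> : F (rC t) = F 0 + (F (rC t) - F 0) by rewrite [RHS]addrC subrK.
exact: He (Hd t t01).
Qed.

Lemma small_line a (A B : 'M[C]_(a, n)) : inO A ->
  exists2 t1 : R, 0 < t1 & forall t, 0 < t < t1 -> inO (A + rC t *: B).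
Proof.
move=> HA; have HA0 : inO (A + 0 *: B) by rewrite scale0r addr0.
exact: (small_curve (mcdiff_affine A B 0) HA0).
Qed.

Lemma line_functional (w0 v : 'rV[C]_n) L (c : 'cV[C]_m) : inO w0 -> hder g w0 L ->
  cder (fun s => (g (w0 + s *: v) *m c) 0 0) 0 ((v *m L *m c) 0 0).
Proof. by move=> Hw HL; apply: hder_line_mul; rewrite scale0r addr0. Qed.

Section Good.
Variables (a : nat) (X : 'M[C]_(a, n)).
Hypothesis HX : inO X.
Hypothesis Xf : row_free (gm X).
Hypothesis gap : forall z y : 'rV[C]_n, inO z -> inO y ->
  (\rank (col_mx X (col_mx z y)) <= (\rank X).+1)%N -> ~~ row_free (gm (col_mx X (col_mx z y))).

Variables (i : 'I_a) (L : 'M[C]_(n, m)).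
Local Notation w0 := (row i X).
Hypothesis HL : hder g w0 L.

(* Modulo the span of [g] on [X], the map is a multiple of the linear map [L]. *)
Lemma linear_mod_span z (c1 c2 : 'cV[C]_m) : inO z -> gm X *m c1 = 0 -> gm X *m c2 = 0 ->
  (g z *m c2) 0 0 * ((z - w0) *m L *m c1) 0 0 = (g z *m c1) 0 0 * ((z - w0) *m L *m c2) 0 0.
Proof.
move=> Hz h1 h2; have Hw := inO_row i HX; pose v := z - w0.
have g0 (c : 'cV[C]_m) : gm X *m c = 0 -> (g (w0 + 0 *: v) *m c) 0 0 = 0.
  by move=> h; rewrite scale0r addr0 -row_gm -row_mul h row0 mxE.
have [t1 t10 Ht1] := small_line v Hw.
have D1 := cder_scale ((g z *m c2) 0 0) (line_functional v c1 Hw HL).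
have D2 := cder_scale ((g z *m c1) 0 0) (line_functional v c2 Hw HL).
apply: (cder_eq_real D1 D2 t10); first by rewrite (g0 _ h1) (g0 _ h2) !mulr0.
move=> t t01; have Ht := Ht1 t t01.
set y := w0 + rC t *: v in Ht *.
(* [y] lies in the span of [X] and [z], so the images of [y] and [z] are dependent modulo those of
   [X]; differentiating at [t = 0] replaces the image of [y] by the derivative at [w0]. *)
have nf := gap Ht Hz.
rewrite mulrC [RHS]mulrC; apply: (@quotient_line _ _ _ (gm X) _ _ _ _ Xf) => //.
rewrite -(gm_row g z) -(gm_row g y) -!gm_col.
apply: nf; apply: (@leq_trans (\rank (col_mx X z))).
  apply: mxrankS; rewrite !col_mx_sub; apply/and3P; split.
  - by rewrite -addsmxE addsmxSl.
  - rewrite /y /v scalerBr addrCA -{1}[w0]scale1r -scalerBl addmx_sub //.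
      by rewrite scalemx_sub // -addsmxE addsmxSr.
    by rewrite scalemx_sub // (submx_trans (row_sub i X)) // -addsmxE addsmxSl.
  - by rewrite -addsmxE addsmxSr.
rewrite -addsmxE; apply: leq_trans (mxrank_adds_leqif _ _) _.
by rewrite -[(\rank X).+1]addn1 leq_add2l rank_leq_row.
Qed.

(** For [x] orthogonal to [y] the line [w0 + t x] stays orthogonal to [y], so its image stays in the
    kernel of the functional and so does the derivative. Composed with [L], the functional vanishes
    on the orthogonal of [y], hence is a multiple of the form against [y]. *)
Lemma functional_orth y : inO y -> hf J X y = 0 ->
  exists k : C, forall z, ((z - w0) *m L *m (J' *m ct (g y))) 0 0 = k * q z y.
Proof.
move=> Hy Xy; set c := J' *m ct (g y); have Hw := inO_row i HX.
have wy : w0 *m (J *m ct y) = 0.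
  by rewrite mulmxA /= -!row_mul -[X *m J *m _]/(hf J X y) Xy row0.
have [k Hk] : exists k, L *m c = k *: (J *m ct y).
  apply: functional_multiple => x xy; apply/matrixP => p r; rewrite !ord1 [RHS]mxE mulmxA.
  have [t1 t10 Ht1] := small_line x Hw.
  have gy z : inO z -> z *m (J *m ct y) = 0 -> (g z *m c) 0 0 = 0.
    by move=> Hz zy; have := orth Hz Hy; rewrite /hf /c !mulmxA -!(mulmxA z) zy => ->; rewrite ?mxE.
  have g0 : (g (w0 + 0 *: x) *m c) 0 0 = 0 by rewrite scale0r addr0; exact: gy.
  apply: (cder_eq_real (line_functional x c Hw HL) (cder_const 0 0) t10 g0).
  move=> t t01; apply: gy; first exact: Ht1.
  by rewrite mulmxDl wy -scalemxAl xy scaler0 addr0.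
exists k => z; rewrite -mulmxA Hk -scalemxAr mxE mulmxBl wy subr0.
by rewrite /hf mulmxA.
Qed.

Lemma good_star (v : 'rV[C]_n) (c0 : 'cV[C]_m) : gm X *m c0 = 0 -> (v *m L *m c0) 0 0 != 0 ->
  forall z1 z2 y1 y2, inO z1 -> inO z2 -> inO y1 -> inO y2 ->
    hf J X y1 = 0 -> hf J X y2 = 0 -> star_eq z1 z2 y1 y2.
Proof.
move=> Xc0 vc0 z1 z2 y1 y2 Hz1 Hz2 Hy1 Hy2 Xy1 Xy2.
have [k1 K1] := functional_orth Hy1 Xy1; have [k2 K2] := functional_orth Hy2 Xy2.
have o1 := orth_rows HX Hy1 Xy1; have o2 := orth_rows HX Hy2 Xy2.
have HE z y : (g z *m (J' *m ct (g y))) 0 0 = H z y by rewrite mulmxA.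
have E z : inO z -> H z y2 * (k1 * q z y1) = H z y1 * (k2 * q z y2).
  by move=> Hz; have := linear_mod_span Hz o1 o2; rewrite K1 K2 !HE.
(* If the factor is zero, [linear_mod_span] against [c0] makes [H z y] vanish wherever the affine
   function [(z - w0) *m L *m c0] does not; the direction [v] leads to such points arbitrarily close
   to any [z], and continuity finishes. *)
have zero y k : inO y -> gm X *m (J' *m ct (g y)) = 0 ->
    (forall z, ((z - w0) *m L *m (J' *m ct (g y))) 0 0 = k * q z y) -> k = 0 ->
    forall z, inO z -> H z y = 0.
  move=> Hy oy Ky k0 z Hz; rewrite -HE.
  pose c := J' *m ct (g y).
  have L0 z' : inO z' -> ((z' - w0) *m L *m c0) 0 0 != 0 -> (g z' *m c) 0 0 = 0.
    move=> Hz' n0; have := linear_mod_span Hz' Xc0 oy; rewrite Ky k0 mul0r mulr0 => /eqP.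
    by rewrite mulf_eq0 (negPf n0) orbF => /eqP.
  case: (eqVneq (((z - w0) *m L *m c0) 0 0) 0) => z0; last exact: L0.
  have [t1 t10 Ht1] := small_line v Hz.
  have [L' HL'] := gd Hz.
  have L1 t : 0 < t < t1 -> (g (z + rC t *: v) *m c) 0 0 = 0.
    move=> t01; apply: L0; first exact: Ht1.
    have -> : z + rC t *: v - w0 = (z - w0) + rC t *: v by rewrite addrAC.
    have rt : rC t != 0 by case/andP: t01 => t0 _; rewrite -nm_gt0 nm_real gtr0_norm.
    have -> : ((z - w0 + rC t *: v) *m L *m c0) 0 0 =
        ((z - w0) *m L *m c0) 0 0 + rC t * (v *m L *m c0) 0 0.
      by rewrite !mulmxDl -!scalemxAl !mxE.
    by rewrite z0 add0r mulf_neq0.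
  apply: nm_small_eq0 => e e0.
  have [d d0 Hd] := cder_cont0 (line_functional v c Hz HL') e0.
  pose t := Num.min t1 d / 2.
  have mm : 0 < Num.min t1 d by rewrite lt_min t10.
  have t0 : 0 < t by rewrite divr_gt0.
  have : t < Num.min t1 d by rewrite /t ltr_pdivrMr // ltr_pMr // ltr1n.
  rewrite lt_min => /andP[tt td].
  have := Hd t; rewrite t0 td => /(_ isT).
  have t01 : 0 < t < t1 by rewrite t0 tt.
  have vanish (x1 x2 x3 : C) : x1 = 0 -> x2 = x3 -> nm (x1 - x2) <= e -> nm x3 <= e.
    by move=> -> ->; rewrite sub0r nmN.
  by apply: vanish (L1 t t01) _; rewrite scale0r addr0.
case: (eqVneq k1 0) => k10; last exact: (balance_neq0 k10 (E _ Hz1) (E _ Hz2)).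
have Z := zero y1 k1 Hy1 o1 K1 k10.
exact: balance_eq0 (Z _ Hz1) (Z _ Hz2).
Qed.

End Good.

End OrthogonalMaps.

(** * Growth of the number of independent images *)

Section RankGap.
Variable R : realType.
Local Notation C := R[i].
Local Notation nm := (@ComplexField.Normc.normc R).
Local Notation rC := (@real_complex_def R (Phant R)).
Variables (n m : nat) (J : 'M[C]_n) (J' : 'M[C]_m).
Hypothesis ctJ : ct J = J.
Hypothesis JJ : J *m J = 1%:M.
Hypothesis ctJ' : ct J' = J'.
Variables (p0 : 'rV[C]_n) (rho : R).
Local Notation inO := (inbox p0 rho).
Variable g : 'rV[C]_n -> 'rV[C]_m.
Hypothesis gd : forall x, inO x -> hdiff g x.
Hypothesis O0 : ~ inO (0 : 'rV[C]_n).
Hypothesis orth : forall x y, inO x -> inO y -> hf J x y = 0 -> hf J' (g x) (g y) = 0.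

Local Notation H x y := (hf J' (g x) (g y) 0 0).
Local Notation q x y := (hf J x y 0 0).
Local Notation gm := (gm g).
Local Notation star := (star_eq J J' g).

Lemma scal00 (x : 'M[C]_(1, 1)) : x 0 0 = 0 -> x = 0.
Proof. by move=> x0; rewrite [x]mx11_scalar x0 raddf0. Qed.

Lemma mulmx_entry a b c (A : 'M[C]_(a, b)) (B : 'M[C]_(b, c)) i l :
  (A *m B) i l = (row i A *m col l B) 0 0.
Proof. by rewrite !mxE; apply: eq_bigr => p _; rewrite !mxE. Qed.

Lemma gm_cder a (A B : 'M[C]_(a, n)) t i p L : hder g (row i (A + t *: B)) L ->
  cder (fun s => gm (A + s *: B) i p) t ((row i B *m L) 0 p).
Proof.
have rE s : row i (A + s *: B) = row i A + s *: row i B by rewrite linearD linearZ.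
rewrite rE => HL; apply: cder_ext (hder_line p HL) => s.
by rewrite -rE mxE.
Qed.

Definition spans j a := exists X : 'M[C]_(a, n), [/\ (\rank X <= j)%N, inO X & row_free (gm X)].

Lemma spans_pred j a : spans j a.+1 -> spans j a.
Proof.
move=> [X [rX HX Xf]]; exists (dsubmx (X : 'M[C]_(1 + a, n))); split.
- apply: leq_trans rX; apply: mxrankS; apply/row_subP => i.
  by rewrite row_dsubmx; exact: row_sub.
- by move=> i l; rewrite mxE; exact: HX.
- apply: (row_free_dcol (A := gm (usubmx (X : 'M[C]_(1 + a, n))))).
  by rewrite -gm_col vsubmxK.
Qed.

Lemma spans_le j a b : (b <= a)%N -> spans j a -> spans j b.
Proof.
move=> /subnK <-; elim: (a - b)%N => // k IH; rewrite addSn => /spans_pred; exact: IH.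
Qed.

Lemma spans_leq_dim i j a : (i <= j)%N -> spans i a -> spans j a.
Proof. by move=> ij [X [rX HX Xf]]; exists X; split => //; exact: leq_trans rX ij. Qed.

(** If no such [j] existed, the count would rise by two at each rank, giving [2 j + 1] independent
    images at rank [j + 1] and [2 k - 1 > c] at rank [k]. In the conclusion [a.+1] is the largest
    count at rank [j]. *)
Lemma exists_gap k c : (forall a, spans k a -> (a <= c)%N) -> (c + 2 <= 2 * k)%N ->
  spans 1 1 -> exists j a, [/\ (0 < j < k)%N, spans j a.+1, ~ spans j a.+2 & ~ spans j.+1 a.+3].
Proof.
move=> bd ck s1; apply: contrapT => ng.
suff K j : (j < k)%N -> spans j.+1 (2 * j).+1.
  have k0 : (0 < k)%N by lia.
  have := K k.-1; rewrite prednK // => /(_ (leqnn _)) /bd; lia.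
elim: j => [//|j IH] jk; have sj := IH (ltnW jk).
have : exists a, [/\ ((2 * j) <= a)%N, spans j.+1 a.+1 & ~ spans j.+1 a.+2].
  apply: contrapT => na.
  have all b : spans j.+1 (2 * j + b).+1.
    elim: b => [|b Hb]; first by rewrite addn0.
    rewrite addnS; apply: contrapT => nb; apply: na; exists (2 * j + b)%N; split => //; lia.
  have := bd _ (spans_leq_dim (ltnW jk) (all c)); lia.
move=> [a [ja sa na]].
have : spans j.+2 a.+3.
  by apply: contrapT => nb; apply: ng; exists j.+1, a; split => //; lia.
by apply: spans_le; lia.
Qed.

Lemma H_conj x y : H x y = conjc (H y x).
Proof. by rewrite -(ct_hf ctJ') ctE. Qed.
Lemma q_conj (x y : 'rV[C]_n) : q x y = conjc (q y x).
Proof. by rewrite -(ct_hf ctJ) ctE. Qed.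

Lemma conj_balance (x1 x2 x3 x4 x5 x6 x7 x8 y1 y2 y3 y4 y5 y6 y7 y8 : C) :
  x1 = conjc y1 -> x2 = conjc y2 -> x3 = conjc y3 -> x4 = conjc y4 ->
  x5 = conjc y5 -> x6 = conjc y6 -> x7 = conjc y7 -> x8 = conjc y8 ->
  x1 * x2 * (x3 * x4) = x5 * x6 * (x7 * x8) <-> y1 * y2 * (y3 * y4) - y5 * y6 * (y7 * y8) = 0.
Proof.
do 8!move=> ->; rewrite -!conjM.
by split=> [/(can_inj (@conjcK R)) ->|/eqP]; [rewrite subrr|rewrite subr_eq0 => /eqP ->].
Qed.

(* [star_eq] is antiholomorphic in its last two arguments; its conjugate is holomorphic. *)
Definition cstar (y1 y2 z1 z2 : 'rV[C]_n) : C :=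
  H y1 z1 * H y2 z2 * (q y2 z1 * q y1 z2) - H y2 z1 * H y1 z2 * (q y1 z1 * q y2 z2).

Lemma star_cstar z1 z2 y1 y2 : star z1 z2 y1 y2 <-> cstar y1 y2 z1 z2 = 0.
Proof.
exact: conj_balance (H_conj z1 y1) (H_conj z2 y2) (q_conj z1 y2) (q_conj z2 y1)
  (H_conj z1 y2) (H_conj z2 y1) (q_conj z1 y1) (q_conj z2 y2).
Qed.

Lemma cdiff_cstar (a1 a2 b1 b2 z1 z2 : 'rV[C]_n) t : inO (a1 + t *: b1) -> inO (a2 + t *: b2) ->
  cdiff (fun s => cstar (a1 + s *: b1) (a2 + s *: b2) z1 z2) t.
Proof.
move=> h1 h2.
have Hd a b z : inO (a + t *: b) -> cdiff (fun s => H (a + s *: b) z) t.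
  move=> h; apply: (@cdiff_ext _ (fun s => (gm (a + s *: b) *m (J' *m ct (g z))) 0 0)).
    by move=> s; rewrite gm_row mulmxA.
  by apply: mcdiff_mul; [exact: (mcdiff_gm gd h)|exact: mcdiff_const].
have qd (a b z : 'rV[C]_n) : cdiff (fun s => q (a + s *: b) z) t.
  apply: (@cdiff_ext _ (fun s => ((a + s *: b) *m (J *m ct z)) 0 0)).
    by move=> s; rewrite mulmxA.
  by apply: mcdiff_mul; [exact: mcdiff_affine|exact: mcdiff_const].
by apply: cdiff_sub; (apply: cdiff_mul; [apply: cdiff_mul; exact: Hd|apply: cdiff_mul; exact: qd]).
Qed.

Section Maximal.
Variables (j a : nat).
Hypothesis max1 : ~ spans j a.+2.
Hypothesis max2 : ~ spans j.+1 a.+3.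

Lemma max_mem (X : 'M[C]_(a.+1, n)) z : (\rank X <= j)%N -> inO X -> row_free (gm X) ->
  inO z -> (z <= X)%MS -> (g z <= gm X)%MS.
Proof.
move=> rX HX Xf Hz zX; apply: contrapT => nz; apply: max1.
have zXX : (col_mx z X <= X)%MS by rewrite col_mx_sub zX submx_refl.
suff zf : row_free (gm (col_mx z X)).
  by exists (col_mx z X); split; [exact: leq_trans (mxrankS zXX) rX|exact: (inO_col Hz HX)|].
rewrite gm_col gm_row -kermx_eq0; apply/rowV0P => x /sub_kermxP.
rewrite -[x]hsubmxK mul_row_col; set be := lsubmx x; set al := rsubmx x.
rewrite [be]mx11_scalar mul_scalar_mx => E.
case: (eqVneq (be 0 0) 0) => b0.
  move: E; rewrite b0 scale0r add0r => E.
  have -> : al = 0 by apply: (row_free_inj Xf); rewrite E mul0mx.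
  by rewrite raddf0 row_mx0.
case: nz; have -> : g z = - (be 0 0)^-1 *: (al *m gm X).
  have -> : al *m gm X = - (be 0 0 *: g z) by apply/eqP; rewrite -addr_eq0 addrC E.
  by rewrite scaleNr scalerN opprK scalerA mulVf // scale1r.
by rewrite scalemx_sub // submxMl.
Qed.

Lemma max_gap (X : 'M[C]_(a.+1, n)) : (\rank X <= j)%N -> inO X -> forall z y : 'rV[C]_n,
  inO z -> inO y -> (\rank (col_mx X (col_mx z y)) <= (\rank X).+1)%N ->
  ~~ row_free (gm (col_mx X (col_mx z y))).
Proof.
move=> rX HX z y Hz Hy rk; apply/negP => f; apply: max2.
have e : (a.+1 + 2 = a.+3)%N by lia.
suff : spans j.+1 (a.+1 + (1 + 1)) by rewrite e.
exists (col_mx X (col_mx z y)); split => //; first by apply: leq_trans rk _.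
by apply: inO_col => //; exact: inO_col.
Qed.

(* Moving [X] along a nilpotent direction [N = c e] stays maximal; if none of the nearby
   [X (1 + t N)] were good, the span of [g] over them would not move at all. *)
Lemma star_max (X : 'M[C]_(a.+1, n)) : (\rank X <= j)%N -> inO X -> row_free (gm X) ->
  forall z1 z2 y1 y2, inO z1 -> inO z2 -> inO y1 -> inO y2 ->
    hf J X y1 = 0 -> hf J X y2 = 0 -> star z1 z2 y1 y2.
Proof.
move=> rX HX Xf z1 z2 y1 y2 Hz1 Hz2 Hy1 Hy2 Xy1 Xy2.
have o1 := orth_rows orth HX Hy1 Xy1; have o2 := orth_rows orth HX Hy2 Xy2.
(* If every image lies in the span of [gm X], both sides of the identity contain a vanishing
   factor. *)
case: (pselect (forall z c, inO z -> gm X *m c = 0 :> 'cV[C]_(a.+1) -> (g z *m c) 0 0 = 0)) => [A|nA].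
  have HE z y : (g z *m (J' *m ct (g y))) 0 0 = H z y by rewrite mulmxA.
  have h11 := A _ _ Hz1 o1; have h12 := A _ _ Hz1 o2.
  by rewrite HE in h11; rewrite HE in h12; exact: balance_zero h11 h12.
have [z [c0 [Hz Xc0 zc0]]] : exists z c0, [/\ inO z, gm X *m c0 = 0 :> 'cV[C]_(a.+1) & (g z *m c0) 0 0 != 0].
  apply: contrapT => nz; apply: nA => z c Hz Xc; apply/eqP; apply: contra_notT nz => nzc.
  by exists z, c.
pose x1 := row 0 X; pose e := z - x1.
have x10 : x1 != 0 by apply/eqP => E; apply: O0; rewrite -E; exact: inO_row.
have zX : ~ (z <= X)%MS.
  move=> /(max_mem rX HX Xf Hz) /submxP[K zK]; move: zc0.
  by rewrite zK -mulmxA Xc0 mulmx0 mxE eqxx.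
(* [e] and [x1] are independent, since otherwise [z] would lie in the span of [X]. So [c] can be
   chosen with [N = c e] of square zero and [x1 N = e], and the first row of [Y s] moves straight
   towards [z]. *)
have [c [ec x1c]] : exists c : 'cV[C]_n, e *m c = 0 /\ x1 *m c = 1%:M.
  have [u [eu xu]] : exists u : 'cV[C]_n, e *m u = 0 /\ x1 *m u <> 0.
    apply: contrapT => nu.
    have [k Hk] : exists k, x1^T = k *: e^T.
      apply: functional_multiple => x xe; apply: trmx_inj; rewrite trmx_mul trmxK trmx0.
      apply: contrapT => xx; apply: nu; exists x^T; split => //.
      by apply: trmx_inj; rewrite trmx_mul trmxK trmx0.
    have {}Hk : x1 = k *: e by apply: trmx_inj; rewrite Hk linearZ.
    have k0 : k != 0 by apply/eqP => k0; move/eqP: x10; apply; rewrite Hk k0 scale0r.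
    apply: zX; have -> : z = (1 + k^-1) *: x1.
      by rewrite scalerDl scale1r {2}Hk scalerA mulVf // scale1r /e addrC subrK.
    by rewrite scalemx_sub // row_sub.
  have d0 : (x1 *m u) 0 0 != 0 by apply/eqP => d0; apply: xu; exact: scal00.
  exists (((x1 *m u) 0 0)^-1 *: u); rewrite -!scalemxAr eu scaler0; split => //.
  by rewrite [x1 *m u]mx11_scalar scale_scalar_mx mxE eqxx mulr1n mulVf.
have [N [NE NN]] : exists N, N = c *m e /\ N *m N = 0.
  by exists (c *m e); split => //; rewrite -mulmxA (mulmxA e) ec mul0mx mulmx0.
pose Y s := X + s *: (X *m N).
(* The adjoint of [N]. Since [1 - t Na] inverts [1 + t Na], moving [y] by it preserves orthogonality
   to [Y t] for real [t]. *)
pose Na := J *m ct N *m J.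
pose w (y : 'rV[C]_n) s := y - s *: (y *m Na).
have Y0 : Y 0 = X by rewrite /Y scale0r addr0.
have adj x y : hf J (x *m N) y = hf J x (y *m Na).
  rewrite /hf /Na !ctM ctK ctJ -!mulmxA; congr (x *m _).
  by rewrite (mulmxA J J) JJ mul1mx.
have NaNa : Na *m Na = 0.
  rewrite /Na -!mulmxA (mulmxA J J) JJ mul1mx (mulmxA (ct N)) -ctM NN ct0 mul0mx.
  by rewrite mulmx0.
have perp (t : R) y : hf J X y = 0 -> hf J (Y (rC t)) (w y (rC t)) = 0.
  move=> Xy; rewrite /Y /w hfDl !hfBr !hfZl !hfZr !adj -mulmxA NaNa mulmx0 hf0r Xy.
  by rewrite conjc_real !scaler0 subr0 sub0r addNr.
apply: contrapT => nst.
have w0 y : w y 0 = y by rewrite /w scale0r subr0.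
have wE y s : w y s = y + s *: - (y *m Na) by rewrite /w scalerN.
have [P XP] := proj1 (row_free_det (gm X)) Xf.
have [d1 d10 Hd1] := @small_line _ _ _ _ _ X (X *m N) HX.
have [d2 d20 Hd2] := @small_line _ _ _ _ _ y1 (- (y1 *m Na)) Hy1.
have [d3 d30 Hd3] := @small_line _ _ _ _ _ y2 (- (y2 *m Na)) Hy2.
have cd4 : cdiff (fun s => \det (gm (X + s *: (X *m N)) *m P)) 0.
  by apply: (cdiff_gm_det gd); rewrite scale0r addr0.
have cd5 : cdiff (fun s => cstar (y1 + s *: - (y1 *m Na)) (y2 + s *: - (y2 *m Na)) z1 z2) 0.
  by apply: cdiff_cstar; rewrite scale0r addr0.
have nz (f : C -> C) : cdiff f 0 -> f 0 != 0 ->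
    exists2 d, 0 < d & forall t : R, 0 < t < d -> f (rC t) != 0.
  move=> [l fl] f0; have n0 : 0 < nm (f 0) / 2 by rewrite divr_gt0 // nm_gt0.
  have [d d0 Hd] := cder_cont0 fl n0; exists d; first by [].
  move=> t t01; apply/eqP => ft; have := Hd t t01; rewrite ft sub0r nmN.
  by have := n0; lra.
have h4 : \det (gm (X + 0 *: (X *m N)) *m P) != 0 by rewrite scale0r addr0.
have [d4 d40 Hd4] := nz _ cd4 h4.
have cs0 : cstar y1 y2 z1 z2 != 0 by apply/eqP => /star_cstar.
have h5 : cstar (y1 + 0 *: - (y1 *m Na)) (y2 + 0 *: - (y2 *m Na)) z1 z2 != 0.
  by rewrite !scale0r !addr0.
have [d5 d50 Hd5] := nz _ cd5 h5.
pose T := Num.min d1 (Num.min d2 (Num.min d3 (Num.min d4 d5))).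
have T0 : 0 < T by rewrite /T !lt_min d10 d20 d30 d40.
have Tall (t : R) : 0 <= t < T -> [/\ inO (Y (rC t)), inO (w y1 (rC t)), inO (w y2 (rC t)),
    \det (gm (Y (rC t)) *m P) != 0 & cstar (w y1 (rC t)) (w y2 (rC t)) z1 z2 != 0].
  move=> /andP[t0 tT]; case: (eqVneq t 0) => [->|tn0].
    by rewrite rmorph0 Y0 !w0.
  have tp : 0 < t by rewrite lt_def tn0.
  move: tT; rewrite /T !lt_min => /and5P[e1 e2 e3 e4 e5].
  split; rewrite ?wE; [apply: Hd1|apply: Hd2|apply: Hd3|apply: Hd4|apply: Hd5];
    by rewrite tp.
(* The identity fails at [y1], [y2], hence by continuity at their translates for [t] below [T]; by
   [good_star] no derivative at a row of [Y t] can then leave the span of [gm (Y t)]. *)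
have bad (t : R) i L (v : 'rV[C]_n) c' : 0 <= t < T -> hder g (row i (Y (rC t))) L ->
    gm (Y (rC t)) *m c' = 0 :> 'cV[C]_(a.+1) -> (v *m L *m c') 0 0 = 0.
  move=> t0 HL Yc; have [HY Hw1 Hw2 dY cs] := Tall t t0.
  have rY : (\rank (Y (rC t)) <= j)%N.
    have -> : Y (rC t) = X *m (1%:M + rC t *: N) by rewrite mulmxDr mulmx1 -scalemxAr.
    exact: leq_trans (mxrankM_maxl _ _) rX.
  have Yf : row_free (gm (Y (rC t))) by apply/row_free_det; exists P.
  apply/eqP; apply: contraNT cs => vc; apply/eqP/star_cstar.
  have G := @good_star _ _ _ _ _ _ _ g gd orth _ _ HY Yf (max_gap rY HY) i L HL v c' Yc vc.
  exact: (G z1 z2 (w y1 (rC t)) (w y2 (rC t)) Hz1 Hz2 Hw1 Hw2 (perp t y1 Xy1) (perp t y2 Xy2)).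
(* By [stationary_rows], [c0] kills the images of [Y t], in particular of [x1 + t e]; continued
   along that segment it kills [g z], a contradiction. *)
have fix0 (t : R) : 0 < t < T -> gm (Y (rC t)) *m c0 = 0.
  move=> /andP[t0 tT].
  have := @stationary_rows R _ _ (fun s => gm (X + s *: (rC t *: (X *m N)))) P c0.
  rewrite scale1r; apply; last by rewrite scale0r addr0.
  move=> s s01; have st : 0 <= s * t < T.
    rewrite mulr_ge0 ?(ltW t0) //=; last by case/andP: s01.
    by apply: le_lt_trans tT; rewrite ger_pMl //; case/andP: s01.
  have YE : X + rC s *: (rC t *: (X *m N)) = Y (rC (s * t)) by rewrite scalerA -rmorphM.
  have [HY _ _ dY _] := Tall _ st.
  have HY' : inO (X + rC s *: (rC t *: (X *m N))) by rewrite YE.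
  have [D HD] := mder_ex (mcdiff_gm gd HY').
  exists D; split; [exact: HD| |by rewrite YE].
  rewrite YE submxE; apply/eqP/matrixP => i l; rewrite [RHS]mxE mulmx_entry.
  have [L HL] := gd (inO_row i HY').
  have -> : row i D = row i (rC t *: (X *m N)) *m L.
    apply/rowP => p; rewrite [LHS]mxE; exact: (cder_unique (HD i p) (gm_cder p HL)).
  rewrite YE in HL; apply: (bad _ i L _ _ st HL).
  by rewrite colE mulmxA mulmx_coker mul0mx.
have xe s : row 0 (X + s *: (X *m N)) = x1 + s *: e.
  by rewrite linearD linearZ /= row_mul NE mulmxA x1c mul1mx.
have Hx1 : inO x1 by exact: inO_row.
have Hxe : inO (x1 + e) by rewrite /e addrC subrK.
have := @gm_identity _ _ _ _ _ _ gd _ x1 e (fun M => (M *m c0) 0 0) T _ Hx1 Hxe T0.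
have -> : x1 + e = z by rewrite /e addrC subrK.
rewrite gm_row => K; move/eqP: zc0; apply; apply: K.
  by move=> F t HF; apply: mcdiff_mul => //; exact: mcdiff_const.
move=> t t01; rewrite gm_row -xe -row_gm -row_mul fix0 // row0 mxE //.
Qed.

End Maximal.
End RankGap.

(** * Freeing the identity from the orthogonality constraint *)

Section LocalFactorization.
Variable R : realType.
Local Notation C := R[i].
Local Notation nm := (@ComplexField.Normc.normc R).
Local Notation rC := (@real_complex_def R (Phant R)).
Variables (n m : nat) (J : 'M[C]_n) (J' : 'M[C]_m).
Hypothesis ctJ : ct J = J.
Hypothesis JJ : J *m J = 1%:M.
Hypothesis ctJ' : ct J' = J'.
Variables (p0 : 'rV[C]_n) (rho : R).
Hypothesis rho0 : 0 < rho.
Local Notation inO := (inbox p0 rho).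
Variable g : 'rV[C]_n -> 'rV[C]_m.
Hypothesis gd : forall x, inO x -> hdiff g x.
Hypothesis O0 : ~ inO (0 : 'rV[C]_n).
Hypothesis orth : forall x y, inO x -> inO y -> hf J x y = 0 -> hf J' (g x) (g y) = 0.

Local Notation H x y := (hf J' (g x) (g y) 0 0).
Local Notation q x y := (hf J x y 0 0).
Local Notation gm := (gm g).
Local Notation star := (star_eq J J' g).
Local Notation spans := (spans p0 rho g).

Lemma codim_gt1 (r0 j0 k0 n0 : nat) : (r0 <= j0)%N -> (j0 < k0)%N -> (2 * k0 <= n0)%N ->
  ~ (n0 - r0 <= 1)%N.
Proof. by clear; lia. Qed.

Lemma nonzero_dual (y : 'rV[C]_n) : y != 0 -> exists u : 'rV[C]_n, hf J u y = 1%:M.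
Proof.
move=> y0; have : J *m ct y != 0.
  apply: contra_neq y0 => E; apply: (@ct_inj _ _ _).
  by rewrite ct0 -[ct y]mul1mx -JJ -mulmxA E mulmx0.
move=> /matrix0Pn[i [l]]; rewrite ord1 => n0.
exists (((J *m ct y) i 0)^-1 *: delta_mx 0 i); rewrite hfZl /hf -mulmxA -rowE.
apply/matrixP => a b; rewrite !ord1 [LHS]mxE [row i _ _ _]mxE mulVf // mxE eqxx //.
Qed.

(** [X'] subtracts from [X] a multiple of [hf J X b *m u]; the factor [t / (1 + t q u b)] solves the
    orthogonality to [y0 + t b]. This multiplies [X] on the right, so the rank does not grow. *)
Lemma move_line a (X : 'M[C]_(a, n)) (y0 u b : 'rV[C]_n) : inO X -> row_free (gm X) ->
  hf J X y0 = 0 -> hf J u y0 = 1%:M ->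
  exists2 t1 : R, 0 < t1 & forall t, 0 < t < t1 -> exists X' : 'M[C]_(a, n),
    [/\ (\rank X' <= \rank X)%N, inO X', row_free (gm X'), hf J X' (y0 + rC t *: b) = 0 &
     forall y : 'rV[C]_n, hf J X y = 0 -> hf J u y = 0 -> hf J X' y = 0].
Proof.
move=> HX Xf Xy uy; have [P XP] := proj1 (row_free_det _) Xf.
pose B := - (hf J X b *m u); pose ka := q u b.
have HX0 : inO (X + 0 *: B) by rewrite scale0r addr0.
have [d1 d10 Hd1] := inO_cont (mcdiff_affine X B 0) HX0.
have n0 : 0 < nm (\det (gm X *m P)) / 2 by rewrite divr_gt0 // nm_gt0.
have [d2 d20 Hd2] := cdiff_cont (cdiff_gm_det gd P HX0) n0.
pose d := Num.min d1 d2; have d0 : 0 < d by rewrite lt_min d10.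
have k1 : 0 < nm ka + 1 by rewrite ltr_wpDl ?nm_ge0.
exists (Num.min (d / 2) (1 / 2 / (nm ka + 1))).
  by rewrite lt_min !divr_gt0.
move=> t; rewrite lt_min => /and3P[t0 td tk].
rewrite ltr_pdivlMr // in tk.
pose D := 1 + rC t * ka.
have nt : nm (rC t) = t by rewrite nm_real gtr0_norm.
have Dn : 1 / 2 <= nm D.
  have := nmB D (rC t * ka); rewrite /D addrK nm1 nmM nt.
  have := nm_ge0 ka; nra.
have D0 : D != 0 by rewrite -nm_gt0; lra.
pose r := rC t / D.
have rd : nm r < d.
  rewrite /r nmM nmV nt ltr_pdivrMr; last by lra.
  apply: (@lt_le_trans _ _ (d * (1 / 2))); first by lra.
  by rewrite ler_wpM2l // ltW.
move: (rd); rewrite lt_min => /andP[rd1 rd2].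
exists (X + r *: B).
have XE : X + r *: B = X *m (1%:M - r *: (J *m ct b *m u)).
  by rewrite mulmxBr mulmx1 -scalemxAr !mulmxA /B scalerN.
split.
- by rewrite XE; exact: mxrankM_maxl.
- by have := Hd1 r rd1; rewrite add0r.
- apply/row_free_det; exists P; apply/eqP => E.
  by have := Hd2 r rd2; rewrite add0r E scale0r addr0 sub0r nmN; lra.
- have hub : hf J u (y0 + rC t *: b) = D%:M.
    rewrite hfDr hfZr uy conjc_real [hf J u b]mx11_scalar -/ka scale_scalar_mx.
    by rewrite /D raddfD.
  rewrite /B hfDl hfZl -mulNmx hfMl hub hfDr hfZr Xy conjc_real add0r.
  rewrite mul_mx_scalar scalerA scalerN /r divfK //.
  by rewrite subrr.
- by move=> y Xy' uy'; rewrite /B hfDl hfZl -mulNmx hfMl Xy' uy' mulmx0 scaler0 addr0.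
Qed.

Variables (k c : nat).
Hypothesis frames : forall d, (0 < d <= k)%N ->
  exists B : 'M[C]_(d, n), [/\ row_free B, hf J B B = 0 & (p0 <= B)%MS].
Hypothesis null_bound : forall a (X : 'M[C]_(a, n)), inO X -> hf J X X = 0 ->
  row_free (gm X) -> (a <= c)%N.
Hypothesis ck : (c + 2 <= 2 * k)%N.
Hypothesis kn : (2 * k <= n)%N.

Lemma H_identity (x z : 'rV[C]_n) (b : 'rV[C]_n) t1 : inO x -> inO (x + b) -> 0 < t1 ->
  (forall t, 0 < t < t1 -> H (x + rC t *: b) z = 0) -> H (x + b) z = 0.
Proof.
move=> Hx Hxb t10 Hz.
have := @gm_identity _ _ _ _ _ _ gd _ x b (fun M => (M *m (J' *m ct (g z))) 0 0) t1 _ Hx Hxb t10.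
rewrite gm_row mulmxA; apply.
  by move=> F t HF; apply: mcdiff_mul => //; exact: mcdiff_const.
by move=> t t01; rewrite gm_row mulmxA; exact: Hz.
Qed.

(** [star_max] needs its last two arguments orthogonal to one maximal family. [w2] is fixed near a
    row of a null maximal family; for a given [w1] the family then follows a second point starting
    from [w0] towards [w1] for a short time, staying orthogonal to [w2], and the identity theorem
    covers the rest of the way. *)
Lemma local_factorization : (forall z y, inO z -> inO y -> H z y = 0) \/
  exists w2 z0, [/\ inO w2, inO z0, H z0 w2 != 0 &
    forall z1 z2 w1, inO z1 -> inO z2 -> inO w1 -> star z1 z2 w1 w2].
Proof.
case: (pselect (forall z y, inO z -> inO y -> H z y = 0)) => [|nH]; first by left.
right; have [y1 [z0 [Hy1 Hz0 Hzy]]] : exists y z, [/\ inO y, inO z & H y z != 0].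
  apply: contrapT => nyz; apply: nH => z y Hz Hy; apply/eqP; apply: contra_notT nyz => n0.
  by exists z, y.
have s11 : spans 1 1.
  exists y1; split => //; first exact: rank_leq_row.
  have gy : g y1 != 0 by apply: contra_neq Hzy => ->; rewrite hf0l mxE.
  by rewrite /row_free gm_row rank_rV gy.
have bd a : spans k a -> (a <= c)%N.
  case: a => // a [X [rX HX Xf]].
  have [Y [_ HY YY Yf]] := null_rows ctJ JJ rho0 gd O0 frames rX HX Xf.
  exact: null_bound HY YY Yf.
have [j [a [/andP[j0 jk] [X0 [rX0 HX0 X0f]] max1 max2]]] := exists_gap bd ck s11.
have rX0k : (\rank X0 <= k)%N by apply: leq_trans rX0 (ltnW jk).
(* A null family is orthogonal to its own rows, which supplies a first point of the box orthogonal
   to it. *)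
have [X [rX HX XX Xf]] := null_rows ctJ JJ rho0 gd O0 frames rX0k HX0 X0f.
have {rX0k HX0 X0f} {}rX := leq_trans rX rX0.
pose x1 := row 0 X; have Hx1 : inO x1 := inO_row 0 HX.
have Xx1 : hf J X x1 = 0 by rewrite /x1 rowE hfMr XX mul0mx.
have x10 : x1 != 0 by apply/eqP => E; apply: O0; rewrite -E.
have [u0 u0x] := nonzero_dual x10.
pose b1 := y1 - x1; have yE : x1 + b1 = y1 by rewrite /b1 addrC subrK.
have [t1 t10 Ht1] := move_line b1 HX Xf Xx1 u0x.
have [t2 t20 Ht2] := small_line b1 Hx1.
have [t [tt1 tt2 Ht]] : exists t, [/\ 0 < t < t1, 0 < t < t2 & H (x1 + rC t *: b1) z0 != 0].
  apply: contrapT => nt; move/eqP: Hzy; apply; rewrite -yE.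
  apply: (@H_identity x1 z0 b1 (Num.min t1 t2)) => //; first by rewrite yE.
    by rewrite lt_min t10.
  move=> t; rewrite lt_min => /and3P[ta tb tc]; apply/eqP; apply: contra_notT nt => n0.
  by exists t; rewrite ta tb tc.
set w2 := x1 + rC t *: b1 in Ht; have Hw2 : inO w2 := Ht2 t tt2.
have [X1 [rX1 HX1 X1f X1w _]] := Ht1 t tt1; rewrite -/w2 in X1w.
have {}rX1 := leq_trans rX1 rX.
exists w2, z0; split; [exact: Hw2|exact: Hz0|by rewrite (H_conj ctJ') conjc_eq0|].
(* The orthogonal complement of [X1] has dimension at least [n - j], hence at least two, and is not
   contained in the line of [w2]; this yields a starting point [w0] independent of [w2]. *)
have [b2 [X1b2 b2w]] : exists b2 : 'rV[C]_n, hf J X1 b2 = 0 /\ ~ (b2 <= w2)%MS.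
  apply: contrapT => nb; pose K := kermx (J *m ct X1).
  have Kw : (K <= w2)%MS.
    apply/row_subP => i; apply: contrapT => niw; apply: nb; exists (row i K); split => //.
    have KJ : hf J (row i K) X1 = 0 by rewrite /hf -mulmxA -row_mul mulmx_ker row0.
    by rewrite -(ct_hf ctJ) KJ ct0.
  have K1 := leq_trans (mxrankS Kw) (rank_leq_row w2); rewrite mxrank_ker in K1.
  have Kj : (\rank (J *m ct X1) <= j)%N.
    apply: leq_trans (mxrankM_maxr _ _) _.
    by rewrite /ct mxrank_tr mxrank_map.
  exact: codim_gt1 Kj jk kn K1.
have [t3 t30 Ht3] := small_line b2 Hw2.
pose s := t3 / 2; have s0 : 0 < s by rewrite divr_gt0.
have s3 : 0 < s < t3 by rewrite s0 /= /s ltr_pdivrMr // ltr_pMr // ltr1n.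
pose w0 := w2 + rC s *: b2; have Hw0 : inO w0 := Ht3 s s3.
have X1w0 : hf J X1 w0 = 0 by rewrite /w0 hfDr hfZr X1w X1b2 scaler0 addr0.
have rs0 : rC s != 0 by rewrite -nm_gt0 nm_real gtr0_norm.
(* Moving the family along [u] leaves its orthogonality to [w2] intact. *)
have [u [uw2 uw0]] : exists u : 'rV[C]_n, hf J u w2 = 0 /\ hf J u w0 = 1%:M.
  have [x [xw xb]] : exists x : 'rV[C]_n, hf J x w2 = 0 /\ q x b2 != 0.
    apply: contrapT => nx.
    have [e eE] : exists e, J *m ct b2 = e *: (J *m ct w2).
      apply: functional_multiple => x xw; apply: scal00; apply/eqP.
      apply: contra_notT nx => n0; exists x; rewrite /hf -!mulmxA; split => //.
    apply: b2w; have -> : b2 = conjc e *: w2.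
      apply: (@ct_inj _ _ _); rewrite ctZ conjcK -[ct b2]mul1mx -JJ -mulmxA eE -scalemxAr mulmxA JJ.
      by rewrite mul1mx.
    by rewrite scalemx_sub.
  have x0 : q x w0 = conjc (rC s) * q x b2.
    by rewrite /w0 hfDr hfZr xw add0r mxE.
  have n0 : q x w0 != 0 by rewrite x0 mulf_neq0 // conjc_eq0.
  exists ((q x w0)^-1 *: x); rewrite !hfZl xw scaler0; split => //.
  by rewrite [hf J x w0]mx11_scalar scale_scalar_mx mxE eqxx mulr1n mulVf.
move=> z1 z2 w1 Hz1 Hz2 Hw1.
pose b := w1 - w0; have w1E : w0 + b = w1 by rewrite /b addrC subrK.
have [t4 t40 Ht4] := move_line b HX1 X1f X1w0 uw0.
have [t5 t50 Ht5] := small_line b Hw0.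
apply/(star_cstar ctJ ctJ').
have Hw01 : inO (w0 + b) by rewrite w1E.
have [e e0 He] := inO_line Hw0 Hw01.
pose f x := cstar J J' g (w0 + x *: b) (w2 + x *: 0) z1 z2.
have f1 : f 1 = cstar J J' g w1 w2 z1 z2 by rewrite /f scale1r scaler0 addr0 w1E.
have t450 : 0 < Num.min t4 t5 by rewrite lt_min t40.
rewrite -f1; apply: (@identity01 R f e (Num.min t4 t5) e0 t450).
  move=> x w x01 we; apply: (cdiff_cstar J J' gd); first exact: He.
  by rewrite scaler0 addr0.
move=> x; rewrite lt_min => /and3P[xa xb xc].
have x4 : 0 < x < t4 by rewrite xa.
have x5 : 0 < x < t5 by rewrite xa.
have [X2 [rX2 HX2 X2f X2w X2y]] := Ht4 x x4.
rewrite /f scaler0 addr0; apply/(star_cstar ctJ ctJ').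
have rX2' := leq_trans rX2 rX1.
exact: (star_max ctJ JJ ctJ' gd O0 orth max1 max2 rX2' HX2 X2f Hz1 Hz2 (Ht5 x x5) Hw2
  X2w (X2y w2 X1w uw2)).
Qed.

End LocalFactorization.

(** * The local form of an orthogonal map *)

Section Span.
Variable F : fieldType.

Lemma row_free_cons k m (M : 'M[F]_(k, m)) (x : 'rV[F]_m) :
  row_free M -> ~ (x <= M)%MS -> row_free (col_mx x M).
Proof.
move=> Mf nx; rewrite -kermx_eq0; apply/rowV0P => y /sub_kermxP.
rewrite -[y]hsubmxK mul_row_col; set be := lsubmx y; set al := rsubmx y.
rewrite [be]mx11_scalar mul_scalar_mx => E.
case: (eqVneq (be 0 0) 0) => b0.
  move: E; rewrite b0 scale0r add0r => E.
  have -> : al = 0 by apply: (row_free_inj Mf); rewrite E mul0mx.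
  by rewrite raddf0 row_mx0.
case: nx; have -> : x = - (be 0 0)^-1 *: (al *m M).
  have -> : al *m M = - (be 0 0 *: x) by apply/eqP; rewrite -addr_eq0 addrC E.
  by rewrite scaleNr scalerN opprK scalerA mulVf // scale1r.
by rewrite scalemx_sub // submxMl.
Qed.

(** A free family drawn from [S] grows until it spans [S], with at most [m] rows. Keeping its rows
    in [S] lets Gram matrices be computed from values on [S]. *)
Lemma span_set m (S : 'rV[F]_m -> Prop) : exists k (M : 'M[F]_(k, m)),
  [/\ row_free M, forall i, S (row i M) & forall x, S x -> (x <= M)%MS].
Proof.
apply: contrapT => nM.
have K k : exists M : 'M[F]_(k, m), row_free M /\ forall i, S (row i M).
  elim: k => [|k [M [Mf MS]]].
    by exists 0; split => [|[]//]; rewrite /row_free mxrank0.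
  have [x [Sx nx]] : exists x, S x /\ ~ (x <= M)%MS.
    apply: contrapT => nx; apply: nM; exists k, M; split => // x Sx.
    by apply: contrapT => xM; apply: nx; exists x.
  have KK : exists N : 'M[F]_(1 + k, m), row_free N /\ forall i : 'I_(1 + k), S (row i N).
    exists (col_mx x M); split; first exact: row_free_cons.
    move=> i; case: (splitP i) => l il.
      have -> : i = lshift k l by apply: val_inj.
      by rewrite rowKu ord1 (_ : row 0 x = x) //; apply/rowP => p; rewrite mxE.
    have -> : i = rshift 1 l by apply: val_inj.
    by rewrite rowKd.
  exact: KK.
have [M [/eqP Mf _]] := K m.+1.
by have := rank_leq_col M; rewrite Mf ltnn.
Qed.

End Span.

Section StarAlgebra.
Variables (F : fieldType) (a s : F).
Hypotheses (a0 : a != 0) (s0 : s != 0).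

Lemma star_solve h x y u v p : h * a * (x * y) = u * v * (p * s) -> x != 0 -> y != 0 ->
  h = u / x * (v / y) * (s / a) * p.
Proof.
move=> E x0 y0; apply: (mulIf (mulf_neq0 a0 (mulf_neq0 x0 y0))); rewrite mulrA E.
by field; rewrite x0 y0 a0.
Qed.

Lemma star_neq0 h x y u v p : h * a * (x * y) = u * v * (p * s) ->
  u != 0 -> v != 0 -> p != 0 -> h != 0.
Proof.
move=> E u0 v0 p0; have : u * v * (p * s) != 0 by rewrite !mulf_neq0.
by rewrite -E; apply: contra_neq => ->; rewrite !mul0r.
Qed.

(** Each value of [H] is solved from the identity, [a] and [s] being the values of [H] and of the
    source form at the base pair; in the combination all factors attached to the base pair cancel,
    leaving the pivot [b]. *)
Lemma star_ratio hzw hbb hzb hbw qzw qbb qzb qbw hz hb qz qb kw kb lw lb :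
  hzw * a * (qz * lw) = hz * kw * (qzw * s) -> hbb * a * (qb * lb) = hb * kb * (qbb * s) ->
  hzb * a * (qz * lb) = hz * kb * (qzb * s) -> hbw * a * (qb * lw) = hb * kw * (qbw * s) ->
  [/\ hb != 0, kb != 0, qz != 0, qb != 0 & lw != 0] -> lb != 0 ->
  [/\ qbb != 0, qzb != 0 & qbw != 0] ->
  hzw = qbb / hbb * (hzb / qzb) * (hbw / qbw) * qzw.
Proof.
move=> E1 E2 E3 E4 [hb0 kb0 qz0 qb0 lw0] lb0 [n1 n2 n3].
rewrite (star_solve E1) // (star_solve E2) // (star_solve E3) // (star_solve E4) //.
by field; rewrite hb0 kb0 qz0 qb0 lw0 lb0 n1 n2 n3 s0 a0.
Qed.

End StarAlgebra.

(** * Conformal factor and linear part of the map *)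

Section Splitting.
Variable R : realType.
Local Notation C := R[i].
Local Notation nm := (@ComplexField.Normc.normc R).
Local Notation rC := (@real_complex_def R (Phant R)).
Variables (n m : nat) (J : 'M[C]_n) (J' : 'M[C]_m).
Hypothesis ctJ : ct J = J.
Hypothesis JJ : J *m J = 1%:M.
Hypothesis ctJ' : ct J' = J'.
Variables (p0 : 'rV[C]_n) (rho : R).
Local Notation inO := (inbox p0 rho).
Variable g : 'rV[C]_n -> 'rV[C]_m.
Hypothesis gd : forall x, inO x -> hdiff g x.
Hypothesis O0 : ~ inO (0 : 'rV[C]_n).
Hypothesis orth : forall x y, inO x -> inO y -> hf J x y = 0 -> hf J' (g x) (g y) = 0.

Local Notation H x y := (hf J' (g x) (g y) 0 0).
Local Notation q x y := (hf J x y 0 0).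
Local Notation star := (star_eq J J' g).

Lemma nonzero_near (f : C -> C) : cdiff f 0 -> f 0 != 0 ->
  exists2 d, 0 < d & forall t : R, 0 < t < d -> f (rC t) != 0.
Proof.
move=> [l fl] f0; have n0 : 0 < nm (f 0) / 2 by rewrite divr_gt0 // nm_gt0.
have [d d0 Hd] := cder_cont0 fl n0; exists d; first by [].
move=> t t01; apply/eqP => ft; have := Hd t t01; rewrite ft sub0r nmN; lra.
Qed.

Lemma H_line (x v y : 'rV[C]_n) : inO x -> H x y != 0 ->
  exists2 d, 0 < d & forall t : R, 0 < t < d -> H (x + rC t *: v) y != 0.
Proof.
move=> Hx Hxy; apply: (@nonzero_near (fun s => H (x + s *: v) y)); last by rewrite scale0r addr0.
apply: (@cdiff_ext _ (fun s => (gm g (x + s *: v) *m (J' *m ct (g y))) 0 0)).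
  by move=> s; rewrite gm_row mulmxA.
apply: mcdiff_mul; last exact: mcdiff_const.
by apply: (mcdiff_gm gd); rewrite scale0r addr0.
Qed.

Lemma q_line (x v y : 'rV[C]_n) : q x y != 0 ->
  exists2 d, 0 < d & forall t : R, 0 < t < d -> q (x + rC t *: v) y != 0.
Proof.
move=> Hxy; apply: (@nonzero_near (fun s => q (x + s *: v) y)); last by rewrite scale0r addr0.
apply: (@cdiff_ext _ (fun s => ((x + s *: v) *m (J *m ct y)) 0 0)).
  by move=> s; rewrite mulmxA.
by apply: mcdiff_mul; [exact: mcdiff_affine|exact: mcdiff_const].
Qed.

Lemma q_neq0 x y : inO x -> inO y -> H x y != 0 -> q x y != 0.
Proof.
move=> Hx Hy; apply: contra_neq => q0; rewrite orth ?mxE //.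
exact: scal00.
Qed.

Lemma small2 (P Q : R -> Prop) : (exists2 d, 0 < d & forall t : R, 0 < t < d -> P t) ->
  (exists2 d, 0 < d & forall t : R, 0 < t < d -> Q t) ->
  exists2 d, 0 < d & forall t : R, 0 < t < d -> P t /\ Q t.
Proof.
move=> [d d0 Hd] [e e0 He]; exists (Num.min d e); first by rewrite lt_min d0.
by move=> t; rewrite lt_min => /and3P[t0 td te]; split; [apply: Hd|apply: He]; rewrite t0.
Qed.

Lemma small_pick (P : R -> Prop) : (exists2 d, 0 < d & forall t : R, 0 < t < d -> P t) ->
  exists2 t : R, 0 < t & P t.
Proof.
move=> [d d0 Hd]; exists (d / 2); first by rewrite divr_gt0.
by apply: Hd; rewrite divr_gt0 //= ltr_pdivrMr // ltr_pMr // ltr1n.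
Qed.

Lemma conj_fixed (x : C) : conjc x = x -> x = rC (complex.Re x).
Proof.
case: x => a b [] /eqP; rewrite -subr_eq0 -opprD oppr_eq0 -mulr2n mulrn_eq0 /= => /eqP ->.
by [].
Qed.

Lemma conj_fixed_q d (K : 'M[C]_d) (x : 'rV[C]_d) : ct K = K ->
  conjc (hf K x x 0 0) = hf K x x 0 0.
Proof. by move=> cK; rewrite -{2}(ct_hf cK) ctE. Qed.

Lemma real_ratio (x y : C) : conjc x = x -> conjc y = y -> x != 0 -> y != 0 ->
  exists2 ka : R, ka != 0 & x / y = rC ka.
Proof.
move=> cx cy x0 y0; have E : x / y = rC (complex.Re (x / y)).
  by apply: conj_fixed; rewrite conjM conjc_inv cx cy.
exists (complex.Re (x / y)); last exact: E.
have : x / y != 0 by rewrite mulf_neq0 ?invr_eq0.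
by apply: contra_neq => E0; rewrite E E0.
Qed.

(** A pivot [b] replaces the pair [z0], [w2]: [phi z = H z b / q z b] and [ka = q b b / H b b], real
    as a quotient of diagonal values. [Om] is the set where no denominator vanishes; of its openness
    only short real segments are recorded. *)
Lemma hermitian_factor w2 z0 : inO w2 -> inO z0 -> H z0 w2 != 0 ->
  (forall z1 z2 w1, inO z1 -> inO z2 -> inO w1 -> star z1 z2 w1 w2) ->
  exists (Om : 'rV[C]_n -> Prop) (phi : 'rV[C]_n -> C) (ka : R),
    [/\ ka != 0, exists b, Om b, forall z, Om z -> inO z /\ phi z != 0,
        forall z v, Om z -> exists2 t1, 0 < t1 & forall t : R, 0 < t < t1 -> Om (z + rC t *: v) &
        forall z w, Om z -> Om w ->
          hf J' (g z) (g w) = (rC ka * phi z * conjc (phi w)) *: hf J z w].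
Proof.
move=> Hw2 Hz0 Hzw st.
have Hwz : H w2 z0 != 0 by rewrite (H_conj ctJ') conjc_eq0.
(* a point [b] at which none of the relevant forms vanish *)
have [b0 [Hb0 b01 b02]] : exists b, [/\ inO b, H b w2 != 0 & H b z0 != 0].
  pose v := w2 - z0; have vE : z0 + v = w2 by rewrite /v addrC subrK.
  have [d d0 Hd] := small2 (small_line v Hz0) (H_line v Hz0 Hzw).
  apply: contrapT => nb; move/eqP: Hwz; apply; rewrite -vE.
  have Hzv : inO (z0 + v) by rewrite vE.
  apply: (H_identity gd Hz0 Hzv d0) => t t01; have [Ht Hn] := Hd t t01.
  by apply/eqP; apply: contra_notT nb => n0; exists (z0 + rC t *: v).
have b00 : b0 != 0 by apply/eqP => E; apply: O0; rewrite -E.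
have [b [Hb b1 b2 bb]] : exists b, [/\ inO b, H b w2 != 0, H b z0 != 0 & q b b != 0].
  (* With [q v b0 = 1], the value at [b0 + t v] is [t (2 + t q v v)], nonzero for small [t]. *)
  case: (eqVneq (q b0 b0) 0) => qb; last by exists b0.
  have [v vb] := nonzero_dual JJ b00.
  have bv : hf J b0 v = 1%:M by rewrite -(ct_hf ctJ) vb ct1.
  pose f s : C := 2 + s * q v v.
  have fz : exists2 d, 0 < d & forall t : R, 0 < t < d -> f (rC t) != 0.
    apply: nonzero_near; last by rewrite /f mul0r addr0 pnatr_eq0.
    by apply: cdiff_add; [exact: cdiff_const|apply: cdiff_mul; [exact: cdiff_id|exact: cdiff_const]].
  have S1 := small2 (small_line v Hb0) (H_line v Hb0 b01).
  have S2 := small2 (H_line v Hb0 b02) fz.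
  have [t t0 [[h1 h2] [h3 h4]]] := small_pick (small2 S1 S2).
  exists (b0 + rC t *: v); split => //.
  have -> : q (b0 + rC t *: v) (b0 + rC t *: v) = rC t * f (rC t).
    rewrite hfDl !hfDr !hfZl !hfZr conjc_real vb bv (scal00 qb) /f.
    rewrite [hf J v v]mx11_scalar; move: (q v v) => x.
    by rewrite !mxE eqxx !mulr1n; ring.
  by rewrite mulf_neq0 // -nm_gt0 nm_real gtr0_norm.
have qbw := q_neq0 Hb Hw2 b1; have qbz := q_neq0 Hb Hz0 b2.
have qzw := q_neq0 Hz0 Hw2 Hzw.
have qzb : q z0 b != 0 by rewrite (q_conj ctJ) conjc_eq0.
have Hzb : H z0 b != 0 by rewrite (H_conj ctJ') conjc_eq0.
have bbn : H b b != 0.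
  exact: (star_neq0 qzw (st b z0 b Hb Hz0 Hb) b1 Hzb bb).
pose Om z := [/\ inO z, H z b != 0, q z w2 != 0 & q z z0 != 0].
have Ob : Om b by split; [exact: Hb|exact: bbn|exact: qbw|exact: qbz].
pose phi z := H z b / q z b.
have [ka ka0 kE] := real_ratio (conj_fixed_q b ctJ) (conj_fixed_q (g b) ctJ') bb bbn.
exists Om, phi, ka; split; [exact: ka0|by exists b| | |].
- move=> z [Hz hz _ _]; split; first exact: Hz.
  by apply: mulf_neq0; [exact: hz|apply: invr_neq0; exact: q_neq0 Hz Hb hz].
- move=> z v [Hz hz qz qz0].
  have S1 := small2 (small_line v Hz) (H_line v Hz hz).
  have S2 := small2 (q_line v qz) (q_line v qz0).
  have [d d0 Hd] := small2 S1 S2; exists d; first exact: d0.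
  by move=> t t01; have [[h1 h2] [h3 h4]] := Hd t t01; split; [exact: h1|exact: h2|exact: h3|exact: h4].
- move=> z w [Hz hz qz qz0] [Hw hw qw qw0].
  have q0w : q z0 w != 0 by rewrite (q_conj ctJ) conjc_eq0.
  have qbw' : q b w != 0 by rewrite (q_conj ctJ) conjc_eq0; exact: q_neq0 Hw Hb hw.
  rewrite -kE; apply/matrixP => i j; rewrite !ord1 [RHS]mxE.
  have -> : conjc (phi w) = H b w / q b w.
    by rewrite /phi conjM conjc_inv -(q_conj ctJ) -(H_conj ctJ').
  exact: (star_ratio Hzw qzw (st z z0 w Hz Hz0 Hw) (st b z0 b Hb Hz0 Hb)
    (st z z0 b Hz Hz0 Hb) (st b z0 w Hb Hz0 Hw) (And5 b1 Hzb qz qbw q0w) qzb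
    (And3 bb (q_neq0 Hz Hb hz) qbw')).
Qed.

(** [Om] contains a point and nearby points in all directions, hence a basis [M]; sending [M] to the
    normalized images defines [sg]. The remainder is null and orthogonal to the image because
    normalized images pair with each other and with the image of [sg] by one formula. *)
Lemma isometric_section (Om : 'rV[C]_n -> Prop) (phi : 'rV[C]_n -> C) (ka : R) :
  (exists b, Om b) -> (forall z, Om z -> inO z /\ phi z != 0) ->
  (forall z v, Om z -> exists2 t1, 0 < t1 & forall t : R, 0 < t < t1 -> Om (z + rC t *: v)) ->
  (forall z w, Om z -> Om w -> hf J' (g z) (g w) = (rC ka * phi z * conjc (phi w)) *: hf J z w) ->
  exists sg : 'M[C]_(n, m),
    (forall a b (x : 'M[C]_(a, n)) (y : 'M[C]_(b, n)), hf J' (x *m sg) (y *m sg) = rC ka *: hf J x y) /\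
    exists N : 'rV[C]_n -> 'rV[C]_m, [/\ forall z, Om z -> g z = phi z *: (z *m sg + N z),
      forall z (x : 'rV[C]_n), Om z -> hf J' (N z) (x *m sg) = 0 &
      forall z w, Om z -> Om w -> hf J' (N z) (N w) = 0].
Proof.
move=> [b Ob] HO Hl HH.
have [k [M [Mf MO Msp]]] := span_set Om.
have M1 : (1%:M <= M)%MS.
  apply/row_subP => i; have [t t0 Ot] := small_pick (Hl b (row i 1%:M) Ob).
  have -> : row i 1%:M = (rC t)^-1 *: (b + rC t *: row i 1%:M - b) :> 'rV[C]_n.
    rewrite [b + _]addrC addrK scalerA mulVf ?scale1r //.
    by rewrite -nm_gt0 nm_real gtr0_norm.
  apply: scalemx_sub; apply: addmx_sub; first exact: Msp.
  by rewrite -scaleN1r; apply: scalemx_sub; exact: Msp.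
have [P PM] : exists P, P *m M = 1%:M by exists (pinvmx M); rewrite -[pinvmx M]mul1mx mulmxKpV.
pose gh z := (phi z)^-1 *: g z.
have ghh z w : Om z -> Om w -> hf J' (gh z) (gh w) = rC ka *: hf J z w.
  move=> Oz Ow; have [_ fz] := HO _ Oz; have [_ fw] := HO _ Ow.
  rewrite /gh hfZl hfZr HH // !scalerA; congr (_ *: _); rewrite conjc_inv.
  by field; rewrite fz conjc_eq0 fw.
pose Ga := gm gh M.
have GaG : hf J' Ga Ga = rC ka *: hf J M M.
  apply/matrixP => i j; rewrite [LHS]hfE !row_gm ghh //; rewrite [RHS]mxE (hfE J M M).
  by rewrite mxE.
have GaR w : Om w -> hf J' Ga (gh w) = rC ka *: hf J M w.
  move=> Ow; apply/matrixP => i j; rewrite [LHS]hfE row_gm ord1.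
  rewrite (_ : row 0 (gh w) = gh w); last by apply/rowP => p; rewrite mxE.
  rewrite ghh // [RHS]mxE (hfE J M w) mxE; congr (_ * hf J _ _ _ _).
  by apply/rowP => p; rewrite mxE.
have GaL w : Om w -> hf J' (gh w) Ga = rC ka *: hf J w M.
  by move=> Ow; rewrite -(ct_hf ctJ') GaR // ctZ conjc_real ct_hf.
have xPM a (x : 'M[C]_(a, n)) : x *m P *m M = x by rewrite -mulmxA PM mulmx1.
have sgg a b' (x : 'M[C]_(a, n)) (y : 'M[C]_(b', n)) :
    hf J' (x *m (P *m Ga)) (y *m (P *m Ga)) = rC ka *: hf J x y.
  rewrite !mulmxA !hfMl !hfMr GaG -!scalemxAl -!scalemxAr; congr (_ *: _).
  by rewrite -hfMr -hfMl !xPM.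
exists (P *m Ga); split; first exact: sgg.
have sgE z w : Om w -> hf J' (z *m (P *m Ga)) (gh w) = rC ka *: hf J z w.
  by move=> Ow; rewrite mulmxA hfMl GaR // -scalemxAr -hfMl xPM.
have sgE' z w : Om w -> hf J' (gh w) (z *m (P *m Ga)) = rC ka *: hf J w z.
  by move=> Ow; rewrite -(ct_hf ctJ') sgE // ctZ conjc_real ct_hf.
exists (fun z => gh z - z *m (P *m Ga)); split.
- move=> z Oz; have [_ fz] := HO _ Oz.
  by rewrite [_ *m _ + _]addrC subrK /gh scalerA mulfV // scale1r.
- by move=> z x Oz; rewrite hfBl sgE' // sgg subrr.
- by move=> z w Oz Ow; rewrite hfBl !hfBr ghh // sgE' // sgE // sgg subrr.
Qed.

End Splitting.

(** * Forms of given signature *)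

Lemma nonzero_ker (F : fieldType) a b (A : 'M[F]_(a, b)) : (b < a)%N ->
  exists2 u : 'rV[F]_a, u != 0 & u *m A = 0.
Proof.
move=> ab; have : kermx A != 0.
  rewrite -mxrank_eq0 mxrank_ker -lt0n subn_gt0.
  exact: leq_ltn_trans (rank_leq_col A) ab.
by move=> /rowV0Pn[u /sub_kermxP uA u0]; exists u.
Qed.

Section Signature.
Variable R : realType.
Local Notation C := R[i].
Local Notation nm := (@ComplexField.Normc.normc R).
Local Notation rC := (@real_complex_def R (Phant R)).

Definition sqn k (x : 'rV[C]_k) : R := \sum_(j < k) nm (x 0 j) ^+ 2.

Lemma mul_conj (z : C) : z * conjc z = rC (nm z ^+ 2).
Proof.
case: z => a b; rewrite /= sqr_sqrtr ?addr_ge0 ?sqr_ge0 //.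
by apply/eqP; rewrite eq_complex /=; apply/andP; split; apply/eqP; ring.
Qed.

Lemma sqnE k (x : 'rV[C]_k) : x *m ct x = (rC (sqn x))%:M.
Proof.
apply/matrixP => i j; rewrite !ord1 !mxE mulr1n /sqn rmorph_sum; apply: eq_bigr => l _.
by rewrite ctE mul_conj.
Qed.

Lemma sqn_ge0 k (x : 'rV[C]_k) : 0 <= sqn x.
Proof. by apply: sumr_ge0 => j _; exact: sqr_ge0. Qed.

Lemma sqn_eq0 k (x : 'rV[C]_k) : sqn x = 0 -> x = 0.
Proof.
move=> /eqP; rewrite psumr_eq0; last by move=> j _; exact: sqr_ge0.
move=> /allP H; apply/rowP => j; rewrite mxE.
have := H j (mem_index_enum j); rewrite /= sqrf_eq0 nm_eq0 => /eqP E; exact: E.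
Qed.

Definition sign_mx N r s : 'M[C]_N := diag_mx (\row_(j < N) (hsign R r s j : C)).

Lemma hermE N r s (z w : 'rV[CC R]_N) : herm R N r s z w = hf (sign_mx N r s) z w 0 0.
Proof.
rewrite /herm /hf /sign_mx mxE; apply: eq_bigr => j _.
by rewrite mul_mx_diag ctE 2!mxE; congr (_ * _); exact: mulrC.
Qed.

Lemma sig_block r s : sign_mx (r + s) r s = block_mx 1%:M 0 0 (- 1%:M).
Proof.
apply/matrixP => i j; case: (split_ordP i) => a ->; case: (split_ordP j) => b ->.
- by rewrite block_mxEul !mxE eq_lshift /hsign /= ltn_ord.
- by rewrite block_mxEur !mxE eq_lrshift.
- by rewrite block_mxEdl !mxE eq_rlshift.
- rewrite block_mxEdr !mxE eq_rshift /hsign /= ltnNge leq_addr /= ltn_add2l ltn_ord.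
  by rewrite mulNrn.
Qed.

Lemma ct_sig N r s : ct (sign_mx N r s) = sign_mx N r s.
Proof.
apply/matrixP => i j; rewrite ctE !mxE eq_sym; case: eqP => [->|_]; last by rewrite !mulr0n conjc0.
rewrite !mulr1n /hsign; case: ifP => _; first exact: conjc1.
case: ifP => _; last exact: conjc0.
by rewrite rmorphN; congr (- _); exact: conjc1.
Qed.

Lemma sig_sqr r s : sign_mx (r + s) r s *m sign_mx (r + s) r s = 1%:M.
Proof.
rewrite sig_block mulmx_block !mulmx0 !mul0mx mulmx1 mulmxN mulNmx mulmx1 opprK.
by rewrite !addr0 !add0r -scalar_mx_block.
Qed.

Lemma hf_sig r s a b (X : 'M[C]_(a, r + s)) (Y : 'M[C]_(b, r + s)) :
  hf (sign_mx (r + s) r s) X Y = lsubmx X *m ct (lsubmx Y) - rsubmx X *m ct (rsubmx Y).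
Proof.
rewrite /hf sig_block -{1}[X]hsubmxK mul_row_block !mulmx0 addr0 add0r mulmx1 mulmxN mulmx1.
rewrite -{1}[Y]hsubmxK /ct map_row_mx tr_row_mx mul_row_col mulNmx.
by [].
Qed.

Lemma hf_sqn r s (x : 'rV[C]_(r + s)) :
  hf (sign_mx (r + s) r s) x x = (rC (sqn (lsubmx x) - sqn (rsubmx x)))%:M.
Proof. by rewrite hf_sig !sqnE -raddfB /= -rmorphB. Qed.

(** Dimension gives [u] in the positive and [v] in the negative coordinates, both orthogonal to [B];
    scaled to equal length they form a null vector. It lies outside [B], since it pairs nontrivially
    with [(u, 0)] and [B] does not. *)
Lemma extend_frame r s d (B : 'M[C]_(d, r + s)) : (d < r)%N -> (d < s)%N ->
  row_free B -> hf (sign_mx (r + s) r s) B B = 0 ->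
  exists B' : 'M[C]_(1 + d, r + s),
    [/\ row_free B', hf (sign_mx (r + s) r s) B' B' = 0 & (B <= B')%MS].
Proof.
move=> dr ds Bf BB; set J := sign_mx (r + s) r s; have cJ : ct J = J := ct_sig _ _ _.
have [u u0 uB] := nonzero_ker (ct (lsubmx B)) dr.
have [v v0 vB] := nonzero_ker (ct (rsubmx B)) ds.
have al : 0 < sqn u.
  by rewrite lt_def sqn_ge0 andbT; apply: contra_neq u0; exact: sqn_eq0.
have be : 0 < sqn v.
  by rewrite lt_def sqn_ge0 andbT; apply: contra_neq v0; exact: sqn_eq0.
pose w : 'rV[C]_(r + s) := row_mx (rC (Num.sqrt (sqn v)) *: u) (rC (Num.sqrt (sqn u)) *: v).
have wB : hf J w B = 0.
  by rewrite hf_sig row_mxKl row_mxKr -!scalemxAl uB vB !scaler0 subrr.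
have ww : hf J w w = 0.
  rewrite hf_sig row_mxKl row_mxKr !ctZ !conjc_real -!scalemxAl -!scalemxAr !sqnE !scalerA.
  rewrite !scale_scalar_mx -!rmorphM /= -!expr2 !sqr_sqrtr ?sqn_ge0 //.
  by rewrite [sqn u * _]mulrC subrr.
exists (col_mx w B); split.
- apply: row_free_cons => // /submxP[D wE].
  have xB : hf J (row_mx u 0) B = 0 by rewrite hf_sig row_mxKl row_mxKr uB mul0mx subrr.
  have : hf J w (row_mx u 0) = 0 by rewrite wE hfMl -(ct_hf cJ) xB ct0 mulmx0.
  rewrite hf_sig !row_mxKl !row_mxKr ct0 mulmx0 subr0 -scalemxAl sqnE scale_scalar_mx.
  move=> /matrixP/(_ 0 0); rewrite !mxE mulr1n -rmorphM /= => /eqP.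
  apply/negP; rewrite -nm_eq0 nm_real normr_eq0.
  by rewrite mulf_neq0 ?gt_eqF ?sqrtr_gt0.
- rewrite /hf /ct map_col_mx tr_col_mx mul_col_mx mul_col_row.
  have := wB; rewrite -(ct_hf cJ) => /(congr1 (@ct _ _ _)); rewrite ctK ct0 => Bw.
  have -> : w *m J *m (map_mx conjc w)^T = 0 by exact: ww.
  have -> : w *m J *m (map_mx conjc B)^T = 0 by exact: wB.
  have -> : B *m J *m (map_mx conjc w)^T = 0 by exact: Bw.
  have -> : B *m J *m (map_mx conjc B)^T = 0 by exact: BB.
  by rewrite block_mx_const.
- by rewrite -addsmxE addsmxSr.
Qed.

Lemma null_frames r s (p0 : 'rV[C]_(r + s)) d : p0 != 0 -> hf (sign_mx (r + s) r s) p0 p0 = 0 ->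
  (0 < d <= minn r s)%N ->
  exists B : 'M[C]_(d, r + s),
    [/\ row_free B, hf (sign_mx (r + s) r s) B B = 0 & (p0 <= B)%MS].
Proof.
move=> p00 pp; case: d => // d; elim: d => [|d IH] dk.
  by exists p0; split => //; rewrite /row_free rank_rV p00.
have [|B [Bf BB pB]] := IH; first by move: dk; lia.
have [|| B' [B'f BB' B'B]] := extend_frame _ _ Bf BB; try by move: dk; lia.
by exists B'; split => //; apply: submx_trans pB B'B.
Qed.

(** On a null space the positive and negative parts have equal length, so either projection is
    injective. *)
Lemma null_free_le r s a (G : 'M[C]_(a, r + s)) : row_free G ->
  hf (sign_mx (r + s) r s) G G = 0 -> (a <= minn r s)%N.
Proof.
move=> Gf GG.
have K (u : 'rV[C]_a) : sqn (lsubmx (u *m G)) = sqn (rsubmx (u *m G)).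
  have : hf (sign_mx (r + s) r s) (u *m G) (u *m G) = 0 by rewrite hfMl hfMr GG mul0mx mulmx0.
  rewrite hf_sqn => /matrixP/(_ 0 0); rewrite !mxE mulr1n => /eqP.
  by rewrite -nm_eq0 nm_real normr_eq0 subr_eq0 => /eqP.
have Z (u : 'rV[C]_a) : sqn (lsubmx (u *m G)) = 0 -> u = 0.
  move=> l0; have := l0; rewrite K => /sqn_eq0 E2; move/sqn_eq0: l0 => E1.
  by apply: (row_free_inj Gf); rewrite mul0mx -[u *m G]hsubmxK E1 E2 row_mx0.
have sqn0 k : sqn (0 : 'rV[C]_k) = 0.
  by apply: big1 => j _; rewrite mxE nm0 expr0n.
rewrite leq_min; apply/andP; split; rewrite leqNgt; apply/negP => lt.
  have [u u0 uG] := nonzero_ker (lsubmx G) lt; move/eqP: u0; apply; apply: Z.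
  by rewrite -mulmx_lsub uG sqn0.
have [u u0 uG] := nonzero_ker (rsubmx G) lt; move/eqP: u0; apply; apply: Z.
by rewrite K -mulmx_rsub uG sqn0.
Qed.

Lemma sig_ext r s t : sign_mx (r + s + t) r s = block_mx (sign_mx (r + s) r s) 0 0 0.
Proof.
apply/matrixP => i j; case: (split_ordP i) => a ->; case: (split_ordP j) => b ->.
- by rewrite block_mxEul !mxE eq_lshift.
- by rewrite block_mxEur !mxE eq_lrshift.
- by rewrite block_mxEdl !mxE eq_rlshift.
- rewrite block_mxEdr !mxE /hsign /= ltnNge -addnA leq_addr /= addnA ltnNge leq_addr.
  by rewrite mul0rn.
Qed.

Lemma hf_ext r s t a b (X : 'M[C]_(a, r + s + t)) (Y : 'M[C]_(b, r + s + t)) :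
  hf (sign_mx (r + s + t) r s) X Y = hf (sign_mx (r + s) r s) (lsubmx X) (lsubmx Y).
Proof.
rewrite /hf sig_ext -{1}[X]hsubmxK mul_row_block !mulmx0 !addr0.
by rewrite -{1}[Y]hsubmxK /ct map_row_mx tr_row_mx mul_row_col mul0mx addr0.
Qed.

End Signature.

(** * Local structure theorem *)

Section LocalStructure.
Variable R : realType.
Local Notation C := R[i].
Local Notation nm := (@ComplexField.Normc.normc R).
Local Notation rC := (@real_complex_def R (Phant R)).

Lemma hdiff_lsubmx n a b (G : 'rV[C]_n -> 'rV[C]_(a + b)) x :
  hdiff G x -> hdiff (fun z => lsubmx (G z)) x.
Proof.
move=> [L HL]; exists (lsubmx L) => e e0; have [d d0 Hd] := HL e e0; exists d; first by [].
by move=> h q qd hq j; have := Hd h q qd hq (lshift b j); rewrite mulmx_lsub !mxE.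
Qed.

Variables (r s r' s' t' : nat) (p0 : 'rV[C]_(r + s)) (rho : R).
Local Notation J := (sign_mx R (r + s) r s).
Local Notation J' := (sign_mx R (r' + s' + t') r' s').
Local Notation inO := (inbox p0 rho).
Variable G : 'rV[C]_(r + s) -> 'rV[C]_(r' + s' + t').
Hypothesis rho0 : 0 < rho.
Hypothesis Gd : forall x, inO x -> hdiff G x.
Hypothesis O0 : ~ inO (0 : 'rV[C]_(r + s)).
Hypothesis orth : forall x y, inO x -> inO y -> hf J x y = 0 -> hf J' (G x) (G y) = 0.
Hypothesis p0_null : hf J p0 p0 = 0.
Hypothesis small : (minn r' s' + 2 <= 2 * minn r s)%N.

Lemma local_structure : (forall z y, inO z -> inO y -> hf J' (G z) (G y) = 0) \/
  exists (Om : 'rV[C]_(r + s) -> Prop) (phi : 'rV[C]_(r + s) -> C) (ka : R)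
      (sg : 'M[C]_(r + s, r' + s' + t')) (N : 'rV[C]_(r + s) -> 'rV[C]_(r' + s' + t')),
    [/\ ka != 0, exists b, Om b, forall z, Om z -> inO z /\ phi z != 0 &
        forall z v, Om z -> exists2 t1, 0 < t1 & forall t : R, 0 < t < t1 -> Om (z + rC t *: v)] /\
    [/\ forall a b (x : 'M[C]_(a, r + s)) (y : 'M[C]_(b, r + s)),
          hf J' (x *m sg) (y *m sg) = rC ka *: hf J x y,
        forall z, Om z -> G z = phi z *: (z *m sg + N z),
        forall z (x : 'rV[C]_(r + s)), Om z -> hf J' (N z) (x *m sg) = 0 &
        forall z w, Om z -> Om w -> hf J' (N z) (N w) = 0].
Proof.
have cJ : ct J = J := ct_sig _ _ _ _; have cJ' : ct J' = J' := ct_sig _ _ _ _.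
(* The radical coordinates are dropped: the form is unchanged, and in the remaining nondegenerate
   space null spaces have dimension at most [minn r' s']. *)
pose g z := lsubmx (G z); pose K := sign_mx R (r' + s') r' s'.
have cK : ct K = K := ct_sig _ _ _ _.
have gd x : inO x -> hdiff g x by move=> Hx; apply: hdiff_lsubmx; exact: Gd.
have HE z y : hf J' (G z) (G y) = hf K (g z) (g y) by exact: hf_ext.
have g_orth x y : inO x -> inO y -> hf J x y = 0 -> hf K (g x) (g y) = 0.
  by rewrite -HE; exact: orth.
have p00 : p0 != 0.
  by apply/eqP => E; apply: O0 => i j; rewrite E !mxE subrr nm0.
have frames d : (0 < d <= minn r s)%N ->
    exists B : 'M[C]_(d, r + s), [/\ row_free B, hf J B B = 0 & (p0 <= B)%MS].
  exact: null_frames.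
have bound a (X : 'M[C]_(a, r + s)) : inO X -> hf J X X = 0 -> row_free (gm g X) ->
    (a <= minn r' s')%N.
  move=> HX XX Xf; apply: (null_free_le Xf).
  apply/matrixP => i j; rewrite hfE !row_gm g_orth; [by rewrite !mxE|exact: inO_row|exact: inO_row|].
  by apply/matrixP => k l; rewrite !ord1 -hfE XX !mxE.
have rs2 : (2 * minn r s <= r + s)%N by lia.
case: (local_factorization cJ (sig_sqr _ _ _) cK rho0 gd O0 g_orth frames bound small rs2).
  by move=> H0; left => z y Hz Hy; rewrite HE; apply: scal00; exact: H0.
move=> [w2 [z0 [Hw2 Hz0 n0 st]]]; right.
have [Om [phi [ka [ka0 Onb HO Hl HH]]]] :=
  hermitian_factor cJ (sig_sqr _ _ _) cK gd O0 g_orth Hw2 Hz0 n0 st.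
have HH' z w : Om z -> Om w -> hf J' (G z) (G w) = (rC ka * phi z * conjc (phi w)) *: hf J z w.
  by move=> Oz Ow; rewrite HE; exact: HH.
have [sg [sgg [N [N1 N2 N3]]]] := isometric_section cJ cJ' Onb HO Hl HH'.
by exists Om, phi, ka, sg, N; split; split.
Qed.

End LocalStructure.

(** * From the topology of row vectors to boxes *)

Local Open Scope classical_set_scope.

Section Topology.
Variable R : realType.
Local Notation C := R[i].
Local Notation nm := (@ComplexField.Normc.normc R).
Local Notation rC := (@real_complex_def R (Phant R)).

(** Balls in ['rV[CC R]_n] have radii in the complex field, whose positive elements are the positive
    reals. *)
Lemma pos_real (e : CC R) : 0 < e -> exists2 d : R, 0 < d & e = rC d.
Proof.
move=> e0; have : 0 < (e : C) by exact: e0.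
case: e e0 => a b _; rewrite ltcE /= => /andP[/eqP b0 a0]; exists a; first exact: a0.
by rewrite b0.
Qed.

Lemma nbhs_inbox n (p : 'rV[CC R]_n) (W : set 'rV[CC R]_n) : nbhs p W ->
  exists2 d : R, 0 < d & forall x : 'rV[CC R]_n, inbox p d x -> W x.
Proof.
move=> /nbhs_ballP[e /= /pos_real[d d0 ->] dW]; exists d; first exact: d0.
move=> x px; apply: dW; split; first by rewrite ltcR.
move=> i j; rewrite -ball_normE /= ord1.
have := px 0 j; rewrite nmC => H.
have -> : `|p 0 j - x 0 j| = rC (nm (p 0 j - x 0 j)) :> C by exact: nm_norm.
by rewrite ltcR.
Qed.

Lemma inbox_refl n (p : 'rV[C]_n) (d : R) : 0 < d -> inbox p d p.
Proof. by move=> d0 i j; rewrite ord1 subrr nm0. Qed.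

Lemma inbox_nbhs n (p : 'rV[CC R]_n) (d : R) : 0 < d ->
  nbhs p [set x : 'rV[CC R]_n | inbox p d x].
Proof.
move=> d0; apply/nbhs_ballP; exists (rC d); first by rewrite /= ltcR.
move=> x [_ px] i j; have := px i j; rewrite -ball_normE /= ord1 nmC => H.
have E : `|p 0 j - x 0 j| = rC (nm (p 0 j - x 0 j)) :> C by exact: nm_norm.
by move: H; rewrite E ltcR.
Qed.

Lemma inbox_open n (p : 'rV[CC R]_n) (d : R) (q : 'rV[CC R]_n) : inbox p d q ->
  exists2 e : R, 0 < e & forall x : 'rV[CC R]_n, inbox q e x -> inbox p d x.
Proof.
move=> pq; have [e e0 He] := inO_near pq; exists e; first exact: e0.
move=> x qx; have -> : x = q + (x - q) by rewrite addrC subrK.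
by apply: He => i j; rewrite !mxE ord1; exact: qx.
Qed.

(** The set [D] of points with a box on which [P] holds is open; by the local hypothesis a point of
    [U] whose box meets [D] belongs to [D], so [D] is also relatively closed. *)
Lemma connected_spread n (U : set 'rV[CC R]_n) (P : 'rV[CC R]_n -> Prop) :
  open U -> connected U ->
  (forall p, U p -> exists2 d : R, 0 < d & (forall x, inbox p d x -> U x) /\
    forall (q : 'rV[CC R]_n) e, inbox p d q -> 0 < e ->
      (forall x : 'rV[CC R]_n, inbox q e x -> P x) -> forall x : 'rV[CC R]_n, inbox p d x -> P x) ->
  (exists p, U p /\ exists2 d : R, 0 < d & forall x : 'rV[CC R]_n, inbox p d x -> P x) ->
  forall x, U x -> P x.
Proof.
move=> Uo Uc key [p0 [Up0 [d0 d00 Pp0]]].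
pose D := [set p | U p /\ exists2 d : R, 0 < d & forall x : 'rV[CC R]_n, inbox p d x -> P x].
have Do : open D.
  rewrite openE => p [Up [d d1 Pp]].
  have [e e0 eU] := nbhs_inbox (open_nbhs_nbhs (conj Uo Up)).
  have := inbox_nbhs p (d := Num.min d e); rewrite lt_min d1 e0 => /(_ isT).
  apply: filterS => q /= pq; split.
    by apply: eU => i j; apply: lt_le_trans (pq i j) _; rewrite ge_min lexx orbT.
  have pq' : inbox p d q.
    by move=> i j; apply: lt_le_trans (pq i j) _; rewrite ge_min lexx.
  have [f f0 fU] := inbox_open pq'; exists f; first exact: f0.
  by move=> x qx; apply: Pp; exact: fU.
have Eo : open (U `\` D).
  rewrite openE => p [Up nDp]; have [d d1 [dU dP]] := key p Up.
  apply: filterS (inbox_nbhs p d1) => q /= pq; split; first exact: dU.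
  move=> [Uq [e e0 Pe]]; apply: nDp; split; first exact: Up.
  by exists d; [exact: d1|exact: (dP q e pq e0 Pe)].
have DU : D = U.
  apply: Uc; first by exists p0; split; [exact: Up0|exists d0].
    by exists D; [exact: Do|apply/seteqP; split=> [x [Ux ?]|x []] //; split].
  exists (~` (U `\` D)); first exact: open_closedC.
  apply/seteqP; split=> [x Dx|x [Ux /= nx]]; first by split; [exact: (proj1 Dx)|case].
  by apply: contrapT => nD; apply: nx.
move=> x; rewrite -DU => -[_ [d d1 Px]]; apply: Px; exact: inbox_refl.
Qed.

Lemma entry_le_norm m (v : 'rV[CC R]_m) j : (nm (v 0 j))%:C%C <= (`|v| : CC R).
Proof.
have -> : (nm (v 0 j))%:C%C = `|v 0 j| :> CC R by exact: esym (nm_norm _).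
rewrite -[`|v|]/(mx_norm v) mx_normE.
exact: (@le_bigmax _ _ _ (0%:nng) (fun i : 'I_1 * 'I_m => `|v i.1 i.2|%:nng) (0, j)).
Qed.

Lemma norm_le_entries m (v : 'rV[CC R]_m) (q : R) : 0 <= q -> (forall j, nm (v 0 j) <= q) ->
  (`|v| : CC R) <= q%:C%C.
Proof.
move=> q0 vq; rewrite -[`|v|]/(mx_norm v) mx_normE.
have q0' : 0 <= (q%:C%C : CC R) by rewrite lecR.
rewrite -[leRHS]/((NngNum q0')%:num) num_le; apply/bigmax_leP; split=> //= -[i j] _.
rewrite -num_le /= ord1.
have -> : `|v 0 j| = (nm (v 0 j))%:C%C :> CC R by exact: nm_norm.
by rewrite lecR.
Qed.

Lemma differentiable_hdiff n m (G : 'rV[CC R]_n -> 'rV[CC R]_m) x : (0 < n)%N ->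
  differentiable G x -> hdiff G x.
Proof.
move=> n0 /diff_locally /eqaddoP Gx; exists (lin1_mx ('d G x)) => e e0.
have e0' : 0 < (e%:C%C : CC R) by rewrite ltcR.
have [d d0 Hd] := nbhs_inbox (Gx _ e0').
exists d; first exact: d0.
move=> h q qd hq j.
have q0 : 0 <= q := le_trans (nm_ge0 _) (hq (Ordinal n0)).
have hd : inbox (0 : 'rV[CC R]_n) d h.
  by move=> i l; rewrite ord1 mxE subr0; apply: le_lt_trans (hq l) qd.
have H : `|G (h + x) - (G x + 'd G x h)| <= e%:C%C * `|h| := Hd h hd.
have := le_trans (entry_le_norm _ j) (le_trans H (ler_wpM2l (ltW e0') (norm_le_entries q0 hq))).
rewrite mul_rV_lin1 [x + h]addrC opprD addrA.
have -> : e%:C%C * q%:C%C = (e * q)%:C%C :> CC R by rewrite rmorphM.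
by rewrite lecR.
Qed.

End Topology.

(** * Spreading holomorphic relations over the domain *)

Section Globalization.
Variable R : realType.
Local Notation C := R[i].
Local Notation nm := (@ComplexField.Normc.normc R).
Local Notation rC := (@real_complex_def R (Phant R)).

Section Vanish.
Variables (n m k : nat) (W : 'rV[C]_n -> 'M[C]_(m, k)).
Hypothesis Wd : forall a b t, mcdiff (fun s => W (a + s *: b)) t.

Lemma box_identity (p0 : 'rV[C]_n) rho (G : 'rV[C]_n -> 'rV[C]_m) (b y : 'rV[C]_n) t1 :
  (forall x, inbox p0 rho x -> hdiff G x) -> inbox p0 rho b -> inbox p0 rho y -> 0 < t1 ->
  (forall t, 0 < t < t1 -> G (b + rC t *: (y - b)) *m W (b + rC t *: (y - b)) = 0) ->
  G y *m W y = 0.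
Proof.
move=> Gd Hb Hy t10 Hz; set v := y - b in Hz; have yE : b + v = y by rewrite addrC subrK.
have Hbv : inbox p0 rho (b + v) by rewrite yE.
have [e e0 He] := inO_line Hb Hbv.
apply/matrixP => i j; rewrite ord1 [RHS]mxE.
pose f s := (G (b + s *: v) *m W (b + s *: v)) 0 j.
have f1 : f 1 = (G y *m W y) 0 j by rewrite /f scale1r yE.
rewrite -f1; apply: (@identity01 R f e t1 e0 t10).
  move=> t w t01 we; apply: (@cdiff_ext _ (fun s => (gm G (b + s *: v) *m W (b + s *: v)) 0 j)).
    by move=> s; rewrite gm_row.
  by apply: mcdiff_mul; [apply: (mcdiff_gm Gd); exact: He|exact: Wd].
by move=> t t01; rewrite /f Hz // mxE.
Qed.

Variables (U : set 'rV[CC R]_n) (F : 'rV[CC R]_n -> 'rV[CC R]_m).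
Hypothesis Udom : proj_domain R n U.
Hypothesis Fhol : proj_holomorphic R n m U F.
Hypothesis n0 : (0 < n)%N.

Lemma local_lift p : U p -> exists2 d : R, 0 < d &
  exists G : 'rV[C]_n -> 'rV[C]_m, forall x : 'rV[C]_n, inbox p d x ->
    [/\ U x, hdiff G x, G x != 0 & exists2 c : C, c != 0 & G x = c *: F x].
Proof.
move=> Up; have [Uo _ _ _ _] := Udom; have [_ lift] := Fhol.
have [W0 [Wp [G GW]]] := lift p Up.
have [d d0 dU] := nbhs_inbox (filterI Wp (open_nbhs_nbhs (conj Uo Up))).
exists d; first exact: d0.
exists G => x px; have [Wx Ux] := dU x px; have [Gx Gx0 [c [c0 cE]]] := GW x Wx Ux.
split; [exact: Ux|exact: (differentiable_hdiff n0 Gx)|exact: Gx0|].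
by exists c; [exact: c0|exact: cE].
Qed.

Lemma lift_vanish (c : C) (x y : 'rV[C]_m) (M : 'M[C]_(m, k)) : c != 0 -> y = c *: x ->
  (y *m M = 0 <-> x *m M = 0).
Proof.
move=> c0 ->; rewrite -scalemxAl; split=> [/eqP|->]; last by rewrite scaler0.
by rewrite scaler_eq0 (negPf c0) => /eqP.
Qed.

(** The relation is linear in the image, hence independent of the lift, while [W] may vary
    holomorphically with the point. With a local lift it spreads across each box, and then over the
    connected [U]. *)
Lemma global_vanish :
  (exists p, U p /\ exists2 d : R, 0 < d & forall x : 'rV[C]_n, inbox p d x -> F x *m W x = 0) ->
  forall x, U x -> F x *m W x = 0.
Proof.
have [Uo Uc _ _ _] := Udom.
apply: (connected_spread Uo Uc (P := fun x => F x *m W x = 0)) => p Up.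
have [d d0 [G HG]] := local_lift Up; exists d; first exact: d0.
split; first by move=> x /HG[].
move=> q e pq e0 qz x px.
have Gd y : inbox p d y -> hdiff G y by move=> /HG[].
have [t1 t10 Ht1] := small_line (x - q) (inbox_refl q e0).
have [t2 t20 Ht2] := small_line (x - q) pq.
have [_ _ _ [c c0 cE]] := HG x px; apply/(lift_vanish _ c0 cE).
apply: (@box_identity p d G q x (Num.min t1 t2)) => //; first by rewrite lt_min t10.
move=> t; rewrite lt_min => /and3P[ta tb tc].
have Hq := Ht1 t (introT andP (conj ta tb)); have Hp := Ht2 t (introT andP (conj ta tc)).
have [_ _ _ [c' c'0 c'E]] := HG _ Hp; apply/(lift_vanish _ c'0 c'E).
exact: qz.
Qed.

End Vanish.

End Globalization.

(** * Orthogonal projection and globalization *)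

Section Idempotent.
Variables (F : fieldType) (m : nat) (P : 'M[F]_m).
Hypothesis PP : P *m P = P.

Lemma idem_compl : (1%:M - P) *m (1%:M - P) = 1%:M - P.
Proof. by rewrite mulmxBl !mulmxBr !mul1mx mulmx1 PP subrr subr0. Qed.

Lemma idem_cap : (P :&: (1%:M - P) = 0)%MS.
Proof.
apply/eqP; rewrite -submx0; apply/rV_subP => v; rewrite sub_capmx => /andP[/submxP[a ->]].
move=> /submxP[b aE]; rewrite -PP mulmxA aE mulmxBr mulmx1 mulmxBl -mulmxA PP subrr.
exact: sub0mx.
Qed.

Lemma idem_sum : (P + (1%:M - P) :=: 1%:M)%MS.
Proof.
apply/eqmxP/andP; split; first exact: submx1.
rewrite -{1}[1%:M](subrK P) addrC; apply: addmx_sub; first exact: addsmxSl.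
exact: addsmxSr.
Qed.

Lemma idem_proj : proj_mx P (1%:M - P) = P.
Proof.
rewrite -[LHS]mul1mx -{1}[1%:M](subrK P) addrC mulmxDl.
by rewrite (proj_mx_id idem_cap) // (proj_mx_0 idem_cap) // addr0.
Qed.

End Idempotent.

Lemma parallelP (F : fieldType) m (u w : 'rV[F]_m) : w != 0 ->
  (forall i j, u 0 i * w 0 j = u 0 j * w 0 i) -> exists l, u = l *: w.
Proof.
move=> /matrix0Pn[i0 [j]]; rewrite ord1 => wj H; exists (u 0 j / w 0 j).
apply/rowP => i; rewrite mxE; apply: (mulIf wj); rewrite H mulrAC divfK //.
Qed.

Section Projector.
Variable R : realType.
Local Notation C := R[i].
Local Notation rC := (@real_complex_def R (Phant R)).
Variables (n m : nat) (J : 'M[C]_n) (J' : 'M[C]_m) (sg : 'M[C]_(n, m)) (ka : R).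
Hypothesis ctJ : ct J = J.
Hypothesis JJ : J *m J = 1%:M.
Hypothesis ctJ' : ct J' = J'.
Hypothesis ka0 : ka != 0.
Hypothesis sgg : forall a b (x : 'M[C]_(a, n)) (y : 'M[C]_(b, n)),
  hf J' (x *m sg) (y *m sg) = rC ka *: hf J x y.

(** The orthogonal projection onto the row space of [sg], whose Gram matrix [ka *: J] has inverse
    [ka^-1 *: J]. *)
Definition oproj : 'M[C]_m := (rC ka)^-1 *: (J' *m ct sg *m J *m sg).

Lemma kaC0 : rC ka != 0. Proof. by rewrite -nm_gt0 nm_real normr_gt0. Qed.

Lemma sg_gram : sg *m J' *m ct sg = rC ka *: J.
Proof. by have := sgg 1%:M 1%:M; rewrite !mul1mx /hf mul1mx ct1 mulmx1. Qed.

Lemma sg_oproj : sg *m oproj = sg.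
Proof.
rewrite /oproj -scalemxAr !mulmxA sg_gram -!scalemxAl JJ mul1mx scalerA mulVf ?kaC0 //.
by rewrite scale1r.
Qed.

Lemma oproj_idem : oproj *m oproj = oproj.
Proof. by rewrite {1}/oproj -scalemxAl -mulmxA sg_oproj. Qed.

Lemma oproj_adj : oproj *m J' *m ct sg = J' *m ct sg.
Proof.
rewrite /oproj -!scalemxAl -!mulmxA [sg *m _]mulmxA sg_gram -!scalemxAr scalerA mulVf ?kaC0 //.
by rewrite scale1r JJ mulmx1.
Qed.

Lemma oproj_compl_orth a b (v : 'M[C]_(a, m)) (x : 'M[C]_(b, n)) :
  hf J' (v *m (1%:M - oproj)) (x *m sg) = 0.
Proof.
rewrite hfMl hfMr; have -> : hf J' (1%:M - oproj) sg = 0.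
  by rewrite /hf !mulmxBl mul1mx oproj_adj subrr.
by rewrite mul0mx mulmx0.
Qed.

Lemma oproj_perp a (v : 'M[C]_(a, m)) : hf J' v sg = 0 -> v *m oproj = 0.
Proof. by rewrite /hf /oproj -scalemxAr !mulmxA => ->; rewrite !mul0mx scaler0. Qed.

Lemma sg_inj a (x : 'M[C]_(a, n)) : x *m sg = 0 -> x = 0.
Proof.
move=> x0; have : x *m sg *m J' *m ct sg *m J = 0 by rewrite x0 !mul0mx.
rewrite -!mulmxA [J' *m _]mulmxA [sg *m _]mulmxA [sg *m (_ *m _)]mulmxA sg_gram.
rewrite -scalemxAl JJ -scalemxAr mulmx1 => /eqP; rewrite scaler_eq0 (negPf kaC0).
by move=> /eqP.
Qed.

End Projector.

Section Global.
Variable R : realType.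
Local Notation C := R[i].
Local Notation nm := (@ComplexField.Normc.normc R).
Local Notation rC := (@real_complex_def R (Phant R)).
Variables (r s r' s' t' : nat).
Local Notation n := (r + s)%N.
Local Notation m := (r' + s' + t')%N.
Local Notation J := (sign_mx R n r s).
Local Notation J' := (sign_mx R m r' s').
Variables (U : set 'rV[CC R]_n) (F : 'rV[CC R]_n -> 'rV[CC R]_m).
Hypothesis Udom : proj_domain R n U.
Hypothesis Fhol : proj_holomorphic R n m U F.
Hypothesis Forth : local_orthogonal R r s r' s' t' U F.
Hypothesis small : (minn r' s' + 2 <= 2 * minn r s)%N.

Lemma hf_herm N a b (z w : 'rV[C]_N) : herm R N a b z w = 0 -> hf (sign_mx R N a b) z w = 0.
Proof. by rewrite hermE; exact: scal00. Qed.

(** The [(i, j)] minor of the rows [v *m P] and [y *m sg], written as a functional of [v]: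
    proportionality of the two rows thereby takes the shape required by [global_vanish]. *)
Definition minor_mx (P : 'M[C]_m) (sg : 'M[C]_(n, m)) i j (y : 'rV[C]_n) : 'M[C]_(m, 1) :=
  (y *m sg) 0 j *: col i P - (y *m sg) 0 i *: col j P.

Lemma minor_mxE (P : 'M[C]_m) (sg : 'M[C]_(n, m)) i j (y : 'rV[C]_n) (v : 'rV[C]_m) :
  v *m minor_mx P sg i j y =
    ((v *m P) 0 i * (y *m sg) 0 j - (v *m P) 0 j * (y *m sg) 0 i)%:M.
Proof.
rewrite /minor_mx mulmxBr -!scalemxAr !colE !mulmxA -!colE.
move: (v *m P) (y *m sg) => u w; apply/matrixP => a b; rewrite !ord1 !mxE eqxx mulr1n.
by congr (_ - _); exact: mulrC.
Qed.

Lemma minor_mxd (P : 'M[C]_m) (sg : 'M[C]_(n, m)) i j (a b : 'rV[C]_n) t :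
  mcdiff (fun x => minor_mx P sg i j (a + x *: b)) t.
Proof.
have D k : cdiff (fun x => ((a + x *: b) *m sg) 0 k) t.
  by apply: mcdiff_mul; [exact: mcdiff_affine|exact: mcdiff_const].
by apply: mcdiff_sub; apply: mcdiff_scale; [exact: D|exact: mcdiff_const|exact: D|exact: mcdiff_const].
Qed.

Lemma global_structure : (exists p, U p /\ herm R n r s p p = 0) ->
  (exists k (M : 'M[C]_(k, m)), hf J' M M = 0 /\ forall x, U x -> (F x <= M)%MS) \/
  exists (ka : R) (sg : 'M[C]_(n, m)) k (N : 'M[C]_(k, m)),
    [/\ ka != 0, forall a b (x : 'M[C]_(a, n)) (y : 'M[C]_(b, n)),
          hf J' (x *m sg) (y *m sg) = rC ka *: hf J x y,
        N *m oproj J J' sg ka = 0 & hf J' N N = 0] /\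
    [/\ forall x, U x -> (F x *m (1%:M - oproj J J' sg ka) <= N)%MS,
        forall x, U x -> exists l, F x *m oproj J J' sg ka = l *: (x *m sg) &
        exists p, U p /\ F p *m oproj J J' sg ka != 0].
Proof.
move=> [p0 [Up0 /hf_herm p00]].
have [Uo Uc _ U0 _] := Udom.
have n0 : (0 < n)%N by move: small; lia.
have [d d0 [G HG]] := local_lift Udom Fhol n0 Up0.
have Gd x : inbox p0 d x -> hdiff G x by move=> /HG[].
have O0 : ~ inbox p0 d (0 : 'rV[C]_n) by move=> /HG[].
have Gorth x y : inbox p0 d x -> inbox p0 d y -> hf J x y = 0 -> hf J' (G x) (G y) = 0.
  move=> /HG[Ux _ _ [c _ ->]] /HG[Uy _ _ [c' _ ->]] xy.
  have Fxy : herm R n r s x y = 0 by rewrite hermE xy mxE.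
  have {}Fxy : hf J' (F x) (F y) = 0 by apply: hf_herm; exact: (Forth Ux Uy Fxy).
  by rewrite hfZl hfZr Fxy !scaler0.
have FG k (M : 'M[C]_(m, k)) x : inbox p0 d x -> (F x *m M = 0 <-> G x *m M = 0).
  by move=> /HG[_ _ _ [c c0 cE]]; rewrite (lift_vanish M c0 cE).
case: (local_structure d0 Gd O0 Gorth p00 small) => [Gnull|].
  left; have [k [M [_ MG Msp]]] := span_set (fun v => exists2 z, inbox p0 d z & v = G z).
  exists k, M; split.
    apply/matrixP => i j; rewrite hfE [RHS]mxE.
    have [z Hz ->] := MG i; have [y Hy ->] := MG j.
    by rewrite Gnull // mxE.
  (* Membership in the row space of [M] is the relation with constant matrix [cokermx M]. *)
  have Wd (a b : 'rV[C]_n) t : mcdiff (fun _ : C => cokermx M) t.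
    exact: mcdiff_const.
  have K := @global_vanish R n m _ (fun=> cokermx M) Wd U F Udom Fhol n0.
  move=> x Ux; rewrite submxE; apply/eqP; apply: K x Ux.
  exists p0; split; first exact: Up0.
  exists d; first exact: d0.
  move=> y Hy; apply/(FG _ _ _ Hy); apply/eqP; rewrite -submxE; apply: Msp.
  by exists y.
move=> [Om [phi [ka [sg [N [[ka0 [b Ob] HO Hl] [sgg GE N1 N2]]]]]]].
right; set P := oproj J J' sg ka.
have cJ : ct J = J := ct_sig _ _ _ _; have cJ' : ct J' = J' := ct_sig _ _ _ _.
have JJ : J *m J = 1%:M := sig_sqr _ _ _.
have sgP : sg *m P = sg := sg_oproj JJ ka0 sgg.
have PP : P *m P = P := oproj_idem JJ ka0 sgg.
have NP z : Om z -> N z *m P = 0.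
  move=> Oz; apply: oproj_perp; apply: (@ct_inj R _ _); rewrite ct0.
  apply/row_matrixP => i; rewrite row0 (ct_hf cJ') rowE -hfMl.
  by apply: (@ct_inj R _ _); rewrite (ct_hf cJ') ct0; exact: N1.
have [k [M [_ MN Msp]]] := span_set (fun v => exists2 z, Om z & v = N z).
have GP z : Om z -> G z *m P = phi z *: (z *m sg).
  by move=> Oz; rewrite GE // -scalemxAl mulmxDl NP // addr0 -mulmxA sgP.
have GP' z : Om z -> G z *m (1%:M - P) = phi z *: N z.
  by move=> Oz; rewrite mulmxBr mulmx1 GP // GE // -scalerBr addrC addKr.
(* a relation holding on [Om] spreads along segments to the box, then over [U] by connectedness *)
have spread l (W : 'rV[C]_n -> 'M[C]_(m, l)) : (forall a b t, mcdiff (fun s => W (a + s *: b)) t) ->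
    (forall z, Om z -> G z *m W z = 0) -> forall x, U x -> F x *m W x = 0.
  move=> Wd WO; apply: (global_vanish Wd Udom Fhol n0); exists p0; split; first exact: Up0.
  exists d; first exact: d0.
  move=> y Hy; apply/(FG _ _ _ Hy); have [t1 t10 Ht1] := Hl b (y - b) Ob.
  have [Hb _] := HO b Ob.
  by apply: (box_identity Wd Gd Hb Hy t10) => t t01; apply: WO; exact: Ht1.
exists ka, sg, k, M; split; split.
- exact: ka0.
- exact: sgg.
- by apply/row_matrixP => i; rewrite row_mul row0; have [z Oz ->] := MN i; exact: NP.
- apply/matrixP => i j; rewrite hfE [RHS]mxE.
  by have [z Oz ->] := MN i; have [w Ow ->] := MN j; rewrite N2 // mxE.
- have Wd (a c : 'rV[C]_n) t : mcdiff (fun _ : C => (1%:M - P) *m cokermx M) t.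
    exact: mcdiff_const.
  move=> x Ux; rewrite submxE -mulmxA; apply/eqP.
  apply: (spread _ (fun=> (1%:M - P) *m cokermx M) Wd _ x Ux) => z Oz.
  rewrite mulmxA GP' // -scalemxAl; apply/eqP; rewrite scaler_eq0; apply/orP; right.
  by rewrite -submxE; apply: Msp; exists z.
- move=> x Ux; apply: parallelP.
    apply/eqP => xs; apply: U0; rewrite -(sg_inj JJ ka0 sgg xs); exact: Ux.
  move=> i j; apply/eqP; rewrite -subr_eq0; apply/eqP.
  have := spread _ (minor_mx P sg i j) (@minor_mxd P sg i j) _ x Ux.
  rewrite minor_mxE => /(_ _)/matrixP/(_ 0 0); rewrite !mxE eqxx mulr1n; apply.
  by move=> z Oz; rewrite minor_mxE GP // !mxE; apply/matrixP => a c; rewrite !mxE; ring.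
- exists b; have [Hb fb] := HO b Ob; have [Ub _ _ [c c0 cE]] := HG b Hb; split; first exact: Ub.
  apply/eqP => /(proj1 (FG _ P _ Hb)); rewrite GP // => /eqP.
  rewrite scaler_eq0 (negPf fb) /= => /eqP bs.
  by apply: U0; rewrite -(sg_inj JJ ka0 sgg bs).
Qed.

End Global.

(** * Splitting of the target and conclusion *)

Section Conclusion.
Variable R : realType.
Local Notation C := R[i].
Local Notation nm := (@ComplexField.Normc.normc R).
Local Notation rC := (@real_complex_def R (Phant R)).
Variables (r s r' s' t' : nat).
Local Notation n := (r + s)%N.
Local Notation m := (r' + s' + t')%N.
Local Notation J := (sign_mx R n r s).
Local Notation J' := (sign_mx R m r' s').

Lemma hf_null_space k (M : 'M[C]_(k, m)) : hf J' M M = 0 -> null_space R m r' s' k M.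
Proof.
move=> MM x y /submxP[a ->] /submxP[b ->].
by rewrite hermE hfMl hfMr MM mul0mx mulmx0 mxE.
Qed.

Variables (U : set 'rV[CC R]_n) (F : 'rV[CC R]_n -> 'rV[CC R]_m).
Variables (ka : R) (sg : 'M[C]_(n, m)) (k : nat) (N : 'M[C]_(k, m)).
Local Notation P := (oproj J J' sg ka).
Hypothesis ka0 : ka != 0.
Hypothesis sgg : forall a b (x : 'M[C]_(a, n)) (y : 'M[C]_(b, n)),
  hf J' (x *m sg) (y *m sg) = rC ka *: hf J x y.
Hypothesis NP : N *m P = 0.
Hypothesis NN : hf J' N N = 0.
Hypothesis FN : forall x, U x -> (F x *m (1%:M - P) <= N)%MS.
Hypothesis Fsg : forall x, U x -> exists l, F x *m P = l *: (x *m sg).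

(** The null component pairs to zero with itself and with the image of [sg], so only [nm l ^ 2 * ka]
    times the source value remains: the sign of [ka] decides whether signs are preserved. *)
Lemma herm_image x : U x -> exists2 l : R, 0 <= l &
  herm R m r' s' (F x) (F x) = rC (l * ka) * herm R n r s x x.
Proof.
move=> Ux; have [l lE] := Fsg Ux; exists (nm l ^+ 2); first exact: sqr_ge0.
have [D DE] := submxP (FN Ux).
have FE : F x = l *: (x *m sg) + D *m N by rewrite -lE -DE -mulmxDr addrC subrK mulmx1.
have Nsg : hf J' N sg = 0.
  have := oproj_compl_orth (sig_sqr R r s) ka0 sgg N 1%:M.
  by rewrite mul1mx mulmxBr mulmx1 NP subr0.
have ew : hf J' (D *m N) (x *m sg) = 0 by rewrite hfMl hfMr Nsg mul0mx mulmx0.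
have we : hf J' (x *m sg) (D *m N) = 0 by rewrite -(ct_hf (ct_sig _ _ _ _)) ew ct0.
have ee : hf J' (D *m N) (D *m N) = 0 by rewrite hfMl hfMr NN mul0mx mulmx0.
rewrite !hermE FE hfDl !hfDr !hfZl !hfZr we ew ee !scaler0 !addr0 sgg !scalerA ?[conjc l * l]mulrC mul_conj.
by rewrite mxE [in RHS]rmorphM.
Qed.

Lemma induced_scale (c : C) (G : 'rV[C]_n -> 'rV[C]_m) : c != 0 ->
  (forall p, U p -> exists l, G p = l *: (p *m sg)) ->
  (exists p, U p /\ G p != 0) -> induced_by R n m U G (c *: sg).
Proof.
move=> c0 Gsg [p [Up Gp]]; split.
  exists p; split; [exact: Up|split; first exact: Gp].
  have [l E] := Gsg p Up; rewrite -scalemxAr; apply: contra_neq Gp => /eqP.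
  by rewrite scaler_eq0 (negPf c0) E => /eqP ->; rewrite scaler0.
move=> x Ux Gx0 _; have [l E] := Gsg x Ux.
have l0 : l != 0 by apply: contra_neq Gx0 => l0; rewrite E l0 scale0r.
exists (c / l); split; first by rewrite mulf_neq0 // invr_eq0.
by rewrite E scalerA divfK // scalemxAr.
Qed.

Hypothesis Fnz : exists p, U p /\ F p *m P != 0.

(** If the projection is the identity, the complement is zero and [F] itself is linear. The scalar
    [c] is free because the induced map is projective: [1] serves for linearity, the inverse square
    root of [ka] for isometry. *)
Lemma decomposition (c : C) : c != 0 -> induced_by R n m U F (c *: sg) \/
  exists A B, orth_decomp R r' s' t' A B /\
    ((c *: sg <= A)%MS /\ induced_by R n m U (fun p => F p *m proj_mx A B) (c *: sg)) /\
    null_into R n r' s' t' U A B F.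
Proof.
move=> c0; have JJ : J *m J = 1%:M := sig_sqr _ _ _.
have PP : P *m P = P := oproj_idem JJ ka0 sgg.
have indP : induced_by R n m U (fun p => F p *m P) (c *: sg) by exact: induced_scale.
case: (eqVneq P 1%:M) => [P1|P1].
  left; have -> : F = (fun p => F p *m P) by apply/funext => p; rewrite P1 mulmx1.
  exact: indP.
right; exists P, (1%:M - P).
have QP : proj_mx (1%:M - P) P = 1%:M - P.
  have {2}-> : P = 1%:M - (1%:M - P) by rewrite opprB addrC subrK.
  exact: idem_proj (idem_compl PP).
split; last split.
- split; [exact: idem_sum|exact: idem_cap| | |].
  + have [p [_ n0]] := Fnz; apply: contra_neq n0 => ->; exact: mulmx0.
  + by apply: contra_neq P1 => /eqP; rewrite subr_eq0 => /eqP.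
  + move=> a b /submxP[x ->] /submxP[y ->]; rewrite hermE -(ct_hf (ct_sig _ _ _ _)).
    have -> : x *m P = (rC ka)^-1 *: (x *m (J' *m ct sg *m J)) *m sg.
      by rewrite /oproj -scalemxAr -scalemxAl !mulmxA.
    by rewrite (oproj_compl_orth JJ ka0 sgg) ct0 mxE.
- split; last by rewrite idem_proj.
  by apply: scalemx_sub; rewrite -{1}(sg_oproj JJ ka0 sgg) submxMl.
- exists k, N; split; last split.
  + have {1}-> : N = N *m (1%:M - P) by rewrite mulmxBr mulmx1 NP subr0.
    exact: submxMl.
  + exact: hf_null_space.
  + by move=> x Ux; rewrite QP; exact: FN.
Qed.

End Conclusion.

Lemma normalized_isometry (R : realType) (r s r' s' t' : nat) (ka : R)
    (sg : 'M[CC R]_(r + s, r' + s' + t')) : 0 < ka ->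
  (forall a b (x : 'M[CC R]_(a, r + s)) (y : 'M[CC R]_(b, r + s)),
    hf (sign_mx R (r' + s' + t') r' s') (x *m sg) (y *m sg) = ka%:C%C *: hf (sign_mx R (r + s) r s) x y) ->
  isometry_mx R r s r' s' t' ((Num.sqrt ka)^-1%:C%C *: sg).
Proof.
move=> ka0 sgg u v; rewrite !hermE -!scalemxAr hfZl hfZr conjc_real sgg !scalerA -!rmorphM /=.
have -> : (Num.sqrt ka)^-1 / Num.sqrt ka * ka = 1.
  by rewrite -invfM -expr2 sqr_sqrtr ?ltW // mulVf ?gt_eqF.
by rewrite rmorph1 scale1r.
Qed.

Theorem mainTheorem12 (R : realType) (r s r' s' t' : nat)
    (U : set 'rV[CC R]_(r + s))
    (F : 'rV[CC R]_(r + s) -> 'rV[CC R]_(r' + s' + t')) :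
  proj_domain R (r + s) U ->
  (exists p, U p /\ herm R (r + s) r s p p = 0) ->
  proj_holomorphic R (r + s) (r' + s' + t') U F ->
  local_orthogonal R r s r' s' t' U F ->
  (minn r' s' + 2 <= 2 * minn r s)%N ->
  (null_map R (r + s) r' s' t' U F \/ quasi_linear R r s r' s' t' U F) /\
  ((exists p, U p /\ 0 < herm R (r + s) r s p p /\ 0 < herm R (r' + s' + t') r' s' (F p) (F p)) \/
   (exists p, U p /\ herm R (r + s) r s p p < 0 /\ herm R (r' + s' + t') r' s' (F p) (F p) < 0) ->
   quasi_standard R r s r' s' t' U F).
Proof.
move=> Udom Unull Fhol Forth small.
case: (global_structure Udom Fhol Forth small Unull) => [[k [M [MM FM]]]|].
  have Mnull := hf_null_space MM; split; first by left; exists k, M.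
  (* All values of the form on a null image are zero, so the sign hypothesis of the second half
     cannot hold. *)
  by case=> [[p [Up [_]]]|[p [Up [_]]]]; rewrite (Mnull _ _ (FM p Up) (FM p Up)) ltxx.
move=> [ka [sg [k [N [[ka0 sgg NP NN] [FN Fsg Fnz]]]]]].
have dec := decomposition ka0 sgg NP NN FN Fsg Fnz.
split.
  right; case: (dec 1 (oner_neq0 _)) => [ind|[A [B [AB [[sA ind] BN]]]]].
    by left; exists (1 *: sg).
  by right; exists A, B; split; [exact: AB|split; [exists (1 *: sg)|exact: BN]].
move=> Fpos; have {Fpos} kp : 0 < ka.
  (* The sign [e] treats positive and negative points at once. *)
  have conc x (e : R) : U x -> e = 1 \/ e = -1 -> 0 < e%:C%C * herm R _ r s x x ->
      0 < e%:C%C * herm R _ r' s' (F x) (F x) -> 0 < ka.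
    move=> Ux e1 hx hF; have [l l0 lE] := herm_image ka0 sgg NP NN FN Fsg Ux.
    have hF' : 0 < (l * ka)%:C%C * (e%:C%C * herm R _ r s x x) by rewrite mulrCA -lE.
    have {}hF' : 0 < ((l * ka)%:C%C : CC R) by rewrite -(pmulr_lgt0 _ hx).
    have lk : 0 < l * ka by rewrite -ltcR.
    rewrite lt_def ka0 leNgt; apply/negP => kn.
    by move: lk; rewrite ltNge mulr_ge0_le0 // ltW.
  case: Fpos => [[p [Up [hp hFp]]]|[p [Up [hp hFp]]]].
    by apply: (conc p 1 Up); [left|rewrite rmorph1 mul1r|rewrite rmorph1 mul1r].
  by apply: (conc p (-1) Up); [right|rewrite rmorphN1 mulN1r oppr_gt0|rewrite rmorphN1 mulN1r oppr_gt0].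
have iso := normalized_isometry kp sgg.
have c0 : (Num.sqrt ka)^-1%:C%C != 0 :> R[i].
  by rewrite -nm_gt0 nm_real normr_gt0 invr_eq0 gt_eqF // sqrtr_gt0.
case: (dec _ c0) => [ind|[A [B [AB [[sA ind] BN]]]]].
  by left; exists ((Num.sqrt ka)^-1%:C%C *: sg).
right; exists A, B; split; [exact: AB|split; last exact: BN].
by exists ((Num.sqrt ka)^-1%:C%C *: sg).
Qed.
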